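(* There is some $n_0$ such that the following holds for each $n\geq n_0$. Let $D_0$ be a digraph with vertex set $[n]$ and let $X\subset V(D_0)$, with $|X|\leq n^{3/4}$, be such that $D_0$ is pseudorandom with exceptional set $X$. Let $C$ be an $n$-vertex oriented cycle and let $P\subset C$ be a path with length at most $n/10$. Let $f:X\to V(P)$ be an injection such that the vertices in $f(X)$ are pairwise at least $20\log n/\log\log n$ apart on $P$, and let $D_1=D(n,\log n/(10^3n))$. Then, with probability at least $1-2\exp(-2n)$, $D_0\cup D_1$ contains a copy of $C$ in which $f(x)$ is copied to $x$ for each $x\in X$.
   Context: A digraph has a vertex set and a set of edges which are ordered pairs of distinct vertices. For a digraph $D$, $v\in V(D)$, $B\subset V(D)$ and $\diamond\in\{+,-\}$, $N^+_D(v)$ and $N^-_D(v)$ are the sets of out- and in-neighbours of $v$, $d^\diamond(v,B)=|N^\diamond_D(v)\cap B|$, and $\Delta^\pm(D)$ are the maximum out- and in-degrees. A statement with $\pm$ is asserted both for $+$ and for $-$. Given an $n$-vertex digraph $D$ and $X\subset V(D)$, $D$ is pseudorandom with exceptional set $X$ if: (1) $\Delta^\pm(D)\leq 100\log n$; (2) for each $v\in V(D)$, $d^\pm(v,V(D)\setminus X)\geq \log n/500$; (3) for any sets $A,B\subset V(D)$ and $\diamond\in\{-,+\}$ with $|A|\leq n\log\log n/\log n$ and such that $d^\diamond(v,B)\geq(\log n)^{2/3}$ for each $v\in A$, we have $|B|\geq |A|(\log n)^{1/3}$. $D(n,p)$ is the binomial random digraph with vertex set $[n]=\{1,\ldots,n\}$,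 in which each possible directed edge is included independently with probability $p$. An oriented cycle is a digraph formed by orienting each edge of an undirected cycle. A path in $C$ is a path of its underlying undirected cycle (with the inherited orientations); its length is its number of edges, and distances on $P$ are measured in the underlying undirected path. A copy of $C$ in $D$ in which $f(x)$ is copied to $x$ means the image of an injective map $V(C)\to V(D)$ that sends directed edges of $C$ to directed edges of $D$ and maps $f(x)$ to $x$. Logarithms are natural. *)

(* Defs.v *)
From HB Require Import structures.
From mathcomp Require Import all_boot all_order all_algebra.
From mathcomp Require Import reals sequences exp.

Set Implicit Arguments.
Unset Strict Implicit.
Unset Printing Implicit Defensive.

Import Order.TTheory GRing.Theory Num.Theory.

Local Open Scope ring_scope.

(* The vertex set of a digraph is the whole finite type V. *)
Record digraph (V : finType) := Digraph {
  edges :> {set V * V};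
  _ : [forall v, (v, v) \notin edges]
}.

HB.instance Definition _ (V : finType) := [isSub for @edges V].
HB.instance Definition _ (V : finType) := [Finite of digraph V by <:].

Definition edge (V : finType) (D : digraph V) : rel V :=
  fun u v => (u, v) \in edges D.

Lemma dunion_subproof (V : finType) (D1 D2 : digraph V) :
  [forall v, (v, v) \notin edges D1 :|: edges D2].
Proof.
case: D1 D2 => [E1 /forallP h1] [E2 /forallP h2] /=.
by apply/forallP => v; rewrite inE negb_or h1 h2.
Qed.

Definition dunion (V : finType) (D1 D2 : digraph V) : digraph V :=
  Digraph (dunion_subproof D1 D2).

Variant sign := Plus | Minus.

Definition nbhd (V : finType) (D : digraph V) (s : sign) (v : V) : {set V} :=
  match s with
  | Plus => [set u | edge D v u]
  | Minus => [set u | edge D u v]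
  end.

Definition deg_in (V : finType) (D : digraph V) (s : sign) (v : V)
  (B : {set V}) : nat := #|nbhd D s v :&: B|.

Definition max_deg (V : finType) (D : digraph V) (s : sign) : nat :=
  (\max_(v : V) #|nbhd D s v|)%N.

Definition pseudorandom (R : realType) (V : finType) (D : digraph V)
    (X : {set V}) : Prop :=
  let n : R := #|V|%:R in
  [/\ forall s, (max_deg D s)%:R <= 100 * ln n,
      forall s v, ln n / 500 <= (deg_in D s v (~: X))%:R
    & forall (A B : {set V}) (s : sign),
        #|A|%:R <= n * ln (ln n) / ln n ->
        (forall v, v \in A -> ln n `^ (2 / 3) <= (deg_in D s v B)%:R) ->
        #|A|%:R * ln n `^ (1 / 3) <= #|B|%:R].

(* The law of the binomial random digraph D(V, p), as a probability mass
   function: a product of Bernoulli(p) weights over all ordered pairs of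
   distinct vertices. *)
Definition random_digraph_pmf (R : realType) (V : finType) (p : R)
    (D : digraph V) : R :=
  \prod_(e : V * V | e.1 != e.2) (if e \in edges D then p else 1 - p).

Definition random_digraph_prob (R : realType) (V : finType) (p : R)
    (E : pred (digraph V)) : R :=
  \sum_(D : digraph V | E D) random_digraph_pmf p D.

Lemma random_digraph_prob_total (R : realType) (V : finType) (p : R) :
  random_digraph_prob (V := V) p predT = 1.
Proof.
pose F (e : V * V) : R := if e.1 != e.2 then p else 0.
pose G (e : V * V) : R := if e.1 != e.2 then 1 - p else 1.
have FG e : F e + G e = 1 by rewrite /F /G; case: ifP; rewrite ?subrKC ?add0r.
have <- : \prod_(e : V * V) (F e + G e) = 1 by apply: big1.
rewrite bigA_distr /random_digraph_prob.
pose loopless := [pred E : {set V * V} | [forall v, (v, v) \notin E]].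
rewrite (bigID loopless) /= [X in _ + X]big1 ?addr0; last first.
  move=> E; rewrite negb_forall => /existsP[v]; rewrite negbK => vE.
  by rewrite (bigD1 (v, v)) //= vE /F eqxx mul0r.
rewrite (reindex_omap (@edges V) insub) /=; last first.
  by move=> E hE; rewrite insubT.
apply: eq_big => [D|D _].
  by rewrite /= valK eqxx andbT; case: D.
rewrite /random_digraph_pmf [RHS](bigID (fun e : V * V => e.1 != e.2)) /=.
rewrite [X in _ * X]big1 ?mulr1.
  by apply: eq_bigr => e ne; rewrite /F /G ne.
case: D => E /= /forallP hE [u v] /=; rewrite negbK => /eqP->.
by rewrite (negbTE (hE v)) /G /= eqxx.
Qed.

Definition uedge (V : finType) (D : digraph V) : rel V :=
  fun u v => edge D u v || edge D v u.

(* e is the adjacency relation of an undirected cycle through all of V. *)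
Definition cycle_graph (V : finType) (e : rel V) : Prop :=
  exists s : seq V,
    [/\ uniq s, (2 < size s)%N, forall v, v \in s
      & forall u v, e u v = (v == next s u) || (u == next s v)].

Definition oriented_cycle (V : finType) (C : digraph V) : Prop :=
  cycle_graph (uedge C) /\ (forall u v, ~~ (edge C u v && edge C v u)).

(* A path in the underlying undirected graph of D is given by the sequence of
   its vertices, in order along the path. *)
Definition path_in (V : finType) (D : digraph V) (P : seq V) : bool :=
  [&& P != [::], uniq P & sorted (uedge D) P].

Definition path_length (V : finType) (P : seq V) : nat := (size P).-1.

Definition path_dist (V : finType) (P : seq V) (u v : V) : nat :=
  `|index u P - index v P|%N.

Definition has_copy (V W : finType) (D : digraph V) (C : digraph W)
    (X : {set V}) (f : V -> W) : bool :=
  [exists phi : {ffun W -> V},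
    [&& injectiveb phi,
        [forall u, forall v, edge C u v ==> edge D (phi u) (phi v)]
      & [forall x in X, phi (f x) == x]]].

(* Main.v *)
Require Import Defs.
From mathcomp Require Import all_boot all_order all_algebra.
From mathcomp Require Import reals sequences exp.
From mathcomp Require Import boolp zify ring lra.

(** Write [L] for [ln n].  Symmetrizing the random digraph pair by pair
    (McDiarmid's coupling) can only decrease the probability of a copy, provided
    [p] is halved; so the random edges may be taken undirected, and the two bits
    of each pair give two independent rounds of exposure.

    Outside an event of probability [exp (- 2 n)] the first round [G] has an edge
    between any two disjoint sets of sizes [10^5 n / L] and [n / 10].  Then [G]
    expands on the complement of [X] and of a set [Bad] of [O(n / L)] vertices.
    By the pseudorandomness of [D0], the bad vertices fall into [O(L / ln L)]
    levels such that every vertex of [X] or [Bad] has many in- and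
    out-neighbours in [D0] that lie outside [X] and have lower level; from such
    a vertex one descends in [D0], with any prescribed orientations, to a vertex
    where [G] expands.  A Hall-type condition, maintained as in the theorem of
    Friedman and Pippenger, reserves disjoint neighbours for all these descents
    and afterwards yields vertex-disjoint connecting paths of any prescribed
    length of at least [O(L / ln L)] in [G].  This gives one path of length at
    most [n / 2] that contains [X] and [Bad], fits the orientations of [C], and
    has the vertices of [X] at their places; the remaining vertices together with
    its two ends still span an expander in [G].

    It remains to find in that expander a Hamilton path between the two ends,
    i.e. a Hamilton cycle through a forced edge.  By Posa rotations there are
    always [n^2 / 250] pairs each of which, added as an edge, lengthens a longest
    path through the forced edge or closes it to a Hamilton cycle.  If the second
    round fails to provide enough of them, some set of at most [n + 1] of its
    edges leaves all of these pairs absent, and the union bound over such sets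
    gives [L^(n+1) exp (O(n)) exp (- c n L)]. *)

(** Symmetrization comes before everything else because a rotation reverses a segment of the path: a
    reversed directed edge would no longer fit the orientation of [C], whereas a pair present in
    both directions fits any. The price is density: a first-round pair has probability
    [L / (2000 n)], below the connectivity threshold, so isolated vertices of [G] must be expected.
    These can be entered and left only through [D0], whose orientations are given; this is why the
    skeleton has to swallow [Bad] along with [X]. It cannot be routed greedily either, since what it
    leaves over must expand down to single vertices for the rotations to work; the reservations
    guarantee this to the end. With [t] about [4 L / ln L] and [r] about half of [L^(1/3)] one has
    [n <= r ^ t], so [t] bounds both the number of levels and the depth of the search trees. Two
    descents of at most [t + 1] steps and a link of at least [2 t + 1] must fit between consecutive
    roots, whence the gap [4 t + 3], which the distance [20 L / ln L] covers. *)

Set Implicit Arguments.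
Unset Strict Implicit.
Unset Printing Implicit Defensive.

(** * Extendable reservations *)

Section Extend.
Variables (L V : finType) (N : L -> {set V}) (d : L -> nat) (Ls : {set L}).
Variables (m : nat).

(* [par y = Some l] reserves [y] for [l]; [eff par l] consists of the neighbours
   of [l] that are free or reserved for [l], which turns the condition of
   Friedman and Pippenger into Hall's. *)
Definition eff (par : V -> option L) (l : L) : {set V} :=
  [set y in N l | (par y == None) || (par y == Some l)].

Definition effs par (A : {set L}) : {set V} := \bigcup_(l in A) eff par l.

Definition dem (A : {set L}) : nat := \sum_(l in A) d l.

(** The range up to [m.*2] keeps the union of two critical sets, each of fewer than [m] labels,
    subject to the condition. *)
Definition extendable (par : V -> option L) : Prop :=
  forall A : {set L}, A \subset Ls -> #|A| <= m.*2 -> dem A <= #|effs par A|.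

Definition children (par : V -> option L) (l : L) : {set V} :=
  [set y | par y == Some l].

Definition consistent (par : V -> option L) : Prop :=
  forall y l, par y = Some l -> y \in N l.

Definition upd (par : V -> option L) (y : V) (l : L) : V -> option L :=
  fun x => if x == y then Some l else par x.

(** Strictness in the upper range confines critical sets to sizes below [m], which is what closes
    them under union. *)
Definition roomy par : Prop :=
  forall A : {set L}, A \subset Ls -> m <= #|A| <= m.*2 -> dem A < #|effs par A|.

Lemma demU A B : dem (A :|: B) + dem (A :&: B) = dem A + dem B.
Proof.
rewrite /dem (big_setID A) /= setUK.
rewrite [in RHS](big_setID A (A := B)) /= setDUl setDv set0U setIC.
lia.
Qed.

Lemma effsU par A B : effs par (A :|: B) = effs par A :|: effs par B.
Proof. exact: bigcup_setU. Qed.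

Lemma effsI par A B : effs par (A :&: B) \subset effs par A :&: effs par B.
Proof.
apply/subsetP => y /bigcupP [l]; rewrite inE => /andP [lA lB] yl.
by rewrite inE; apply/andP; split; apply/bigcupP; exists l.
Qed.

(* Hence the unused branches of a search tree can be discarded at once. *)
Lemma extendable_sub par par' :
  (forall y, par' y = None \/ par' y = par y) ->
  extendable par -> extendable par'.
Proof.
move=> h e A sA cA; apply: leq_trans (e A sA cA) _; apply: subset_leq_card.
apply/subsetP => y /bigcupP [l lA]; rewrite inE => /andP [yl yp].
apply/bigcupP; exists l => //; rewrite inE yl /=.
by case: (h y) => ->.
Qed.

(* A violated set for every candidate child of [l] would be a critical one
   (demand equal to supply) avoiding [l]; critical sets are closed under union
   by submodularity, and the maximal one together with [l] is deficient. *)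
Lemma extend_step par l :
  0 < m -> extendable par -> consistent par -> roomy par ->
  l \in Ls -> #|children par l| < d l ->
  exists2 y, y \in N l /\ par y = None & extendable (upd par y l).
Proof.
move=> m0 ext con big lLs room.
apply: contrapT => noy.
pose crit (A : {set L}) :=
  [&& A \subset Ls, #|A| < m, l \notin A & #|effs par A| == dem A].
have crit0 : crit set0.
  by rewrite /crit sub0set cards0 m0 inE /effs /dem !big_set0 cards0 eqxx.
pose M := [arg max_(A > set0 | crit A) #|A|].
have [critM maxM] : crit M /\ (forall A, crit A -> #|A| <= #|M|).
  by rewrite /M; case: arg_maxnP.
have /and4P [MLs Mm lM /eqP Mc] := critM.
have critU A : crit A -> A \subset M.
  move=> critA; have /and4P [ALs Am lA /eqP Ac] := critA.
  have ULs : M :|: A \subset Ls by rewrite subUset MLs.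
  have Um : #|M :|: A| <= m.*2.
    by apply: leq_trans (leq_card_setU _ _) _; move: Mm Am; clear; lia.
  have ILs : M :&: A \subset Ls by apply: subset_trans (subsetIl _ _) MLs.
  have Im : #|M :&: A| <= m.*2.
    by apply: leq_trans (subset_leq_card (subsetIl _ _)) _; move: Mm; clear; lia.
  have hI := ext _ ILs Im; have hU := ext _ ULs Um.
  have hdem := demU M A.
  have hc := cardsUI (effs par M) (effs par A).
  have hs := subset_leq_card (effsI par M A).
  rewrite -effsU in hc.
  have eqU : #|effs par (M :|: A)| = dem (M :|: A).
    by move: hI hU hdem hc hs Mc Ac; clear; lia.
  have Ults : #|M :|: A| < m.
    rewrite ltnNge; apply/negP => mU.
    have := big _ ULs; rewrite mU Um /= => /(_ isT) => hh.
    by move: eqU hh; clear; lia.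
  have : crit (M :|: A).
    by rewrite /crit ULs Ults eqU eqxx inE negb_or lM lA.
  move=> /maxM; rewrite -[X in _ <= X]add0n => le.
  have /eqP -> : M == M :|: A by rewrite eqEcard subsetUl le.
  exact: subsetUr.
have free y : y \in N l -> par y = None -> y \in effs par M.
  move=> yl yp; apply: contrapT => /negP ynM; apply: noy; exists y => //.
  move=> A ALs Am.
  have dA := ext _ ALs Am.
  (* If [l] is in [A], then [y] stays available to [A] and the supply does not drop. Otherwise it
     drops by at most one, so a violated [A] was critical before. *)
  have [lA|lA] := boolP (l \in A).
    apply: leq_trans dA _; apply: subset_leq_card.
    apply/subsetP => z /bigcupP [l' l'A]; rewrite inE => /andP [zl' zp].
    have [zy|zy] := eqVneq z y.
      by apply/bigcupP; exists l => //; rewrite inE zy yl /upd !eqxx orbT.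
    by apply/bigcupP; exists l' => //; rewrite inE zl' /upd (negbTE zy).
  rewrite leqNgt; apply/negP => lt.
  have sub : effs par A :\ y \subset effs (upd par y l) A.
    apply/subsetP => z; rewrite !inE => /andP [zy].
    move=> /bigcupP [l' l'A]; rewrite inE => /andP [zl' zp].
    by apply/bigcupP; exists l' => //; rewrite inE zl' /upd (negbTE zy).
  have := subset_leq_card sub.
  have := cardsD1 y (effs par A).
  have [yA|yA] := boolP (y \in effs par A) => /= e1 e2; last by move: e1 e2 lt dA; clear; lia.
  have eqA : #|effs par A| = dem A by move: e1 e2 lt dA; clear; lia.
  have : crit A.
    rewrite /crit ALs lA eqA eqxx !andbT ltnNge; apply/negP => mA.
    by have := big _ ALs; rewrite mA Am eqA ltnn => /(_ isT).
  move=> /critU AM; case/negP: ynM; move/bigcupP: yA => [l' l'A yl'].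
  by apply/bigcupP; exists l' => //; apply: (subsetP AM).
have lMLs : l |: M \subset Ls by rewrite subUset sub1set lLs.
have lMm : #|l |: M| <= m.*2 by rewrite cardsU1 lM; move: Mm; clear; lia.
have := ext _ lMLs lMm.
have -> : dem (l |: M) = d l + dem M by rewrite /dem big_setU1.
have sub : effs par (l |: M) \subset effs par M :|: children par l.
  apply/subsetP => y /bigcupP [l']; rewrite !inE => /orP [/eqP ->|l'M].
    move=> /andP [yl /orP [/eqP yp|->]]; last by rewrite orbT.
    by rewrite free.
  by move=> h; apply/orP; left; apply/bigcupP; exists l' => //; rewrite inE.
have := subset_leq_card sub; have := (leq_card_setU (effs par M) (children par l)).1.
by move: room Mc; clear; lia.
Qed.

End Extend.

(** * Trees and connecting paths *)

Section Connect.
Variables (V T : finType).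
Local Notation L := (V * option T)%type.
Variables (N : L -> {set V}) (d : L -> nat) (Ls : {set L}) (m r wmax : nat).
Variables (G : rel V) (U : {set V}).

Definition dom (par : V -> option L) : {set V} := [set y | par y].

Definition pextends (par par' : V -> option L) : Prop :=
  forall y, par y -> par' y = par y.

(** Consequently a free vertex has no children yet and can later be given all [r] of them. *)
Definition lclosed (par : V -> option L) : Prop :=
  forall y v, par y = Some (v, None) -> par v.

Definition unlab (par : V -> option L) (v : V) : Prop :=
  forall y, par y <> Some (v, None).

Definition good par :=
  [/\ extendable N d Ls m par, consistent N par & lclosed par].

Hypothesis m_gt0 : 0 < m.
Hypothesis NG : forall v w, w \in N (v, None) -> G v w /\ w \in U.
Hypothesis dG : forall v, d (v, None) = r.
Hypothesis LsG : forall v, v \in U -> (v, None) \in Ls.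
Hypothesis room : forall par, #|dom par| <= wmax -> roomy N d Ls m par.

Lemma pextends_trans par1 par2 par3 :
  pextends par1 par2 -> pextends par2 par3 -> pextends par1 par3.
Proof.
by move=> h12 h23 y h; rewrite -(h12 y h) h23 // h12.
Qed.

Lemma gextend par v :
  good par -> #|dom par| < wmax -> v \in U -> par v ->
  #|children par (v, None)| < r ->
  exists y, [/\ par y = None, y \in U, good (upd par y (v, None)) &
    #|dom (upd par y (v, None))| = #|dom par|.+1].
Proof.
move=> [ext con lcl] wm vU pv ch.
have [|y [yN yp] exty] := extend_step m_gt0 ext con (room (ltnW wm)) (LsG vU).
  by rewrite dG.
have [Gvy yU] := NG yN.
exists y; split=> //.
  split=> //.
    by move=> z l; rewrite /upd; case: eqP => [-> [<-]|_ /con].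
  move=> z w; rewrite /upd; case: eqP => [_ [<-]|_ /lcl]; first by case: eqP.
  by case: eqP.
have -> : dom (upd par y (v, None)) = y |: dom par.
  by apply/setP => z; rewrite !inE /upd; case: eqP.
by rewrite cardsU1 inE yp.
Qed.

Definition fresh (par0 par : V -> option L) (y : V) : bool :=
  ~~ par0 y && par y.

Definition parent_rel (par : V -> option L) : rel V :=
  fun u v => par v == Some (u, None).

Definition chain_to par0 par root i y :=
  exists c : seq V, [/\ size c = i, uniq c, all (fresh par0 par) c,
    path (parent_rel par) root c & last root c = y].

(** [Y] is the current set of leaves, all at depth exactly [i]. By [tree_lab] only the root and
    fresh vertices gain children, so vertices reserved earlier keep their slots. *)
Record tree par0 root i par (Y : {set V}) : Prop := Tree {
  tree_good : good par;
  tree_ext : pextends par0 par;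
  tree_unlab : forall y, y \in Y -> unlab par y;
  tree_sub : Y \subset U;
  tree_dom : forall y, y \in Y -> par y;
  tree_lab : forall y l, ~~ par0 y -> par y = Some l ->
    exists2 v, l = (v, None) & v = root \/ fresh par0 par v;
  tree_chain : forall y, y \in Y -> chain_to par0 par root i y }.

Lemma tree0 par root :
  good par -> root \in U -> par root -> unlab par root ->
  tree par root 0 par [set root].
Proof.
move=> g rU pr ur; split=> //.
- by move=> y /set1P ->.
- by rewrite sub1set.
- by move=> y /set1P ->.
- by move=> y l /negbTE; case: (par y).
- by move=> y /set1P ->; exists [::].
Qed.

Lemma tree_grow par0 root i par Y k :
  tree par0 root i par Y -> k <= r * #|Y| -> #|dom par| + k <= wmax ->
  exists par' Y', [/\ tree par0 root i.+1 par' Y', #|Y'| = k,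
    #|dom par'| = #|dom par| + k & pextends par par'].
Proof.
move=> tr kr wk.
suff [par' [Y' [g e cY [dm un] H]]] : exists (par' : V -> option L) (Y' : {set V}), [/\ good par',
    pextends par par', #|Y'| = k, #|dom par'| = #|dom par| + k /\
      (forall v, unlab par v -> v \notin Y -> unlab par' v) &
    [/\ Y' \subset U, (forall y, y \in Y' -> par y = None),
     (forall y, y \in Y' -> exists2 v, v \in Y & par' y = Some (v, None)) &
     (forall y, par y = None -> par' y -> y \in Y')]].
  have [Y'U Y'n Y'p Y'd] := H.
  have parN v : par v = None -> unlab par v.
    by move=> pv y yv; have [_ _ /(_ _ _ yv)] := tree_good tr; rewrite pv.
  have pe := pextends_trans (tree_ext tr) e.
  have fr v : fresh par0 par v -> fresh par0 par' v.
    by move=> /andP [p0 p]; rewrite /fresh p0 e.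
  have YY' v : v \in Y -> v \notin Y'.
    by move=> vY; apply/negP => /Y'n pv; have := tree_dom tr vY; rewrite pv.
  have fY' y : y \in Y' -> fresh par0 par' y.
    move=> yY'; rewrite /fresh; have [v _ ->] := Y'p _ yY'.
    rewrite andbT; apply/negP => p0.
    by move: (p0); rewrite -(tree_ext tr p0) (Y'n _ yY').
  exists par', Y'; split=> //; split=> //.
  - move=> y yY'; apply: un; first exact/parN/Y'n.
    by apply/negP => /YY'; rewrite yY'.
  - by move=> y /Y'p [v _ ->].
  - move=> y l p0 p'.
    have [pn|pn] := boolP (par y).
      rewrite (e _ pn) in p'; have [v -> h] := tree_lab tr p0 p'.
      by exists v => //; case: h => [->|h]; [left|right; apply: fr].
    have yY' : y \in Y' by apply: Y'd; [case: (par y) pn|rewrite p'].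
    have [v vY] := Y'p _ yY'; rewrite p' => -[->].
    exists v => //.
    have [[|j] [c [sc _ fc _ lc]]] : exists j, chain_to par0 par root j v.
    - by exists i; apply: (tree_chain tr).
    - by left; rewrite -lc; case: c sc {fc lc}.
    - right; apply: fr; move/allP: fc; apply; rewrite -lc.
      by case: c sc {lc} => //= a c _; apply: mem_last.
  - move=> y yY'; have [v vY pv] := Y'p _ yY'.
    have [c [sc uc fc pc lc]] := tree_chain tr vY.
    exists (rcons c y); split.
    + by rewrite size_rcons sc.
    + rewrite rcons_uniq uc andbT; apply/negP => yc.
      by have := allP fc _ yc; rewrite /fresh (Y'n _ yY') andbF.
    + rewrite all_rcons fY' //=; apply/allP => z /(allP fc); exact: fr.
    + rewrite rcons_path lc /parent_rel pv eqxx andbT.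
      apply: sub_path pc => z w; rewrite /parent_rel => /eqP pw.
      by rewrite e ?pw.
    + by rewrite last_rcons.
(* The last conjunct serves the induction: while fewer than [r * #|Y|] children are placed, some
   vertex of [Y] has a slot left. *)
suff [par' [Y' [g e cY [dm un] [H _]]]] : exists (par' : V -> option L) (Y' : {set V}), [/\ good par',
    pextends par par', #|Y'| = k, #|dom par'| = #|dom par| + k /\
      (forall v, unlab par v -> v \notin Y -> unlab par' v) &
    [/\ Y' \subset U, (forall y, y \in Y' -> par y = None),
     (forall y, y \in Y' -> exists2 v, v \in Y & par' y = Some (v, None)) &
     (forall y, par y = None -> par' y -> y \in Y')] /\
    \sum_(v in Y) #|children par' (v, None)| <= k].
  by exists par', Y'.
elim: k kr wk => [|k IH] kr wk.
  exists par, set0; split=> //.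
  - exact: tree_good tr.
  - by rewrite cards0.
  - by rewrite addn0.
  - split; [split|].
    + exact: sub0set.
    + by move=> y; rewrite inE.
    + by move=> y; rewrite inE.
    + by move=> y ->.
    + rewrite leqn0 sum_nat_eq0; apply/forallP => v; apply/implyP => vY.
      rewrite cards_eq0; apply/eqP/setP => y; rewrite !inE.
      by apply/negP => /eqP; apply: (tree_unlab tr).
have [||par1 [Y1 [g e cY [dm un] [[Y1U Y1n Y1p Y1d] S1]]]] := IH.
  exact: ltnW.
  by move: wk; clear; lia.
have [v vY ltr] : exists2 v, v \in Y & #|children par1 (v, None)| < r.
  apply: contrapT => no; have : \sum_(v in Y) r <= k.
    apply: leq_trans S1; apply: leq_sum => v vY; rewrite leqNgt; apply/negP => h.
    by apply: no; exists v.
  by rewrite sum_nat_const mulnC leqNgt kr.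
have pv : par1 v by rewrite e; apply: tree_dom tr _ vY.
have vU : v \in U by apply: (subsetP (tree_sub tr)).
have wk1 : #|dom par1| < wmax by rewrite dm; move: wk; clear; lia.
have [y [py yU gy dy]] := gextend g wk1 vU pv ltr.
have pyn : par y = None.
  by apply: contra_eqP py => /eqP; case E: (par y) => // _; rewrite e E.
have yY1 : y \notin Y1.
  by apply/negP => /Y1p [w _]; rewrite py.
exists (upd par1 y (v, None)), (y |: Y1); split=> //.
- move=> z pz; rewrite /upd; case: eqP => [zy|_]; last exact: e.
  by rewrite zy pyn in pz.
- by rewrite cardsU1 yY1 cY.
- split; first by rewrite dy dm addnS.
  move=> w uw wY z; rewrite /upd; case: eqP => [_ [vw]|_]; last exact: un.
  by rewrite -vw vY in wY.
- split; [split|].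
  + by rewrite subUset sub1set yU.
  + by move=> z /setU1P [->|/Y1n].
  + move=> z; rewrite /upd => /setU1P [->|zY1].
      by rewrite eqxx; exists v.
    by case: eqP => [_|_]; [exists v|apply: Y1p].
  + move=> z zn; rewrite /upd in_setU1; case: eqP => //= _; exact: Y1d.
  + apply: leq_trans (_ : (\sum_(w in Y) (#|children par1 (w, None)| +
       (w == v)) <= _)).
      apply: leq_sum => w wY.
      have [->|wv] := eqVneq w v.
        apply: leq_trans (_ : #|y |: children par1 (v, None)| <= _).
          apply: subset_leq_card; apply/subsetP => z.
          by rewrite !inE /upd; case: (z =P y).
        by rewrite cardsU1 addnC leq_add2l leq_b1.
      rewrite addn0; apply: subset_leq_card; apply/subsetP => z.
      rewrite !inE /upd; case: (z =P y) => // _ /eqP [vw].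
      by rewrite vw eqxx in wv.
    rewrite big_split /=.
    have -> : \sum_(w in Y) nat_of_bool (w == v) = 1; last by rewrite addn1.
    rewrite (bigD1 v) //= eqxx big1 // => w /andP [_ /negbTE ->] //.
Qed.

Lemma tree_line par0 root i par y k :
  0 < r -> tree par0 root i par [set y] -> #|dom par| + k <= wmax ->
  exists par' y', [/\ tree par0 root (i + k) par' [set y'],
    #|dom par'| = #|dom par| + k & pextends par par'].
Proof.
move=> r0 tr; elim: k => [|k IH] wk.
  by exists par, y; rewrite !addn0; split.
have [|par1 [y1 [tr1 d1 e1]]] := IH; first by move: wk; clear; lia.
have [||par2 [Y2 [tr2 /eqP /cards1P [y2 e] d2 e2]]] := tree_grow (k := 1) tr1.
- by rewrite cards1 muln1.
- by rewrite d1; move: wk; clear; lia.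
rewrite e in tr2.
exists par2, y2; split; first by rewrite addnS.
- by rewrite d2 d1 addn1 addnS.
- exact: pextends_trans e1 e2.
Qed.

(** The height [h] comes from [M] alone, before any tree is given; otherwise the length of a
    connecting path could not be prescribed. Going towards the root, the levels have sizes [M],
    [M / r] rounded up, and so on; as [4 <= r] they at least halve, so [M.*2] vertices suffice. *)
Lemma tree_bush t M : 4 <= r -> 0 < M -> M <= r ^ t ->
  exists2 h, h <= t & forall par0 root i par y,
    tree par0 root i par [set y] -> #|dom par| + M.*2 <= wmax ->
  exists par' Y', [/\ tree par0 root (i + h) par' Y', #|Y'| = M,
    #|dom par'| <= #|dom par| + M.*2 & pextends par par'].
Proof.
move=> r4; elim: t M => [|t IH] M M0 Mt.
  exists 0 => // par0 root i par y tr _; exists par, [set y]; split=> //.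
  - by rewrite addn0.
  - by rewrite cards1; move: M0 Mt; rewrite expn0; clear; lia.
  - exact: leq_addr.
have [M1|M2] := leqP M 1.
  exists 0 => // par0 root i par y tr _; exists par, [set y]; split=> //.
  - by rewrite addn0.
  - by rewrite cards1; move: M0 M1; clear; lia.
  - exact: leq_addr.
pose M' := (M + r.-1) %/ r.
have r0 : 0 < r by exact: leq_trans r4.
have MM' : M <= r * M'.
  have h1 := divn_eq (M + r.-1) r; have h2 := ltn_pmod (M + r.-1) r0.
  rewrite -/M' in h1; move: h1 h2 r0; rewrite mulnC.
  by move: (r * M') (_ %% _); clear; lia.
have M'1 : 0 < M' by rewrite divn_gt0 //; move: M0 r0; clear; lia.
have M'2 : M'.*2 <= M.
  have : M' * r <= M + r.-1 by apply: leq_trunc_div.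
  by move: r4 M2; clear; nia.
have M't : M' <= r ^ t.
  rewrite -ltnS ltn_divLR // mulSn -expnSr; move: Mt r0; clear; lia.
have [h ht H] := IH M' M'1 M't.
exists h.+1 => // par0 root i par y tr wm.
have [|par1 [Y1 [tr1 c1 d1 e1]]] := H _ _ _ _ _ tr.
  by move: wm M'2; clear; lia.
have [||par2 [Y2 [tr2 c2 d2 e2]]] := tree_grow (k := M) tr1.
- by rewrite c1.
- by move: wm M'2 d1; clear; lia.
exists par2, Y2; split=> //.
- by rewrite addnS.
- by rewrite d2; move: M'2 d1; clear; lia.
- exact: pextends_trans e1 e2.
Qed.


Lemma parent_in par x c y :
  path (parent_rel par) x c -> y \in c ->
  exists2 u, u \in x :: c & par y = Some (u, None).
Proof.
elim: c x => //= z c IH x /andP [/eqP pz pc]; rewrite inE => /orP [/eqP ->|yc].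
  by exists x => //; rewrite inE eqxx.
have [u uc pu] := IH _ pc yc; exists u => //.
by rewrite inE uc orbT.
Qed.

Lemma parent_path par x c :
  consistent N par -> path (parent_rel par) x c -> path G x c /\ all (mem U) c.
Proof.
move=> con; elim: c x => //= z c IH x /andP [/eqP pz pc].
have [Gxz zU] := NG (con _ _ pz); have [-> ->] := IH _ pc.
by rewrite Gxz zU.
Qed.

(** A line from [a] ending in a bush with [mA] leaves, a bush from [b] with [mB] leaves, and by [J]
    an edge between the leaves. Only the path keeps its reservations, so the bushes are a temporary
    expense. *)
Lemma connect t mA mB par a b g :
  symmetric G -> 4 <= r -> 0 < mA <= r ^ t -> 0 < mB <= r ^ t ->
  (forall A B : {set V}, [disjoint A & B] -> mA <= #|A| -> mB <= #|B| ->
     exists x y, [/\ x \in A, y \in B & G x y]) ->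
  good par -> a \in U -> b \in U -> par a -> par b -> a != b ->
  unlab par a -> unlab par b -> t.*2.+1 <= g ->
  #|dom par| + g + mA.*2 + mB.*2 <= wmax ->
  exists par' c, [/\ size c = g.-1, path G a (rcons c b),
    uniq c /\ (forall y, y \in c -> y \in U /\ par y = None), good par' &
    [/\ pextends par par', dom par' = dom par :|: [set y in c] &
      forall v, unlab par v -> v \notin a :: b :: c -> unlab par' v]].
Proof.
move=> symG r4 /andP [mA0 mAt] /andP [mB0 mBt] J gp aU bU pa pb ab ua ub gt wm.
have r0 : 0 < r by exact: leq_trans r4.
have [hA hAt HA] := tree_bush r4 mA0 mAt.
have [hB hBt HB] := tree_bush r4 mB0 mBt.
(* The initial line takes up the slack, so that the path has exactly [g] edges, the joining edge
   included. *)
pose i0 := g.-1 - hA - hB.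
have eg : i0 + hA + hB = g.-1 by rewrite /i0; move: gt hAt hBt; clear; lia.
have [|par0 [y0 [tr0 d0 e0]]] := tree_line (k := i0) r0 (tree0 gp aU pa ua).
  by move: wm eg; clear; lia.
have [|par1 [YA [trA cA dA e1]]] := HA _ _ _ _ _ tr0.
  by move: wm eg d0; clear; lia.
rewrite add0n in trA.
have pb1 : par1 b by rewrite (tree_ext trA).
(* The first tree gives children only to [a] and to fresh vertices, and [b] was reserved before
   it. *)
have ub1 : unlab par1 b.
  move=> y yb; have [py|py] := boolP (par y).
    by apply: (ub y); rewrite -yb (tree_ext trA).
  have [v [<-]] := tree_lab trA py yb; case=> [ba|].
    by rewrite ba eqxx in ab.
  by rewrite /fresh pb.
have [|par2 [YB [trB cB dB e2]]] := HB _ _ _ _ _ (tree0 (tree_good trA) bU pb1 ub1).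
  by move: wm eg d0 dA; clear; lia.
rewrite add0n in trB.
(* Every vertex of the second tree other than [b] was still free when the first tree was
   complete. *)
have dAB : [disjoint YA & YB].
  rewrite -setI_eq0; apply/eqP/setP => y; rewrite !inE.
  apply/negP => /andP [yA yB].
  have [c [_ _ fc _ lc]] := tree_chain trA yA.
  have [c' [_ _ fc' _ lc']] := tree_chain trB yB.
  have [yb|yb] := eqVneq y b.
    move: lc; rewrite yb; case/lastP: c fc => [_ /= /esym /eqP|c z].
      by rewrite eq_sym (negbTE ab).
    by rewrite all_rcons last_rcons => /andP [fz _] zb; rewrite zb /fresh pb in fz.
  have : fresh par1 par2 y.
    move: lc'; case/lastP: c' fc' => [_ /= /esym /eqP|c' z].
      by rewrite (negbTE yb).
    by rewrite all_rcons last_rcons => /andP [fz _] <-.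
  by rewrite /fresh (tree_dom trA yA).
have [|| x [y [xA yB Gxy]]] := J _ _ dAB; [by rewrite cA|by rewrite cB|].
have [c1 [s1 un1 f1 p1 l1]] := tree_chain trA xA.
have [c2 [s2 un2 f2 p2 l2]] := tree_chain trB yB.
have ext2 : pextends par par2.
  exact: pextends_trans (tree_ext trA) e2.
have {}p1 : path (parent_rel par2) a c1.
  by apply: sub_path p1 => z w; rewrite /parent_rel => /eqP pw; rewrite e2 pw.
have [ex2 con2 lcl2] := tree_good trB.
have [G1 U1] := parent_path con2 p1; have [G2 U2] := parent_path con2 p2.
pose c := c1 ++ rev c2.
(* Releases all search vertices that are not on the path. *)
pose par3 z := if par z || (z \in c) then par2 z else None.
have c1n z : z \in c1 -> par z = None /\ par1 z.
  by move=> /(allP f1) /andP []; case: (par z).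
have c2n z : z \in c2 -> [/\ par z = None, par1 z = None & par2 z].
  move=> /(allP f2) /andP [] p1z ->; split=> //; last by case: (par1 z) p1z.
  case E: (par z) => [l|] //; case/negP: p1z.
  by rewrite (tree_ext trA) E.
have e3 : pextends par par3.
  by move=> z pz; rewrite /par3 pz ext2.
have in_c z : (z \in c) = (z \in c1) || (z \in c2).
  by rewrite mem_cat mem_rev.
have c3 z : z \in c -> par3 z.
  move=> zc; rewrite /par3 zc orbT; move: zc; rewrite in_c => /orP [/c1n [_ p]|].
    by rewrite e2.
  by move=> /c2n [].
have lab3 z v : z \in c -> par3 z = Some (v, None) -> v \in a :: b :: c.
  move=> zc; rewrite /par3 zc orbT => pz; rewrite !inE in_c.
  move: zc; rewrite in_c => /orP [/(parent_in p1)|/(parent_in p2)];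
    move=> [u]; rewrite pz inE => /orP uc [->]; case: uc => ->; rewrite ?orbT //.
exists par3, c; split.
- by rewrite size_cat size_rev s1 s2 -eg.
- rewrite /c rcons_cat -rev_cons lastI l2 rev_rcons cat_path G1 l1 /= Gxy /=.
  rewrite -[X in path _ X](l2) rev_path; apply: sub_path G2 => z w.
  by rewrite symG.
- split.
    rewrite cat_uniq un1 rev_uniq un2 andbT /=; apply/hasPn => z.
    rewrite mem_rev => /c2n [_ p _]; apply/negP => /c1n [_].
    by rewrite p.
  move=> z; rewrite in_c => /orP [zc|zc].
    by split; [exact: (allP U1)|have [] := c1n _ zc].
  by split; [exact: (allP U2)|have [] := c2n _ zc].
- split.
  + apply: extendable_sub ex2 => z; rewrite /par3; case: ifP => _; by [left|right].
  + by move=> z l; rewrite /par3; case: ifP => // _ /con2.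
  + move=> z v; have [zc|zc] := boolP (z \in c).
      move=> /(lab3 _ _ zc); rewrite !inE => /or3P [/eqP ->|/eqP ->|/c3 //].
      * by rewrite e3.
      * by rewrite e3.
    rewrite /par3 (negbTE zc) orbF; case: ifP => // pz.
    rewrite ext2 // => pzv; have [_ _ /(_ _ _ pzv) pv] := gp.
    by rewrite pv ext2.
- split=> //.
    apply/setP => z; rewrite !inE; apply/idP/idP; last first.
      by move=> /orP [pz|/c3 //]; rewrite e3.
    by rewrite /par3; case: (_ || _).
  move=> v uv vc z; have [zc|zc] := boolP (z \in c).
    by move=> /(lab3 _ _ zc); rewrite (negbTE vc).
  rewrite /par3 (negbTE zc) orbF; case: ifP => // pz.
  by rewrite ext2 //; exact: uv.
Qed.

End Connect.

(** * Rotations with a forced edge *)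

Section Steps.
Variable V : eqType.
Implicit Types (p q : seq V) (R : rel V).

Definition steps p : seq (V * V) := zip p (behead p).

Definition adjp p (u v : V) : bool := ((u, v) \in steps p) || ((v, u) \in steps p).

Lemma adjp_sym p : symmetric (adjp p).
Proof. by move=> u v; rewrite /adjp orbC. Qed.

Lemma steps_cons2 x y p : steps (x :: y :: p) = (x, y) :: steps (y :: p).
Proof. by []. Qed.

Lemma steps_cat p1 x p2 :
  steps (p1 ++ x :: p2) = steps (rcons p1 x) ++ steps (x :: p2).
Proof.
elim: p1 => [|a [|b p1] IH] //.
by rewrite cat_cons rcons_cons steps_cons2 -cat_cons IH.
Qed.

Lemma steps_rcons2 p x y : steps (rcons (rcons p x) y) = rcons (steps (rcons p x)) (x, y).
Proof. by rewrite -cats1 cat_rcons steps_cat cats1. Qed.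

Lemma steps_rev p u v : ((u, v) \in steps (rev p)) = ((v, u) \in steps p).
Proof.
elim: p => [|x [|y p] IH] //.
rewrite rev_cons [rev (y :: p)]rev_cons steps_rcons2 -rev_cons mem_rcons steps_cons2.
by rewrite !inE -IH ![in LHS]xpair_eqE ![in RHS]xpair_eqE andbC.
Qed.

Lemma adjp_rev p : adjp (rev p) =2 adjp p.
Proof. by move=> u v; rewrite /adjp !steps_rev orbC. Qed.

Lemma adjp_cat p1 x p2 u v :
  adjp (p1 ++ x :: p2) u v = adjp (rcons p1 x) u v || adjp (x :: p2) u v.
Proof. by rewrite /adjp steps_cat !mem_cat orbACA. Qed.

Lemma adjp_cons2 x y p u v : adjp (x :: y :: p) u v =
  [|| (u == x) && (v == y), (u == y) && (v == x) | adjp (y :: p) u v].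
Proof.
rewrite /adjp steps_cons2 !in_cons !xpair_eqE [(v == x) && _]andbC.
by rewrite orbACA -orbA.
Qed.

Lemma sorted_cat R p1 x p2 :
  sorted R (p1 ++ x :: p2) = sorted R (rcons p1 x) && sorted R (x :: p2).
Proof. by case: p1 => [|a p1] //=; rewrite cat_path rcons_path /= andbA. Qed.

Lemma sorted_rev R p : symmetric R -> sorted R (rev p) = sorted R p.
Proof. by move=> sR; rewrite rev_sorted; apply: eq_sorted => u v; rewrite sR. Qed.

Lemma next_step p u v : uniq p -> (u, v) \in steps p -> next p u = v.
Proof.
move=> + uv; suff [p1 [p2 ->]] : exists p1 p2, p = p1 ++ u :: v :: p2.
  move=> up; rewrite next_nth mem_cat inE eqxx orbT.
  case: p1 up => [|a p1] /=; first by rewrite eqxx.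
  move=> /andP [au up]; rewrite index_cat.
  case: eqP => [e|_]; first by rewrite e mem_cat inE eqxx orbT in au.
  move: up; rewrite cat_uniq => /and3P [_ /hasPn/(_ u) h _].
  have /negbTE -> : u \notin p1 by apply: h; rewrite inE eqxx.
  by rewrite /= eqxx addn0 nth_cat ltnNge leqnSn /= subSnn.
elim: p uv => [|x [|y p] IH] //; rewrite steps_cons2 inE => /orP [/eqP [-> ->]|].
  by exists [::], p.
by move=> /IH [p1 [p2 ->]]; exists (x :: p1), p2.
Qed.

Lemma prev_step p u v : uniq p -> (u, v) \in steps p -> prev p v = u.
Proof. by move=> up h; rewrite -(next_step up h) prev_next. Qed.

Lemma adjp_next_prev p u v : uniq p -> adjp p u v -> v = next p u \/ v = prev p u.
Proof.
move=> up /orP [/(next_step up) <-|/(prev_step up) <-]; by [left|right].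
Qed.

End Steps.

(** * Posa rotations and boosters *)

Section Posa.
Variables (V : finType) (S0 : {set V}) (s t : V).
Hypotheses (sS : s \in S0) (tS : t \in S0) (st : s != t).

Definition forced (H : rel V) : rel V :=
  fun u v => [|| H u v, (u == s) && (v == t) | (u == t) && (v == s)].

Definition valid (H : rel V) (p : seq V) : bool :=
  [&& uniq p, all (mem S0) p, sorted (forced H) p & adjp p s t].

(** A Hamilton cycle through the forced edge, cut open at that edge, so that only edges of [H]
    itself remain. *)
Definition hamilton (H : rel V) : Prop :=
  exists p, [/\ uniq (t :: p), (t :: p) =i S0, path H t p & last t p = s].

Definition longest (H : rel V) : nat :=
  \max_(k < #|V|.+1 | [exists p : k.-tuple V, valid H p]) k.

Definition extnbr (H : rel V) (A : {set V}) : {set V} :=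
  [set w in S0 | (w \notin A) && [exists a in A, H a w]].

Lemma forced_sym H : symmetric H -> symmetric (forced H).
Proof.
move=> sH u v; rewrite /forced sH; congr (_ || _).
by rewrite [(u == s) && _]andbC [(u == t) && _]andbC orbC.
Qed.

Lemma valid_rev H p : symmetric H -> valid H (rev p) = valid H p.
Proof.
by move=> sH; rewrite /valid rev_uniq all_rev sorted_rev ?adjp_rev //; apply: forced_sym.
Qed.

Lemma valid_size H p : valid H p -> size p <= #|V|.
Proof. by move=> /and4P [/card_uniqP <- _ _ _]; apply: max_card. Qed.

Lemma longest_ge H p : valid H p -> size p <= longest H.
Proof.
move=> vp; have sp : size p < #|V|.+1 by rewrite ltnS (valid_size vp).
apply: (leq_bigmax_cond (Ordinal sp)); apply/existsP; exists (in_tuple p).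
exact: vp.
Qed.

Lemma longest_le H : longest H <= #|V|.
Proof. by apply/bigmax_leqP => k _; rewrite -ltnS ltn_ord. Qed.

Lemma valid_st H : valid H [:: s; t].
Proof. by rewrite /valid /= !inE st sS tS /forced /adjp !inE !eqxx !orbT. Qed.

Lemma longest_ex H : exists2 p, valid H p & size p = longest H.
Proof.
have l2 : 2 < #|V|.+1 by rewrite ltnS (valid_size (valid_st (fun _ _ => false))).
have [|k vk mk] := @eq_bigmax_cond _ [pred k : 'I_#|V|.+1 |
    [exists p : k.-tuple V, valid H p]] (fun k => nat_of_ord k).
  apply/card_gt0P; exists (Ordinal l2); rewrite inE; apply/existsP.
  by exists [tuple s; t]; apply: valid_st.
move: vk; rewrite inE => /existsP [p vp]; exists p => //.
by rewrite size_tuple -mk /longest; apply: eq_bigl => i; rewrite inE.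
Qed.

Section Rotations.
Variable H : rel V.
Hypothesis symH : symmetric H.
Variable p0 : seq V.

(** A rotation with pivot [v] exchanges the edge [vy] for one from the last vertex to [v]. The first
    vertex stays, and the side condition protects the forced edge. *)
Inductive rotated : seq V -> Prop :=
| Rot0 : rotated p0
| RotS p1 v y p2 : rotated (p1 ++ v :: y :: p2) ->
    H (last y p2) v -> ~~ (((v == s) && (y == t)) || ((v == t) && (y == s))) ->
    rotated (p1 ++ v :: rev (y :: p2)).

Hypotheses (v0 : valid H p0) (l0 : size p0 = longest H).
Variable x0 : V.

Lemma adjp_rotation (p1 p2 : seq V) (v y a b : V) : adjp (p1 ++ v :: y :: p2) a b ->
  ~~ (((v == a) && (y == b)) || ((v == b) && (y == a))) ->
  adjp (p1 ++ v :: rev (y :: p2)) a b.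
Proof.
rewrite adjp_cat adjp_cons2 (adjp_cat _ v) => /or4P [->//|e|e|ad] n.
- by rewrite (eq_sym v) (eq_sym y) e in n.
- by rewrite (eq_sym v b) (eq_sym y a) [(b == v) && _]andbC e orbT in n.
- case E : (rev (y :: p2)) => [|z q]; first by move/(congr1 size): E; rewrite size_rev.
  by rewrite adjp_cons2 -E adjp_rev ad !orbT.
Qed.

Lemma rotated_valid q : rotated q -> valid H q /\ perm_eq q p0 /\ head x0 q = head x0 p0.
Proof.
elim=> [|p1 v y p2 _ [vq [pq hq]] Hl nst] //.
have pe : perm_eq (p1 ++ v :: rev (y :: p2)) (p1 ++ v :: y :: p2).
  by rewrite perm_cat2l perm_cons perm_rev.
split; [|split; [exact: perm_trans pe pq|by rewrite -hq; case: (p1)]].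
have /and4P [uq aq sq adq] := vq.
apply/and4P; split.
- by rewrite (perm_uniq pe).
- by rewrite (perm_all _ pe).
- move: sq; rewrite !(sorted_cat _ p1) => /andP [-> /=].
  move=> /andP [vy py]; have : sorted (forced H) (rev (y :: p2)).
    by rewrite sorted_rev //; apply: forced_sym.
  rewrite lastI rev_rcons /= => ->.
  by rewrite /forced symH Hl.
- exact: adjp_rotation.
Qed.

Definition ends : {set V} :=
  [set u | `[< exists2 q, rotated q & last x0 q = u >]].

Lemma endsP u : reflect (exists2 q, rotated q & last x0 q = u) (u \in ends).
Proof. by rewrite inE; apply: asboolP. Qed.

(** A rotation deletes one edge [vy] and makes [y] an end, so an edge that avoids [ends] is never
    deleted. *)
Lemma rotated_adjp q a b : rotated q -> adjp p0 a b -> a \notin ends -> b \notin ends ->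
  adjp q a b.
Proof.
move=> rq ab aE bE; elim: rq => [|p1 v y p2 r IH Hl nst] //.
apply: adjp_rotation => //.
have yE : y \in ends.
  apply/endsP; exists (p1 ++ v :: rev (y :: p2)); first exact: RotS.
  by rewrite rev_cons last_cat /= last_rcons.
apply/negP => /orP [] /andP [_ /eqP e].
  by rewrite -e yE in bE.
by rewrite -e yE in aE.
Qed.

Lemma rotated_nil q : rotated q -> q != [::].
Proof. by case/rotated_valid => /and4P [_ _ _]; case: q. Qed.

(** A neighbour off the path could be appended to a longest path. *)
Lemma ends_nbr u w : u \in ends -> H u w -> w \in S0 -> w \in p0.
Proof.
move=> /endsP [q rq <-] Hw wS; have [vq [pq _]] := rotated_valid rq.
rewrite -(perm_mem pq); apply: contraT => wq.
have /and4P [uq aq sq adq] := vq.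
suff /longest_ge : valid H (rcons q w).
  by rewrite size_rcons -l0 -(perm_size pq) ltnn.
case: (lastP q) (rotated_nil rq) wq uq aq sq adq Hw => // q' z _ wq uq aq sq adq.
rewrite last_rcons => Hw.
rewrite /valid rcons_uniq wq uq all_rcons aq /= wS /=.
rewrite -cats1 cat_rcons sorted_cat sq /= /forced Hw /=.
by rewrite adjp_cat adq.
Qed.

(* A vertex outside [ends], and with no [p0]-neighbour in [ends], keeps both
   its [p0]-edges through every rotation; pivoting at it would then turn one
   of these neighbours into an end. *)
Lemma ends_adjp u w : u \in ends -> H u w -> w \in p0 -> w \notin ends ->
  [|| w == s, w == t, w == head x0 p0 | [exists e in ends, adjp p0 e w]].
Proof.
move=> uE Huw wp wE; apply: contraT; rewrite !negb_or => /and4P [ws wt wh].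
move=> /existsPn nb.
have {}nb e : adjp p0 w e -> e \notin ends.
  by move=> we; have := nb e; rewrite (adjp_sym p0) we andbT.
have /endsP [q rq lq] := uE; have [vq [pq _]] := rotated_valid rq.
have wu : w != u by apply: contraNneq wE => ->.
have /and4P [uq aq sq adq] := vq.
have [q1 [y [q2 eq]]] : exists q1 y q2, q = q1 ++ w :: y :: q2.
  have wq : w \in q by rewrite (perm_mem pq).
  case/splitPr: wq lq => q1 [|y q2]; last by exists q1, y, q2.
  by rewrite last_cat /= => e; rewrite e eqxx in wu.
have yE : y \in ends.
  apply/endsP; exists (q1 ++ w :: rev (y :: q2)); last first.
    by rewrite rev_cons last_cat /= last_rcons.
  apply: RotS; first by rewrite -eq.
    by move: lq; rewrite eq last_cat /= => ->.
  by rewrite (negbTE ws) (negbTE wt).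
have uv0 : uniq p0 by case/and4P: v0.
have [c [e [wc we ce]]] : exists c e, [/\ adjp p0 w c, adjp p0 w e & c != e].
  case/splitPr: wp wh uv0 (Rot0) => a1 a2.
  case/lastP: a1 => [|a1 c]; first by rewrite /= eqxx.
  case: a2 => [|e a2] _ ua r0.
    case/negP: wE; apply/endsP; exists (rcons a1 c ++ [:: w]) => //.
    by rewrite last_cat.
  exists c, e; split.
  - by rewrite cat_rcons adjp_cat adjp_cons2 !eqxx !orbT.
  - by rewrite adjp_cat adjp_cons2 !eqxx !orbT.
  - move: ua; rewrite cat_uniq has_sym => /and3P [_ /hasPn /(_ c)].
    rewrite mem_rcons inE eqxx => /(_ isT); rewrite !inE !negb_or.
    by case/and3P.
have wcq := rotated_adjp rq wc wE (nb _ wc).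
have weq := rotated_adjp rq we wE (nb _ we).
have ny : next q w = y.
  by apply: next_step => //; rewrite eq steps_cat mem_cat inE eqxx orbT.
have [hc|hc] := adjp_next_prev uq wcq.
  by have := nb _ wc; rewrite hc ny yE.
have [he|he] := adjp_next_prev uq weq.
  by have := nb _ we; rewrite he ny yE.
by rewrite hc he eqxx in ce.
Qed.

Lemma ends_sub : ends \subset S0.
Proof.
apply/subsetP => u /endsP [q rq <-]; have [/and4P [_ aq _ _] _] := rotated_valid rq.
apply: (allP aq); have := rotated_nil rq; case: (q) => //= a q' _.
exact: mem_last.
Qed.

(** By [ends_adjp] an outside neighbour is next to an end on [p0], which allows two per end, or one
    of three exceptions: the first vertex, which has a single path edge, and [s] and [t], where a
    rotation might delete the forced edge. *)
Lemma card_extnbr_ends : #|extnbr H ends| <= #|ends|.*2 + 3.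
Proof.
have sub : extnbr H ends \subset
    ((next p0 @: ends) :|: (prev p0 @: ends)) :|: [set s; t; head x0 p0].
  apply/subsetP => w; rewrite inE => /and3P [wS wE /existsP [u /andP [uE Huw]]].
  have wp := ends_nbr uE Huw wS.
  have /or4P [/eqP ->|/eqP ->|/eqP ->|] := ends_adjp uE Huw wp wE;
    rewrite ?inE ?eqxx ?orbT //.
  move=> /existsP [e /andP [eE]]; have /and4P [up _ _ _] := v0.
  by move=> /(adjp_next_prev up) [->|->]; rewrite imset_f ?orbT.
apply: leq_trans (subset_leq_card sub) _.
apply: leq_trans (leq_card_setU _ _) _; apply: leq_add.
  apply: leq_trans (leq_card_setU _ _) _; rewrite -addnn.
  by apply: leq_add; apply: leq_imset_card.
apply: leq_trans (leq_card_setU _ _) _; rewrite cards1 addn1 ltnS.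
by rewrite cards2; case: (_ != _).
Qed.

End Rotations.

Definition longest_pairs (H : rel V) : {set V * V} :=
  [set e | `[< exists p, [/\ valid H (e.1 :: p), (size p).+1 = longest H &
                          last e.1 p = e.2] >]].

Lemma longest_pairsP H a b : reflect (exists p, [/\ valid H (a :: p),
  (size p).+1 = longest H & last a p = b]) ((a, b) \in longest_pairs H).
Proof. by rewrite inE; apply: asboolP. Qed.

Lemma longest_pairs_sym H a b : symmetric H ->
  (a, b) \in longest_pairs H -> (b, a) \in longest_pairs H.
Proof.
move=> sH /longest_pairsP [p [vp sp lp]]; apply/longest_pairsP.
have vr : valid H (rev (a :: p)) by rewrite valid_rev.
move: vr sp; rewrite lastI lp rev_rcons => vr sp.
exists (rev (belast a p)); split=> //.
  by rewrite size_rev size_belast.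
by case: p {vp vr sp} lp => //= z p _; rewrite rev_cons last_rcons.
Qed.

Lemma longest_pairs_neq H a b : (a, b) \in longest_pairs H -> a != b.
Proof.
move=> /longest_pairsP [p [/and4P [up _ _]]].
case: p up => [|c p] up _ _ <- //; apply/negP => /eqP e.
by move: up; rewrite /= -/(last a (c :: p)) {1}e (mem_last c p).
Qed.

Section Boosters.
Variables (H : rel V) (m b c : nat).
Hypothesis symH : symmetric H.
Hypothesis expH : forall A : {set V}, A \subset S0 -> 0 < #|A| <= m ->
  #|A|.*2 + 3 < #|extnbr H A|.
Hypothesis bigH : forall A : {set V}, A \subset S0 -> m <= #|A| ->
  #|S0| <= #|A| + #|extnbr H A| + b.
Hypothesis bS0 : b.*2 < #|S0|.
Hypothesis cS0 : c * 3 + 3 + b <= #|S0|.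

(** Ends have too few outside neighbours for [expH], so there are at least [m] of them. Then [bigH]
    applies, and with [E] ends it gives [#|S0| <= 3 E + 3 + b]. *)
Lemma card_longest_from a b' : (a, b') \in longest_pairs H ->
  c <= #|[set z | (a, z) \in longest_pairs H]|.
Proof.
move=> /longest_pairsP [p [vp sp lp]].
pose E := ends H (a :: p) a.
have cE := card_extnbr_ends symH vp sp a.
have E0 : 0 < #|E|.
  apply/card_gt0P; exists (last a p); apply/endsP; exists (a :: p) => //.
  exact: Rot0.
have Ebig : m <= #|E|.
  rewrite leqNgt; apply/negP => Em.
  have := expH (ends_sub symH vp a); rewrite -/E E0 (ltnW Em) => /(_ isT).
  by rewrite ltnNge cE.
apply: (@leq_trans #|E|).
  have := bigH (ends_sub symH vp a) Ebig; move: cE cS0; rewrite -/E; clear; lia.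
apply: subset_leq_card; apply/subsetP => z /endsP [q rq lq].
have [vq [pq hq]] := rotated_valid symH vp a rq.
rewrite inE; apply/longest_pairsP.
case: q rq lq vq pq hq => [/rotated_nil|w q rq lq vq pq /= hq].
  by move/(_ symH vp a).
by exists q; rewrite -hq; split=> //; rewrite -sp -[RHS](perm_size pq).
Qed.

(** After reversal, each end reached from [a] is itself the first vertex of a longest path and has
    [c] ends in its turn. *)
Lemma card_longest_pairs : c ^ 2 <= #|longest_pairs H|.
Proof.
have [[|a p] vp sp] := longest_ex H; first by case/and4P: vp.
have aP : (a, last a p) \in longest_pairs H by apply/longest_pairsP; exists p.
pose F := [set z | (a, z) \in longest_pairs H].
have cF : c <= #|F| := card_longest_from aP.
apply: (@leq_trans (\sum_(z in F) \sum_(w | (z, w) \in longest_pairs H) 1)).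
  apply: (@leq_trans (\sum_(z in F) c)).
    by rewrite sum_nat_const leq_mul.
  apply: leq_sum => z; rewrite inE => /(longest_pairs_sym symH)/card_longest_from h.
  by rewrite sum1dep_card.
rewrite pair_big_dep /= sum1dep_card; apply: subset_leq_card.
by apply/subsetP => -[z w]; rewrite !inE /= => /andP [_].
Qed.

(** Otherwise neither [A] nor its complement in [S0] has outside neighbours. Both then exceed [m] by
    [expH], hence have at least [#|S0| - b] elements by [bigH], too many in total. *)
Lemma leaving_edge (A : {set V}) : A \subset S0 -> A != set0 -> A != S0 ->
  exists z w, [/\ z \in A, w \in S0, w \notin A & H z w].
Proof.
move=> AS A0 AS0; apply: contrapT => no.
have nA : extnbr H A = set0.
  apply/setP => w; rewrite !inE; apply/negP => /and3P [wS wA].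
  by move=> /existsP [z /andP [zA zw]]; apply: no; exists z, w.
have nB : extnbr H (S0 :\: A) = set0.
  apply/setP => z; rewrite !inE negb_and negbK; apply/negP => /and3P [zS].
  rewrite zS orbF => zA /existsP [w /andP [/setDP [wS wA] wz]].
  by apply: no; exists z, w; split=> //; rewrite symH.
have BS : S0 :\: A \subset S0 by apply: subsetDl.
have cAB : #|A| + #|S0 :\: A| = #|S0|.
  by rewrite -[in RHS](cardsID A S0); congr (_ + _); rewrite (setIidPr AS).
have A1 : 0 < #|A| by rewrite card_gt0.
have B1 : 0 < #|S0 :\: A|.
  rewrite card_gt0 setD_eq0; apply/negP => h; case/negP: AS0.
  by rewrite eqEsubset AS.
have [Am|Am] := leqP #|A| m.
  by have := expH AS; rewrite A1 Am nA cards0 => /(_ isT).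
have [Bm|Bm] := leqP #|S0 :\: A| m.
  by have := expH BS; rewrite B1 Bm nB cards0 => /(_ isT).
have := bigH AS (ltnW Am); have := bigH BS (ltnW Bm).
by rewrite nA nB cards0; move: cAB bS0; clear; lia.
Qed.

Lemma forced_path H' z q : path (forced H') z q -> uniq (z :: q) ->
  (s \notin z :: q) || (t \notin z :: q) -> path H' z q.
Proof.
elim: q z => //= y q IH z /andP [fzy pq] /andP [zq uq] h.
have h' : (s \notin y :: q) || (t \notin y :: q).
  by case/orP: h; rewrite in_cons negb_or => /andP [_ ->]; rewrite ?orbT.
have n1 : (z == s) && (y == t) = false.
  by apply/negbTE/negP => /andP [/eqP zs /eqP yt]; rewrite zs yt !inE !eqxx !orbT in h.
have n2 : (z == t) && (y == s) = false.
  by apply/negbTE/negP => /andP [/eqP zs /eqP yt]; rewrite zs yt !inE !eqxx !orbT in h.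
by move: fzy; rewrite /forced n1 n2 !orbF => ->; rewrite IH.
Qed.

(** The edge [ae] closes a longest path to a cycle through [st]. If the cycle misses a vertex, there
    is an edge [zw] leaving it; cutting the cycle next to [z], at an edge other than [st], gives a
    path with one more vertex. *)
Lemma booster H' a e : symmetric H' -> subrel H H' ->
  (a, e) \in longest_pairs H -> H' a e ->
  hamilton H' \/ longest H < longest H'.
Proof.
move=> sH' HH' /longest_pairsP [p [vp sp lp]] Hae.
have fH' : subrel (forced H) (forced H').
  by move=> u v /orP [/HH' h|h]; rewrite /forced ?h ?orbT.
have [C [uC mC pC lC sC]] : exists C, [/\ uniq (t :: C), t :: C =i a :: p,
    path H' t C, last t C = s & size C = size p].
  (* Up to reversal [s] comes just before [t], and [t :: C] runs along the cycle from [t] round to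
     [s]. *)
  wlog [q1 [q2 eq]] : a e p vp sp lp Hae / exists q1 q2, a :: p = q1 ++ s :: t :: q2.
    move=> wl; have /and4P [up _ _ adp] := vp.
    have ex q : adjp q s t -> exists q1 q2, q = q1 ++ s :: t :: q2 \/
        q = q1 ++ t :: s :: q2.
      elim: q => // x [|y q] IH //; rewrite adjp_cons2 => /or3P [] //.
      + by move=> /andP [/eqP <- /eqP <-]; exists [::], q; left.
      + by move=> /andP [/eqP <- /eqP <-]; exists [::], q; right.
      + by move=> /IH [q1 [q2 [->|->]]]; exists (x :: q1), q2; [left|right].
    have [q1 [q2 [eq|eq]]] := ex _ adp.
      by apply: (wl a e p) => //; exists q1, q2.
    have vr : valid H (rev (a :: p)) by rewrite valid_rev.
    have er : rev (a :: p) = e :: rev (belast a p) by rewrite lastI lp rev_rcons.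
    have [|||||C [uC mC pC lC sC]] := wl e a (rev (belast a p)).
    - by rewrite -er.
    - by rewrite size_rev size_belast.
    - by case: (p) lp => //= z p' _; rewrite rev_cons last_rcons.
    - by rewrite sH'.
    - exists (rev q2), (rev q1); rewrite -er eq rev_cat !rev_cons.
      by rewrite -!cats1 -!catA.
    exists C; split=> //; first by move=> z; rewrite mC -er mem_rev.
    by rewrite sC size_rev size_belast.
  have /and4P [up ap sop _] := vp.
  exists (q2 ++ rcons q1 s).
  have pe : perm_eq (t :: q2 ++ rcons q1 s) (a :: p).
    by rewrite eq -cat_cons -cat_rcons perm_catC.
  have sz := perm_size pe; have uC := perm_uniq pe.
  rewrite up in uC.
  have so := sop; rewrite eq sorted_cat in so.
  have /andP [so1 so2] := so.
  have {so2} p2 : path H' t q2.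
    apply: forced_path.
    - by move: so2 => /= /andP [_]; apply: sub_path.
    - by move: uC; rewrite -cat_cons cat_uniq => /and3P [].
    - apply/orP; left; move: uC; rewrite -cat_cons uniq_catC cat_uniq.
      by move=> /and3P [_ /hasPn h _]; apply/negP => /h; rewrite mem_rcons inE eqxx.
  split=> //; [exact: perm_mem| |by rewrite last_cat last_rcons|by move: sz => /= [->]].
  rewrite cat_path p2 /=.
  have lq2 : last t q2 = e by rewrite -lp -[last a p]/(last a (a :: p)) eq last_cat.
  have uq : uniq (rcons q1 s).
    by move: uC; rewrite -cat_cons cat_uniq => /and3P [].
  have tq : t \notin rcons q1 s.
    by move: uC; rewrite /= mem_cat negb_or => /andP [/andP []].
  case: q1 eq so1 uq tq {pe sz uC so sop} => [|a' q1] eq so1 uq tq.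
    by move: eq Hae => /= [-> _]; rewrite lq2 sH' => ->.
  case: eq => <- _ in so1 uq tq *.
  rewrite rcons_cons /= lq2 sH' Hae /=; apply: forced_path => //.
    by move: so1 => /=; apply: sub_path.
  by rewrite -rcons_cons tq orbT.
have [full|nfull] := eqVneq [set z in t :: C] S0.
  by left; exists C; split=> // z; rewrite -full [RHS]inE.
right; rewrite -sp -sC.
have /and4P [_ ap _ _] := vp.
have CS : [set z in t :: C] \subset S0.
  by apply/subsetP => z; rewrite inE mC => /(allP ap).
have [|z [w [zC wS wC Hzw]]] := leaving_edge CS _ nfull.
  by apply/set0Pn; exists t; rewrite inE mem_head.
rewrite !inE -in_cons in zC; rewrite !inE -in_cons in wC.
have fst : forced H' s t by rewrite /forced !eqxx orbT.
have all0 : all (mem S0) (t :: C) by apply/allP => y yC; apply: (subsetP CS); rewrite inE.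
have Hzw' := HH' _ _ Hzw.
have subf : subrel H' (forced H') by move=> u v h; rewrite /forced h.
have pC' : path (forced H') t C by apply: sub_path pC.
suff [P [vP <-]] : exists P, valid H' P /\ size P = (size C).+2 by apply: longest_ge.
case/splitPr eC : {1}(t :: C) / zC => [c1 c2].
have pe1 : perm_eq (c2 ++ c1 ++ [:: z; w]) (w :: t :: C).
  by rewrite eC; apply/permP => g; rewrite /= !count_cat /=; clear; lia.
have sc : sorted (forced H') (t :: C) by [].
rewrite eC sorted_cat in sc; have /andP [sc1 sc2] := sc.
(* If [z] is last on [t :: C], then [z = s] and the cycle is cut just before [s]. Otherwise it is
   cut just after [z], and the path passes through [s] and [t] before it ends in [z] and [w]. *)
case: c2 eC pe1 sc sc2 => [|y c2] eC pe1 sc sc2.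
  have zs : z = s by rewrite -lC -[last t C]/(last t (t :: C)) eC last_cat.
  exists (w :: s :: c1); split; last first.
    by have /(congr1 size) := eC; rewrite size_cat /= addn1 => [[->]].
  apply/and4P; split.
  - by move: wC uC; rewrite eC zs cats1 rcons_uniq mem_rcons => w1 /andP [u1 u2]; rewrite /= w1 u1 u2.
  - by move: all0; rewrite eC zs all_cat /= wS => /and3P [-> -> _].
  - case: c1 eC sc1 {pe1 sc} => [|t' c1] [tt]; first by move: st; rewrite tt zs eqxx.
    move=> _; rewrite -tt rcons_cons /= rcons_path => /andP [-> _].
    by rewrite fst andbT /forced -zs sH' Hzw'.
  - case: c1 eC {sc1 pe1 sc} => [|t' c1] [tt]; first by move: st; rewrite tt zs eqxx.
    by rewrite -tt !adjp_cons2 !eqxx !orbT.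
exists (y :: c2 ++ c1 ++ [:: z; w]); split; last by rewrite (perm_size pe1).
have ls : last y c2 = s by rewrite -lC -[last t C]/(last t (t :: C)) eC last_cat.
have e0 : y :: c2 ++ c1 ++ [:: z; w] = belast y c2 ++ s :: (c1 ++ [:: z; w]).
  by rewrite -cat_cons lastI ls cat_rcons.
have hd : exists c', c1 ++ [:: z; w] = t :: c'.
  case: (c1) eC => [|t' c'] [<- _]; first by exists [:: w].
  by exists (c' ++ [:: z; w]).
apply/and4P; split.
- by rewrite (perm_uniq pe1) cons_uniq wC.
- by rewrite (perm_all _ pe1) /= wS.
- rewrite e0 sorted_cat -ls -lastI; apply/andP; split.
    by move: sc2 => /= /andP [].
  rewrite ls; have [c' ec'] := hd; rewrite ec' /= fst /=.
  rewrite -[path _ _ _]/(sorted (forced H') (t :: c')) -ec' sorted_cat sc1 /=.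
  by rewrite andbT; apply: subf.
- rewrite e0; have [c' ->] := hd.
  by rewrite adjp_cat adjp_cons2 !eqxx !orbT.
Qed.

End Boosters.

End Posa.

(** * Bad vertices and levels *)

Section BadSet.
Variables (V : finType) (G : rel V) (X : {set V}) (m b r K : nat).

Definition spreads : Prop := forall A : {set V}, m <= #|A| ->
  #|[set w | (w \notin A) && [forall a in A, ~~ G a w]]| < b.

Lemma card_extnbr_spread (S0 A : {set V}) : spreads -> m <= #|A| ->
  #|S0| <= #|A| + #|extnbr S0 G A| + b.
Proof.
move=> sp mA; have lt := sp A mA.
have sub : S0 \subset (A :|: extnbr S0 G A) :|:
    [set w | (w \notin A) && [forall a in A, ~~ G a w]].
  apply/subsetP => w wS; rewrite !inE wS /=.
  case: (w \in A) => //=; have [//|] := boolP [exists a in A, G a w].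
  by rewrite negb_exists => /forallP h; apply/forallP => a; rewrite implybE -negb_and.
apply: leq_trans (subset_leq_card sub) _; apply: leq_trans (leq_card_setU _ _) _.
by apply: leq_add (ltnW lt); apply: leq_card_setU.
Qed.

(** [Bad] is a largest set of at most [K + m] vertices that expands poorly outside [X]. By [spreads]
    it has fewer than [m] elements, so there is room to add any further poor set of at most [K]
    vertices. *)
Lemma bad_set : spreads -> #|X| + b + (r.*2.+1) * (K + m) < #|V| ->
  exists Bad : {set V}, [/\ [disjoint Bad & X], #|Bad| < m &
    forall A : {set V}, A \subset ~: (X :|: Bad) -> 0 < #|A| <= K ->
      r.*2 * #|A| <= #|extnbr (~: (X :|: Bad)) G A|].
Proof.
move=> sp num.
pose P (A : {set V}) := [&& A \subset ~: X, #|A| <= K + m &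
  #|extnbr (~: X) G A| <= r.*2 * #|A|].
have P0 : P set0.
  rewrite /P sub0set cards0 muln0 leqn0 cards_eq0 /=; apply/eqP/setP => w.
  by rewrite !inE; apply/negP => /andP [_ /existsP [a]]; rewrite inE.
pose M := [arg max_(A > set0 | P A) #|A|].
have [/and3P [MX cM eM] maxM] : P M /\ (forall A, P A -> #|A| <= #|M|).
  by rewrite /M; case: arg_maxnP.
have cX := cardsC X.
have Mm : #|M| < m.
  rewrite ltnNge; apply/negP => mM.
  have := card_extnbr_spread (~: X) sp mM; move: cX num cM eM; clear; nia.
exists M; split=> //; first by rewrite disjoints_subset.
move=> A AU /andP [A0 AK].
have [AX AM] : A \subset ~: X /\ A :&: M = set0.
  split; apply/subsetP || apply/setP => a; last first.
    rewrite !inE; apply/negP => /andP [aA aM]; have := subsetP AU a aA.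
    by rewrite !inE aM orbT.
  by move=> a /(subsetP AU); rewrite !inE negb_or => /andP [].
have cMA : #|M :|: A| = #|M| + #|A| by rewrite cardsU setIC AM cards0 subn0.
have nP : ~~ P (M :|: A).
  by apply/negP => /maxM; rewrite cMA; move: A0; clear; lia.
move: nP; rewrite /P subUset MX AX cMA /=.
have -> /= : #|M| + #|A| <= K + m by move: AK Mm; clear; lia.
rewrite -ltnNge => lt.
have sub : extnbr (~: X) G (M :|: A) \subset extnbr (~: X) G M :|: extnbr (~: (X :|: M)) G A.
  apply/subsetP => w; rewrite !inE negb_or => /and3P [wX /andP [wM wA]].
  move=> /existsP [a]; rewrite inE => /andP [/orP [aM|aA] Gaw].
    apply/orP; left; rewrite wX wM; apply/existsP; exists a; by rewrite aM.
  apply/orP; right; rewrite negb_or wX wM wA; apply/existsP; exists a; by rewrite aA.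
have := subset_leq_card sub; have := (leq_card_setU (extnbr (~: X) G M) (extnbr (~: (X :|: M)) G A)).1.
move: lt eM; rewrite mulnDr; clear; lia.
Qed.

End BadSet.

(** * Levels of the bad vertices *)

Section Levels.
Variables (V : finType) (adj : bool -> rel V) (X Bad : {set V}) (q r t rho mD : nat).
Hypothesis min_deg : forall s v, q.*2 <= #|[set w | adj s v w & w \notin X]|.
Hypothesis expand : forall (A B : {set V}) s, #|A| <= mD ->
  (forall v, v \in A -> q <= #|[set w in B | adj s v w]|) -> rho * #|A| <= #|B|.
Hypotheses (q_gt0 : 0 < q) (rrho : r.*2 <= rho) (BadD : #|Bad| <= mD) (Badt : #|Bad| < r ^ t).
Hypothesis BadX : [disjoint Bad & X].

Definition next_bad (B : {set V}) : {set V} :=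
  [set v in B | [exists s, q <= #|[set w in B | adj s v w]|]].

Definition bads i : {set V} := iter i next_bad Bad.

(** Vertices of [X] get the top level, since a descent from them may go to any vertex outside [X],
    bad or not. *)
Definition level v : nat := if v \in X then t.+1 else \sum_(i < t) (v \in bads i).

Lemma bads_sub i j : i <= j -> bads j \subset bads i.
Proof.
move=> ij; rewrite -(subnK ij); elim: (j - i) => [|k IH] //.
rewrite addSn /bads iterS -/(bads _); apply: subset_trans IH.
by apply/subsetP => v; rewrite inE => /andP [].
Qed.

(** For each of the two signs at most a [1 / rho] part survives a stage, and [r.*2 <= rho]. *)
Lemma card_bads i : r ^ i * #|bads i| <= #|Bad|.
Proof.
elim: i => [|i IH]; first by rewrite mul1n.
apply: leq_trans IH; rewrite expnSr -mulnA leq_mul2l; apply/orP; right.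
have B1 s : rho * #|[set v in bads i | q <= #|[set w in bads i | adj s v w]|]| <= #|bads i|.
  apply: (expand (s := s)); last by move=> v; rewrite inE => /andP [].
  apply: leq_trans BadD; apply: subset_leq_card.
  by apply: subset_trans (bads_sub (leq0n i)); apply/subsetP => v; rewrite inE => /andP [].
have sub : bads i.+1 \subset
    [set v in bads i | q <= #|[set w in bads i | adj true v w]|] :|:
    [set v in bads i | q <= #|[set w in bads i | adj false v w]|].
  apply/subsetP => v; rewrite /bads iterS -/(bads i) !inE.
  by move=> /andP [-> /existsP [[] ->]]; rewrite ?orbT.
have := subset_leq_card sub; have := (leq_card_setU
    [set v in bads i | q <= #|[set w in bads i | adj true v w]|]
    [set v in bads i | q <= #|[set w in bads i | adj false v w]|]).1.
have := B1 true; have := B1 false; move: rrho; clear; nia.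
Qed.

Lemma bads_t : bads t = set0.
Proof.
apply/eqP; rewrite -cards_eq0 -leqn0 leqNgt; apply/negP => B0.
have := card_bads t; move: Badt B0; clear; nia.
Qed.

Lemma level_max v : level v <= t.+1.
Proof.
rewrite /level; case: ifP => // _; apply: leqW.
apply: (@leq_trans (\sum_(i < t) 1)).
  by apply: leq_sum => i _; apply: leq_b1.
by rewrite sum_nat_const card_ord muln1.
Qed.

Lemma level_bound i v : v \notin X -> v \notin bads i -> level v <= i.
Proof.
move=> vX vi; rewrite /level (negbTE vX).
apply: (@leq_trans (\sum_(j < t) (j < i))).
  apply: leq_sum => j _; case: ltnP => [_|ij]; first exact: leq_b1.
  by rewrite leqn0 eqb0; apply: contra vi; apply/subsetP/bads_sub.
elim: (t) => [|u IH]; first by rewrite big_ord0.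
rewrite big_ord_recr /=; have [ui|ui] := ltnP u i; last by rewrite addn0.
apply: leq_trans (_ : \sum_(j < u) 1 + 1 <= _).
  by rewrite leq_add2r; apply: leq_sum => j _; apply: leq_b1.
by rewrite sum_nat_const card_ord muln1 addn1.
Qed.

Lemma level_ge i v : v \notin X -> v \in bads i -> i < t -> i < level v.
Proof.
move=> vX vi it; rewrite /level (negbTE vX).
apply: (@leq_trans (\sum_(j < t) (j <= i))); last first.
  apply: leq_sum => j _; case: (leqP j i) => // ji.
  by rewrite (subsetP (bads_sub ji)).
have h u : i < u -> i < \sum_(j < u) (j <= i).
  elim: u => // u IH; rewrite big_ord_recr /= ltnS leq_eqVlt => /orP [/eqP <-|iu].
    rewrite leqnn addn1 ltnS; apply: leq_trans (_ : \sum_(j < i) 1 <= _).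
      by rewrite sum_nat_const card_ord muln1.
    by apply: leq_sum => j _; rewrite (ltnW (ltn_ord j)).
  by apply: leq_trans (IH iu) (leq_addr _ _).
exact: h.
Qed.

Lemma level0 v : (level v == 0) = (v \notin X :|: Bad).
Proof.
rewrite inE negb_or; have [vX|vX] := boolP (v \in X); first by rewrite /level vX.
have t0 : v \in Bad -> 0 < t.
  move=> vB; rewrite lt0n; apply/eqP => t0; have := bads_t; rewrite t0 => B0.
  by move: vB; rewrite -[Bad]/(bads 0) B0 inE.
apply/idP/idP => /=.
  by apply: contraTN => vB; rewrite -lt0n; apply: level_ge => //; apply: t0.
by move=> vB; rewrite -leqn0; apply: level_bound.
Qed.

(** A vertex that drops out after stage [i] has fewer than [q] [s]-neighbours in [bads i]. Its other
    neighbours outside [X] have level at most [i], and at least [q] of them remain by [min_deg]. *)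
Lemma level_deg s v : v \in X :|: Bad ->
  q <= #|[set w | [&& adj s v w, w \notin X & level w < level v]]|.
Proof.
have lq := min_deg s v.
have q2 : q <= q.*2 by rewrite -addnn leq_addr.
rewrite inE; have [vX _|vX /= vB] := boolP (v \in X).
  apply: leq_trans q2 (leq_trans lq _); apply: subset_leq_card.
  apply/subsetP => w; rewrite !inE => /andP [-> wX]; rewrite wX /=.
  by rewrite {2}/level vX ltnS; apply: level_bound => //; rewrite bads_t inE.
have [i [it vi vi1]] : exists i, [/\ i < t, v \in bads i & v \notin bads i.+1].
  have ex : exists i, v \notin bads i by exists t; rewrite bads_t inE.
  case: (ex_minnP ex) => [[|i]] vi mini; first by rewrite /bads /= vB in vi.
  exists i; split=> //; first by apply: mini; rewrite bads_t inE.
  by apply: contraT => /mini; rewrite ltnn.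
have lti : #|[set w in bads i | adj s v w]| < q.
  move: vi1; rewrite /bads iterS -/(bads i) inE vi /= => /existsPn /(_ s).
  by rewrite -ltnNge.
have sub : [set w | adj s v w & w \notin X] \subset
    [set w in bads i | adj s v w] :|: [set w | [&& adj s v w, w \notin X & level w < level v]].
  apply/subsetP => w; rewrite !inE => /andP [-> wX]; rewrite wX /= andbT.
  have [//|wi] := boolP (w \in bads i).
  exact: leq_ltn_trans (level_bound wX wi) (level_ge vX vi it).
have := subset_leq_card sub; have := (leq_card_setU [set w in bads i | adj s v w]
   [set w | [&& adj s v w, w \notin X & level w < level v]]).1.
move: lq lti; clear; lia.
Qed.

End Levels.

(** * Reserving neighbours for the bad vertices *)

Section Reserve.
Variables (V : finType) (G : rel V) (adj : bool -> rel V) (X : {set V}) (lev : V -> nat).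
Variables (m b r q K mD wmax : nat).
Local Notation L := (V * option (bool * bool))%type.

Definition ground : {set V} := [set v | lev v == 0].
Local Notation U := ground.

(* [(u, None)] asks for neighbours of [u] in [G]; [(z, Some (s, side))] asks for
   an [s]-neighbour of [z] of lower level, to be used on the given side of [z]. *)
Definition nbr (l : L) : {set V} :=
  if l.2 is Some (s, _) then [set w | [&& adj s l.1 w, w \notin X & lev w < lev l.1]]
  else [set w in U | G l.1 w].

Definition want (l : L) : nat := if l.2 is Some _ then 1 else r.

Definition labels : {set L} :=
  [set l | if l.2 is Some _ then l.1 \notin U else l.1 \in U].

Let nZ := #|~: U|.
(** There are at most [4 * nZ] descent labels, from two signs and two sides, so any [ms] labels
    include at least [m] labels of the form [(u, None)]. *)
Let ms := 4 * nZ + m.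

Hypothesis lev_deg : forall s v, v \notin U ->
  q <= #|[set w | [&& adj s v w, w \notin X & lev w < lev v]]|.
Hypothesis expand : forall (A B : {set V}) s, #|A| <= mD ->
  (forall v, v \in A -> q <= #|[set w in B | adj s v w]|) -> 8 * #|A| <= #|B|.
Hypothesis expU : forall A : {set V}, A \subset U -> 0 < #|A| <= K ->
  r.*2 * #|A| <= #|extnbr U G A|.
Hypothesis spr : spreads G m b.
Hypotheses (m_gt0 : 0 < m) (r_gt0 : 0 < r) (msK : ms.*2 <= K) (ZD : nZ <= mD).
Hypothesis num : nZ + ms.*2 + b + wmax + ms.*2 * r < #|V|.

Definition gpart (A : {set L}) : {set V} := [set v | (v, None) \in A].
Definition dpart (A : {set L}) (s : bool) : {set V} :=
  [set v | ((v, Some (s, true)) \in A) || ((v, Some (s, false)) \in A)].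

Lemma labels_parts (A : {set L}) : A \subset
  [set (v, None) | v in gpart A] :|:
  ([set (p.1, Some (true, p.2)) | p in setX (dpart A true) [set: bool]] :|:
   [set (p.1, Some (false, p.2)) | p in setX (dpart A false) [set: bool]]).
Proof.
apply/subsetP => -[v [[s side]|]] lA; rewrite !inE.
  have h : (v, side) \in setX (dpart A s) [set: bool].
    by rewrite !inE /= andbT; case: side lA => ->; rewrite ?orbT.
  case: s h {lA} => h; apply/orP; right; apply/orP; [left|right];
    apply/imsetP; by exists (v, side).
by apply/orP; left; apply/imsetP; exists v => //; rewrite inE.
Qed.

Lemma card_dpart_img (A : {set L}) s :
  #|[set ((p.1, Some (s, p.2)) : L) | p in setX (dpart A s) [set: bool]]| <= 2 * #|dpart A s|.
Proof.
by apply: leq_trans (leq_imset_card _ _) _; rewrite cardsX cardsT card_bool mulnC.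
Qed.

Lemma card_gpart (A : {set L}) : #|gpart A| <= #|A|.
Proof.
have inj : injective (fun v : V => (v, None) : L) by move=> u v [].
rewrite -(card_imset (gpart A) inj); apply: subset_leq_card.
by apply/subsetP => l /imsetP [v]; rewrite inE => vA ->.
Qed.

Lemma card_labels (A : {set L}) :
  #|A| <= #|gpart A| + (2 * #|dpart A true| + 2 * #|dpart A false|).
Proof.
apply: leq_trans (subset_leq_card (labels_parts A)) _.
apply: leq_trans (leq_card_setU _ _) _; apply: leq_add; first exact: leq_imset_card.
apply: leq_trans (leq_card_setU _ _) _; apply: leq_add; exact: card_dpart_img.
Qed.

Lemma dem_labels (A : {set L}) :
  dem want A <= r * #|gpart A| + (2 * #|dpart A true| + 2 * #|dpart A false|).
Proof.
rewrite /dem (bigID (fun l : L => l.2 == None)) /=; apply: leq_add.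
  apply: (@leq_trans (\sum_(l in [set ((v, None) : L) | v in gpart A]) r)).
    rewrite [leqLHS](eq_bigl (mem [set ((v, None) : L) | v in gpart A])) => [|l].
      by apply: leq_sum => -[v [s|]] /imsetP [v' _ []].
    apply/andP/imsetP => [[lA /eqP l2]|[v]].
      by exists l.1; [rewrite inE|]; case: l l2 lA => v [s|].
    by rewrite inE => vA ->.
  by rewrite sum_nat_const mulnC leq_mul2l leq_imset_card orbT.
set B := [set l in A | l.2 != None].
have -> : \sum_(l in A | l.2 != None) want l = \sum_(l in B) 1.
  by apply: eq_big => [l|[v [s|]] /andP []]; rewrite ?inE.
rewrite sum1_card; apply: leq_trans (card_labels B) _.
have -> : gpart B = set0 by apply/setP => v; rewrite !inE andbF.
rewrite cards0 add0n; apply: leq_add; rewrite leq_mul2l; apply/orP; right;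
  by apply: subset_leq_card; apply/subsetP => v; rewrite !inE !andbT.
Qed.

Lemma nbr_gpart (A : {set L}) : extnbr U G (gpart A) \subset \bigcup_(l in A) nbr l.
Proof.
apply/subsetP => w; rewrite inE => /and3P [wU _ /existsP [a /andP []]].
rewrite inE => aA Gaw; apply/bigcupP; exists (a, None) => //.
by rewrite inE wU.
Qed.

Lemma gpart_sub (A : {set L}) : A \subset labels -> gpart A \subset U.
Proof. by move=> AL; apply/subsetP => v; rewrite inE => /(subsetP AL); rewrite inE. Qed.

Lemma dpart_sub (A : {set L}) s : A \subset labels -> dpart A s \subset ~: U.
Proof.
move=> AL; apply/subsetP => v; rewrite inE in_setC.
by move=> /orP [] /(subsetP AL); rewrite inE.
Qed.

(** Half of the supply pays for the labels [(u, None)], as [G] expands by [r.*2], and a quarter for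
    the descents of each sign: the factor 8 is four times their demand of at most 2 per vertex. *)
Lemma extendable_init : extendable nbr want labels ms (fun _ => None).
Proof.
move=> A AL Am.
have -> : effs nbr (fun _ => None) A = \bigcup_(l in A) nbr l.
  by apply: eq_bigr => l _; apply/setP => w; rewrite inE andbT.
set N := \bigcup_(l in A) nbr l.
have D s : 8 * #|dpart A s| <= #|N|.
  apply: (expand (s := s)).
    by apply: leq_trans ZD; apply: subset_leq_card; apply: dpart_sub.
  move=> v vA; have vU : v \notin U by rewrite -in_setC (subsetP (dpart_sub s AL)).
  apply: leq_trans (lev_deg s vU) _; apply: subset_leq_card.
  apply/subsetP => w; rewrite !inE => /and3P [aw wX lw]; rewrite aw andbT.
  move: vA; rewrite inE => /orP [] lA; apply/bigcupP.
    by exists (v, Some (s, true)) => //; rewrite inE /= aw wX.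
  by exists (v, Some (s, false)) => //; rewrite inE /= aw wX.
have E : r.*2 * #|gpart A| <= #|N|.
  have [->|A0] := eqVneq (gpart A) set0; first by rewrite cards0 muln0.
  apply: leq_trans (expU (gpart_sub AL) _) (subset_leq_card (nbr_gpart A)).
  by rewrite card_gt0 A0 (leq_trans (card_gpart A)) // (leq_trans Am).
apply: leq_trans (dem_labels A) _.
by have := D true; have := D false; move: E; clear; nia.
Qed.

(** Some [m] of the labels are of the form [(u, None)]; their vertices and the neighbours of these
    cover all but at most [b] of [U]. Losing the at most [wmax] reserved vertices leaves more than
    the demand. *)
Lemma roomy_dom (par : V -> option L) : #|dom par| <= wmax -> roomy nbr want labels ms par.
Proof.
move=> wm A AL /andP [mA Am].
have hg := card_gpart A; have hl := card_labels A.
have hz s : #|dpart A s| <= nZ by apply: subset_leq_card; apply: dpart_sub.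
have mg : m <= #|gpart A|.
  have := hz true; have := hz false; move: (leq_trans mA hl); rewrite /ms; clear; lia.
have hU : #|U| <= #|gpart A| + #|extnbr U G (gpart A)| + b.
  exact: (card_extnbr_spread U spr mg).
have cU : #|U| + nZ = #|V| by rewrite /nZ cardsC.
have sub : extnbr U G (gpart A) \subset effs nbr par A :|: dom par.
  apply/subsetP => w /(subsetP (nbr_gpart A)) /bigcupP [l lA wl].
  rewrite in_setU; have [pw|pw] := boolP (w \in dom par); first by rewrite orbT.
  rewrite orbF; apply/bigcupP; exists l => //; rewrite inE wl /=.
  by move: pw; rewrite inE; case: (par w).
have hs := subset_leq_card sub; have hsU := (leq_card_setU (effs nbr par A) (dom par)).1.
have hd : dem want A <= ms.*2 * r.
  apply: (@leq_trans (\sum_(l in A) r)).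
    by apply: leq_sum => -[v [s|]] _.
  by rewrite sum_nat_const leq_mul2r Am orbT.
apply: leq_ltn_trans hd _.
move: num (leq_trans hs hsU) cU hU (leq_trans hg Am) wm; clear.
move: (ms.*2) (#|gpart A|) (#|effs nbr par A|) (#|dom par|) (#|V|) (#|U|) => *; lia.
Qed.

(** All four labels of a vertex are served in advance, because the signs needed on its two sides
    depend on the position it will get on the cycle. *)
Lemma reserve : 4 * nZ <= wmax -> exists par : V -> option L,
  [/\ good nbr want labels ms par, #|dom par| <= 4 * nZ,
     forall v, unlab par v &
     forall v s side, v \notin U -> exists w, par w = Some (v, Some (s, side))].
Proof.
move=> w4.
pose Lz : {set L} := [set l in labels | l.2 != None].
have cLz : #|Lz| <= 4 * nZ.
  apply: leq_trans (card_labels Lz) _.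
  have -> : gpart Lz = set0 by apply/setP => v; rewrite !inE andbF.
  have sub : Lz \subset labels by apply/subsetP => l; rewrite inE => /andP [].
  have h s : #|dpart Lz s| <= nZ by apply: subset_leq_card; apply: dpart_sub.
  by rewrite cards0; have := h true; have := h false; clear; lia.
have step (ls : seq L) : uniq ls -> {subset ls <= Lz} -> exists par : V -> option L,
    [/\ extendable nbr want labels ms par /\ consistent nbr par, #|dom par| = size ls,
       forall w l, par w = Some l -> l \in ls &
       forall l, l \in ls -> exists w, par w = Some l].
  elim: ls => [|l ls IH] /=.
    move=> _ _; exists (fun _ => None); split=> //.
      by split; first exact: extendable_init.
    by apply/eqP; rewrite cards_eq0; apply/eqP/setP => w; rewrite !inE.
  move=> /andP [lls uls] sub.
  have [|par [[ext con] dm lab srv]] := IH uls.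
    by move=> l' h; apply: sub; rewrite inE h orbT.
  have lLz : l \in Lz by apply: sub; rewrite mem_head.
  have dl : want l = 1 by move: lLz; rewrite !inE => /andP [_]; case: l {lls sub} => v [].
  have ch : #|children par l| < want l.
    rewrite dl ltnS leqn0 cards_eq0; apply/eqP/setP => w; rewrite !inE.
    by apply/negP => /eqP /lab; rewrite (negbTE lls).
  have dw : #|dom par| <= wmax.
    rewrite dm; apply: leq_trans w4; apply: leq_trans cLz.
    have /card_uniqP <- := uls; apply: subset_leq_card; apply/subsetP => l' h.
    by apply: sub; rewrite inE h orbT.
  have ms0 : 0 < ms by rewrite /ms addn_gt0 m_gt0 orbT.
  have [|y [yN yp] exty] := extend_step ms0 ext con (roomy_dom dw) _ ch.
    by move: lLz; rewrite inE => /andP [].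
  exists (upd par y l); split.
  - by split=> // z l'; rewrite /upd; case: eqP => [-> [<-]|_ /con].
  - have -> : dom (upd par y l) = y |: dom par.
      by apply/setP => z; rewrite !inE /upd; case: (z =P y).
    by rewrite cardsU1 inE yp dm.
  - move=> w l'; rewrite /upd inE; case: eqP => [_ [->]|_ /lab ->].
      by rewrite eqxx.
    by rewrite orbT.
  - move=> l'; rewrite inE => /orP [/eqP ->|/srv [w pw]].
      by exists y; rewrite /upd eqxx.
    exists w; rewrite /upd; case: eqP => [wy|//].
    by rewrite wy yp in pw.
have [|par [[ext con] dm lab srv]] := step (enum Lz) (enum_uniq _).
  by move=> l; rewrite mem_enum.
have un v : unlab par v.
  by move=> y /lab; rewrite mem_enum !inE andbF.
exists par; split=> //.
- by split=> // y v /un.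
- by rewrite dm -cardE.
- by move=> v s side vU; apply: srv; rewrite mem_enum !inE /= andbT -/U; move: vU; rewrite inE.
Qed.

End Reserve.

(** * Blocks *)

Section PositionedSequences.
Variable V : eqType.
Implicit Types (E : nat -> rel V) (p : seq V).

(** The relation varies with the position, so that the step leaving position [k] can be made to
    follow the orientation of the cycle there. *)
Fixpoint oseq E k p : bool :=
  match p with
  | x :: (y :: _) as p' => E k x y && oseq E k.+1 p'
  | _ => true
  end.

Lemma oseq_cat E k p1 x p2 :
  oseq E k (p1 ++ x :: p2) = oseq E k (rcons p1 x) && oseq E (k + size p1) (x :: p2).
Proof.
elim: p1 k => [|a [|b p1] IH] k; first by rewrite addn0.
  by rewrite [LHS]/= [X in _ = X && _]/= andbT addn1.
by have := IH k.+1; rewrite addSnnS /= => ->; rewrite andbA.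
Qed.

Lemma oseq_sub E E' k p : (forall j x y, E j x y -> E' j x y) -> oseq E k p -> oseq E' k p.
Proof.
move=> h; elim: p k => [|x [|y p] IH] k //= /andP [/h -> hp] /=.
exact: IH.
Qed.

Lemma oseq_path E (G : rel V) k x p : (forall j, subrel G (E j)) -> path G x p -> oseq E k (x :: p).
Proof.
move=> h; elim: p x k => [|y p IH] x k //= /andP [/h -> hp] /=.
exact: IH.
Qed.

Lemma oseq_nth E k p x0 j : oseq E k p -> j.+1 < size p ->
  E (k + j) (nth x0 p j) (nth x0 p j.+1).
Proof.
elim: p k j => [|x [|y p] IH] k [|j] //= /andP [Exy hp] jp.
  by rewrite addn0.
by rewrite -addSnnS; apply: IH.
Qed.

End PositionedSequences.

(** * Descents, blocks and roots *)

Section Blocks.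
Variables (V : finType) (G : rel V) (adj : bool -> rel V) (X : {set V}) (lev : V -> nat) (t : nat).
Local Notation L := (V * option (bool * bool))%type.
Local Notation U := (ground lev).
Variables (par0 : V -> option L) (sg : nat -> bool) (pos : V -> nat).

Hypothesis adjC : forall s u v, adj (~~ s) u v = adj s v u.
Hypothesis con0 : consistent (nbr G adj X lev) par0.
Hypothesis own0 : forall v s side, v \notin U ->
  exists w, par0 w = Some (v, Some (s, side)).
Hypothesis lev_max : forall v, lev v <= t.+1.

(** The sign is forgotten: which of the two reserved neighbours is used depends on the position
    only. *)
Definition prel (side : bool) : rel V := fun u w =>
  if par0 w is Some (u', Some (_, side')) then (u' == u) && (side' == side) else false.

Lemma prel_facts side u w : prel side u w -> [/\ lev w < lev u, w \notin X & par0 w].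
Proof.
rewrite /prel; case E: (par0 w) => [[u' [[s side']|]]|] // /andP [/eqP <- _].
by have := con0 E; rewrite inE /= => /and3P [].
Qed.

Lemma prel_inj side u u' w : prel side u w -> prel (~~ side) u' w -> false.
Proof.
rewrite /prel; case: (par0 w) => [[u0 [[s side']|]]|] //.
by move=> /andP [_ /eqP ->] /andP [_]; case: side.
Qed.

Fixpoint spath (tau : nat -> bool) j z c : bool :=
  if c is w :: c' then adj (tau j) z w && spath tau j.+1 w c' else true.

Definition is_chain side tau j z c : Prop :=
  [/\ size c <= lev z, spath tau j z c, last z c \in U, path (prel side) z c &
      z \notin U -> c != [::]].

(** Reserved neighbours have lower level, so following them reaches level 0, which is [U], within
    [lev z] steps. *)
Lemma chain_exists side tau j z : exists c, is_chain side tau j z c.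
Proof.
have [k] := ubnP (lev z); elim: k z j => // k IH z j lz.
have [zU|zU] := boolP (z \in U); first by exists [::]; split; rewrite ?zU.
have [w pw] := own0 (tau j) side zU.
have := con0 pw; rewrite inE /= => /and3P [aw wX lw].
have [|c [sc pc lc prc _]] := IH w j.+1.
  by apply: leq_trans lw _; rewrite -ltnS.
exists (w :: c); split=> //=.
- exact: leq_ltn_trans sc lw.
- by rewrite aw.
- by rewrite {1}/prel pw !eqxx.
Qed.

Lemma chain_low side z c : path (prel side) z c ->
  all (fun w => [&& lev w < lev z, w \notin X & isSome (par0 w)]) c.
Proof.
elim: c z => //= w c IH z /andP [/prel_facts [lw wX pw] pc].
rewrite lw wX pw /=; apply: sub_all (IH _ pc) => y /and3P [ly -> ->].
by rewrite (ltn_trans ly lw).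
Qed.

Lemma chain_uniq side z c : path (prel side) z c -> uniq (z :: c).
Proof.
elim: c z => //= w c IH z pc; have low := chain_low (c := w :: c) pc.
move: pc => /= /andP [_ /IH ->]; rewrite andbT.
by apply/negP => /(allP low); rewrite ltnn.
Qed.

Lemma chain_parent side z c w : path (prel side) z c -> w \in c ->
  exists2 u, u \in z :: c & prel side u w.
Proof.
elim: c z => //= y c IH z /andP [py pc]; rewrite inE => /orP [/eqP ->|wc].
  by exists z; rewrite ?mem_head.
have [u uc pu] := IH _ pc wc; exists u => //.
by rewrite in_cons uc orbT.
Qed.

Local Notation E0 := (fun k => adj (sg k)).

Lemma chain_right i j z c : spath (fun j => sg (i + j)) j z c -> oseq E0 (i + j) (z :: c).
Proof.
elim: c z j => [|w c IH] z j // /andP [aw pc].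
have := IH w j.+1 pc; rewrite addnS => h.
by rewrite /= aw.
Qed.

(** A left chain is followed against the cycle: its step [j] lies between the positions [i - j.+1]
    and [i - j] and is traversed backwards, hence the negated sign. *)
Lemma chain_left i j z c : j + size c <= i ->
  spath (fun j => ~~ sg (i - j.+1)) j z c -> oseq E0 (i - (j + size c)) (rev (z :: c)).
Proof.
elim: c z j => [|w c IH] z j // ji /andP [aw pc].
have := IH w j.+1; rewrite addSnnS => /(_ ji pc) h.
rewrite rev_cons [rev (w :: c)]rev_cons -cats1 cat_rcons oseq_cat -rev_cons h /=.
rewrite andbT size_rev -adjC.
have -> // : i - (j + (size c).+1) + size c = i - j.+1.
by move: ji => /=; clear; lia.
Qed.

Lemma chains : exists CL CR : nat * V -> seq V, forall r,
  is_chain false (fun j => ~~ sg (r.1 - j.+1)) 0 r.2 (CL r) /\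
  is_chain true (fun j => sg (r.1 + j)) 0 r.2 (CR r).
Proof.
have [CL hL] := boolp.choice (fun r : nat * V =>
  chain_exists false (fun j => ~~ sg (r.1 - j.+1)) 0 r.2).
have [CR hR] := boolp.choice (fun r : nat * V =>
  chain_exists true (fun j => sg (r.1 + j)) 0 r.2).
by exists CL, CR.
Qed.

Variables (CL CR : nat * V -> seq V).
Hypothesis hC : forall r,
  is_chain false (fun j => ~~ sg (r.1 - j.+1)) 0 r.2 (CL r) /\
  is_chain true (fun j => sg (r.1 + j)) 0 r.2 (CR r).

(* The root [r.2] is to be placed at position [r.1] of the cycle; its block also
   contains the descents [CL r] to its left and [CR r] to its right. *)
Definition bhead (r : nat * V) : V := last r.2 (CL r).
Definition btail (r : nat * V) : seq V := rev (belast r.2 (CL r)) ++ CR r.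
Definition blk r := bhead r :: btail r.
Definition bstart r := r.1 - size (CL r).
Definition cover (rs : seq (nat * V)) : seq V := flatten (map blk rs).

Lemma blkE r : blk r = rev (CL r) ++ r.2 :: CR r.
Proof.
by rewrite -cat_rcons -rev_cons lastI rev_rcons.
Qed.

Lemma blk_oseq r : t < r.1 -> oseq E0 (bstart r) (blk r).
Proof.
have [[sL pL _ _ _] [_ pR _ _ _]] := hC r.
move=> tr; rewrite blkE oseq_cat -rev_cons.
have szL : size (CL r) <= r.1 by apply: leq_trans sL (leq_trans (lev_max _) tr).
rewrite (chain_left _ pL) ?add0n // /bstart size_rev subnK //=.
by have := chain_right pR; rewrite addn0.
Qed.

(** Levels fall strictly along each chain, and the two chains are disjoint because a vertex is
    reserved for one side only. *)
Lemma blk_uniq r : uniq (blk r).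
Proof.
have [[_ _ _ pL _] [_ _ _ pR _]] := hC r.
rewrite blkE cat_uniq rev_uniq (chain_uniq pR) andbT.
have /andP [zL uL] : (r.2 \notin CL r) && uniq (CL r) := chain_uniq pL.
rewrite uL; apply/hasPn => w; rewrite [_ \in rev _]mem_rev inE => /orP [/eqP -> //|wR].
apply/negP => wL; have [u _ pu] := chain_parent pL wL.
have [u' _ pu'] := chain_parent pR wR.
by have := prel_inj pu pu'.
Qed.

Lemma blk_mem r w : w \in blk r -> w = r.2 \/
  [/\ par0 w, w \notin X, lev w < lev r.2 &
    exists2 u, u \in blk r & exists side, prel side u w].
Proof.
have [[_ _ _ pL _] [_ _ _ pR _]] := hC r.
rewrite blkE mem_cat mem_rev inE => /or3P [wL|/eqP ->|wR]; [right|by left|right].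
  have /and3P [h1 h2 h3] := allP (chain_low pL) _ wL; split=> //.
  have [u uL pu] := chain_parent pL wL; exists u; last by exists false.
  by move: uL; rewrite mem_cat mem_rev !inE => /orP [->|->]; rewrite ?orbT.
have /and3P [h1 h2 h3] := allP (chain_low pR) _ wR; split=> //.
have [u uR pu] := chain_parent pR wR; exists u; last by exists true.
by rewrite mem_cat uR orbT.
Qed.

(** A descent that starts outside a set closed under parents cannot enter it, so a new block avoids
    the earlier ones as soon as its root does. *)
Definition closedc (S : seq V) : Prop :=
  forall y u side, y \in S -> prel side u y -> u \in S.

Lemma chain_avoid side z c (S : seq V) : closedc S -> z \notin S -> path (prel side) z c ->
  forall w, w \in c -> w \notin S.
Proof.
move=> cl; elim: c z => //= y c IH z zS /andP [py pc] w.
have yS : y \notin S by apply: contra zS => yS; apply: cl yS py.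
by rewrite inE => /orP [/eqP ->|]; [|apply: IH pc _].
Qed.

Lemma cover_rcons rs r : cover (rcons rs r) = cover rs ++ blk r.
Proof. by rewrite /cover map_rcons flatten_rcons. Qed.

Lemma cover_step rs r : closedc (cover rs) -> uniq (cover rs) ->
  r.2 \notin cover rs -> (forall side u, prel side u r.2 -> u \in cover rs) ->
  uniq (cover (rcons rs r)) /\ closedc (cover (rcons rs r)).
Proof.
have [[_ _ _ pL _] [_ _ _ pR _]] := hC r.
move=> cl un zS pz; rewrite cover_rcons; split.
  rewrite cat_uniq un blk_uniq andbT andTb; apply/hasPn => w.
  rewrite blkE mem_cat mem_rev inE => /or3P [wL|/eqP -> //|wR].
    exact: (chain_avoid cl zS pL wL).
  exact: (chain_avoid cl zS pR wR).
move=> y u side; rewrite !mem_cat => /orP [yS /(cl _ _ _ yS) -> //|/blk_mem].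
case=> [->|[_ _ _ [v vb [side' pv]]] pu]; first by move=> /pz ->.
suff -> : u = v by rewrite vb orbT.
move: pu pv; rewrite /prel; case: (par0 y) => [[u0 [[s sd]|]]|] //.
by move=> /andP [/eqP <- _] /andP [/eqP <- _].
Qed.

Definition gapr (l : nat) : rel (nat * V) := fun a b => a.1 + l <= b.1.

(** The next root is an uncovered vertex of maximal level: the vertex it is reserved for, if any,
    has higher level and is covered already, so the cover stays closed. Each new root is placed [l]
    positions after the last one. *)
Lemma roots_complete l p r0 rs :
  path (gapr l) r0 rs -> uniq (cover (r0 :: rs)) -> closedc (cover (r0 :: rs)) ->
  {subset X <= cover (r0 :: rs)} -> t < r0.1 ->
  (forall r, r \in r0 :: rs -> r.2 \notin U /\ t < r.1 <= p) ->
  exists rs', [/\ path (gapr l) r0 rs', uniq (cover (r0 :: rs')),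
    forall v, v \notin U -> v \in cover (r0 :: rs'),
    {subset rs <= rs'} &
    forall r, r \in r0 :: rs' -> r.2 \notin U /\ t < r.1 <= p + l * #|~: U|].
Proof.
suff H k : forall rs p, #|[set v in ~: U | v \notin cover (r0 :: rs)]| <= k ->
  path (gapr l) r0 rs -> uniq (cover (r0 :: rs)) -> closedc (cover (r0 :: rs)) ->
  {subset X <= cover (r0 :: rs)} -> t < r0.1 ->
  (forall r, r \in r0 :: rs -> r.2 \notin U /\ t < r.1 <= p) ->
  exists rs', [/\ path (gapr l) r0 rs', uniq (cover (r0 :: rs')),
    forall v, v \notin U -> v \in cover (r0 :: rs'),
    {subset rs <= rs'} &
    forall r, r \in r0 :: rs' -> r.2 \notin U /\ t < r.1 <= p + l * k].
  move=> h1 h2 h3 h4 h5 h6; apply: (H #|~: U| rs p) => //.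
  by apply: subset_leq_card; apply/subsetP => v; rewrite inE => /andP [].
elim: k => [|k IH] {}rs {}p hk pa un cl Xs t0 hr.
  exists rs; split=> //; last by move=> r /hr; rewrite muln0 addn0.
  move=> v vU; apply: contraT => vc.
  have : v \in [set v in ~: U | v \notin cover (r0 :: rs)] by rewrite inE in_setC vU.
  by move: hk; rewrite leqn0 cards_eq0 => /eqP ->; rewrite inE.
set B := [set v in ~: U | v \notin cover (r0 :: rs)] in hk.
have [B0|[v0 v0B]] := set_0Vmem B.
  exists rs; split=> //.
    move=> v vU; apply: contraT => vc.
    have : v \in B by rewrite inE in_setC vU.
    by rewrite B0 inE.
  move=> r /hr [-> /andP [-> h]]; split=> //=.
  exact: leq_trans h (leq_addr _ _).
pose z := [arg max_(v > v0 in B) lev v].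
have [zB maxz] : z \in B /\ (forall v, v \in B -> lev v <= lev z).
  by rewrite /z; case: arg_maxnP.
have /andP [zU zc] : (z \notin U) && (z \notin cover (r0 :: rs)).
  by move: zB; rewrite inE in_setC.
pose i := (last r0 rs).1 + l; pose r : nat * V := (i, z).
have pz side u : prel side u z -> u \in cover (r0 :: rs).
  move=> pu; have [lz _ _] := prel_facts pu.
  apply: contraT => uc; have : u \in B.
    by rewrite inE uc in_setC inE andbT -lt0n; apply: leq_ltn_trans lz.
  by move=> /maxz; rewrite leqNgt lz.
have [un' cl'] := cover_step (r := r) cl un zc pz.
have [lU /andP [lt lp]] := hr _ (mem_last r0 rs).
have [|||||||rs' [h1 h2 h3 h4 h5]] := IH (rcons rs r) (p + l).
- rewrite -ltnS; apply: leq_trans hk; apply: proper_card; apply/properP; split.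
    apply/subsetP => v; rewrite !in_set -rcons_cons cover_rcons mem_cat negb_or.
    by move=> /and3P [-> ->].
  exists z => //; rewrite in_set negb_and negbK; apply/orP; right.
  by rewrite -rcons_cons cover_rcons mem_cat blkE [in X in _ || X]mem_cat mem_head !orbT.
- by rewrite rcons_path pa /gapr /= leqnn.
- by rewrite -rcons_cons.
- by rewrite -rcons_cons.
- by move=> v /Xs vc; rewrite -rcons_cons cover_rcons mem_cat vc.
- by [].
- move=> r'; rewrite -rcons_cons mem_rcons inE => /orP [/eqP ->|/hr [-> /andP [-> h]]].
    rewrite zU /= /i leq_add2r lp andbT; split=> //.
    exact: leq_trans lt (leq_addr _ _).
  by split=> //=; apply: leq_trans h (leq_addr _ _).
exists rs'; split=> //.
  by move=> r' r'rs; apply: h4; rewrite mem_rcons inE r'rs orbT.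
by move=> r' /h5; rewrite mulnS addnA.
Qed.

(** Vertices of [X] are never reserved for a descent, so [cover_step] applies to them in any order.
    Sorting by position supplies the gaps, and [roots_complete] adds the other roots. *)
Lemma roots_exist l p : 0 < l -> X != set0 -> (forall x, x \in X -> x \notin U) ->
  (forall x, x \in X -> t < pos x <= p) ->
  (forall x y, x \in X -> y \in X -> x != y -> pos x + l <= pos y \/ pos y + l <= pos x) ->
  exists r0 rs, [/\ path (gapr l) r0 rs, uniq (cover (r0 :: rs)),
    forall v, v \notin U -> v \in cover (r0 :: rs),
    forall x, x \in X -> (pos x, x) \in r0 :: rs &
    forall r, r \in r0 :: rs -> r.2 \notin U /\ t < r.1 <= p + l * #|~: U|].
Proof.
move=> l0 X0 XU tp gap.
pose xs := sort (fun x y => pos x <= pos y) (enum X).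
pose f (x : V) := (pos x, x).
have xsX x : (x \in xs) = (x \in X) by rewrite mem_sort mem_enum.
have uxs : uniq xs by rewrite sort_uniq enum_uniq.
have so : sorted (gapr l) (map f xs).
  rewrite sorted_map; apply: pairwise_sorted.
  have p1 : pairwise (fun x y => pos x <= pos y) xs.
    rewrite -sorted_pairwise; last by move=> y x z; apply: leq_trans.
    by apply: sort_sorted => x y; apply: leq_total.
  have : pairwise (fun x y => (pos x <= pos y) && (x != y)) xs.
    by rewrite pairwise_relI p1 -uniq_pairwise.
  have aX : all (mem X) xs by apply/allP => x; rewrite xsX.
  apply: sub_in_pairwise aX => x y xX yX /andP [le ne].
  rewrite /relpre /gapr /=; case: (gap _ _ xX yX ne) => //.
  by move: le l0; clear; lia.
have cov (ys : seq V) : uniq ys -> all (mem X) ys ->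
    [/\ uniq (cover (map f ys)), closedc (cover (map f ys)) &
      forall x, x \in X -> x \in cover (map f ys) -> x \in ys].
  elim/last_ind: ys => [|ys x IH] //; rewrite rcons_uniq all_rcons.
  move=> /andP [xys uys] /andP [xX' aX]; have xX : x \in X := xX'.
  have [un cl cX] := IH uys aX.
  rewrite map_rcons; have [||un' cl'] := cover_step (r := f x) cl un.
  - by apply/negP => /(cX _ xX); rewrite (negbTE xys).
  - by move=> side u /prel_facts [_]; rewrite xX.
  - split=> // y yX; rewrite cover_rcons mem_cat mem_rcons inE.
    move=> /orP [/(cX _ yX) ->|/blk_mem [->|[_]]]; rewrite ?eqxx ?orbT //.
    by rewrite yX.
have [|un cl _] := cov xs uxs; first by apply/allP => x; rewrite xsX.
case E: (map f xs) => [|r0 rs].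
  have /set0Pn [x] := X0; rewrite -xsX => xxs.
  by have := map_f f xxs; rewrite E.
rewrite E in so un cl.
have hr r : r \in r0 :: rs -> r.2 \notin U /\ t < r.1 <= p.
  rewrite -E => /mapP [x]; rewrite xsX => xX ->; split; [exact: XU|exact: tp].
have inr x : x \in X -> (pos x, x) \in r0 :: rs.
  by move=> xX; rewrite -E; apply: (map_f f); rewrite xsX.
have [|_ /andP [t0 _]] := hr r0; first exact: mem_head.
have [|rs' [h1 h2 h3 h4 h5]] := roots_complete so un cl _ t0 hr.
  move=> x /inr xr; apply/flattenP; exists (blk (pos x, x)); first exact: map_f.
  by rewrite blkE mem_cat inE eqxx orbT.
exists r0, rs'; split=> // x /inr; rewrite !inE => /orP [->//|/h4 ->].
by rewrite orbT.
Qed.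

End Blocks.

(** * Linking the blocks *)

Section Glue.
Variables (V : finType) (G : rel V) (adj : bool -> rel V) (X : {set V}) (lev : V -> nat).
Variables (t m b r ms wmax : nat) (sg : nat -> bool).
Local Notation L := (V * option (bool * bool))%type.
Local Notation U := (ground lev).
Local Notation N := (nbr G adj X lev).
Local Notation Ls := (labels lev).
Local Notation W := (want r).
Local Notation goodp := (good N W Ls ms).

Hypothesis symG : symmetric G.
Hypothesis adjC : forall s u v, adj (~~ s) u v = adj s v u.
Hypothesis lev_max : forall v, lev v <= t.+1.
Hypotheses (ms_gt0 : 0 < ms) (r4 : 4 <= r).
Hypotheses (mt : 0 < m <= r ^ t) (bt : 0 < b <= r ^ t).
Hypothesis J : forall A B : {set V}, [disjoint A & B] -> m <= #|A| -> b <= #|B| ->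
  exists x y, [/\ x \in A, y \in B & G x y].
Hypothesis room : forall par, #|dom par| <= wmax -> roomy N W Ls ms par.

Variables (par0 : V -> option L) (w0 : nat) (CL CR : nat * V -> seq V).
Hypothesis good0 : goodp par0.
Hypothesis un0 : forall v, unlab par0 v.
Hypothesis dom0 : #|dom par0| <= w0.
Hypothesis hC : forall r,
  is_chain adj lev par0 false (fun j => ~~ sg (r.1 - j.+1)) 0 r.2 (CL r) /\
  is_chain adj lev par0 true (fun j => sg (r.1 + j)) 0 r.2 (CR r).

Let con0 : consistent N par0.  Proof. by case: good0. Qed.

Local Notation Bk := (blk CL CR).
Local Notation Bh := (bhead CL).
Local Notation Bt := (btail CL CR).
Local Notation Cov := (cover CL CR).

Definition edge_at (k : nat) : rel V := fun u v => adj (sg k) u v || G u v.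

(** The invariant of the linking: [gl_dom] keeps links away from the path and from blocks still to
    come, and [gl_un] leaves the two ends and all vertices off the path without children, for the
    next link and for the final expansion. *)
Record glued k x p rest par : Prop := Glued {
  gl_seq : oseq edge_at k (x :: p);
  gl_uniq : uniq (x :: p ++ Cov rest);
  gl_good : goodp par;
  gl_dom : forall y, y \in U -> y \in x :: p ++ Cov rest -> par y;
  gl_head : x \in U;
  gl_last : last x p \in U;
  gl_neq : x != last x p;
  gl_un : forall v, [\/ v \notin x :: p, v = x | v = last x p] -> unlab par v;
  gl_size : #|dom par| <= w0 + (size p).+1 }.

Lemma blk_ends s : s.2 \notin U -> [/\ Bh s \in U, last (Bh s) (Bt s) \in U,
  Bh s != last (Bh s) (Bt s) & forall y, y \in U -> y \in Bk s -> par0 y].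
Proof.
move=> sU; have [[_ _ lL pL nL] [_ _ lR pR nR]] := hC s.
have lt : last (Bh s) (Bt s) = last s.2 (CR s).
  by rewrite -[last _ _]/(last (Bh s) (Bk s)) blkE last_cat.
rewrite lt; split=> //; last first.
  by move=> y yU /(blk_mem con0 hC) [e|[]] //; rewrite -e yU in sU.
have uB := blk_uniq con0 hC s.
move: uB; rewrite blkE cat_uniq => /and3P [_ /hasPn h _].
have hL : Bh s \in rev (CL s).
  rewrite mem_rev /bhead; move: (nL sU); case: (CL s) => // a c _ /=; exact: mem_last.
apply: contraTneq hL => ->; apply: h; rewrite inE; apply/orP; right.
by move: (nR sU); case: (CR s) => // a c _ /=; exact: mem_last.
Qed.

Lemma cover_cons s rest : Cov (s :: rest) = Bk s ++ Cov rest.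
Proof. by []. Qed.

Lemma glue_first s rest : s.2 \notin U -> t < s.1 -> uniq (Cov (s :: rest)) ->
  (forall s', s' \in rest -> s'.2 \notin U) ->
  glued (bstart CL s) (Bh s) (Bt s) rest par0.
Proof.
move=> sU ts un hr; have [h1 h2 h3 h4] := blk_ends sU.
split=> //.
- apply: oseq_sub (blk_oseq adjC lev_max hC ts) => j u v /=; rewrite /edge_at => -> //.
- move=> y yU; rewrite -cat_cons mem_cat => /orP [/(h4 _ yU) //|].
  move=> /flattenP [B /mapP [s' s'r ->]]; have [_ _ _] := blk_ends (hr _ s'r).
  exact.
- exact: leq_trans dom0 (leq_addr _ _).
Qed.

Lemma glue_step k x p i s rest par Lmax :
  glued k x p (s :: rest) par -> k + size p <= i + t.+1 -> i + (4 * t + 3) <= s.1 ->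
  t < s.1 <= Lmax -> s.2 \notin U ->
  (forall s', s' \in rest -> s'.2 \notin U) ->
  w0 + Lmax.+1 + m.*2 + b.*2 <= wmax ->
  exists c par', [/\ glued k x (p ++ c ++ Bk s) rest par',
    k + (size p).+1 + size c = bstart CL s & 
    k + size (p ++ c ++ Bk s) <= s.1 + t.+1].
Proof.
move=> [gs gu gg gd gh gl gn gun gz] kp is1 /andP [ts sL] sU hr wm.
have [bh bl bn bd] := blk_ends sU.
have [[szL _ _ _ _] [szR _ _ _ _]] := hC s.
have lL : size (CL s) <= t.+1 by apply: leq_trans szL (lev_max _).
have lR : size (CR s) <= t.+1 by apply: leq_trans szR (lev_max _).
pose g := bstart CL s - (k + size p).
have eg : k + size p + g = bstart CL s.
  by rewrite /g subnKC // /bstart; move: kp is1 lL; clear; lia.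
(* Of the [4 * t + 3] positions between the roots each descent takes at most [t.+1], which leaves
   the [2 t + 1] edges that [connect] needs. *)
have gt : t.*2.+1 <= g.
  move: eg; rewrite /bstart; move: kp is1 lL ts; clear; lia.
have gu' : uniq ((x :: p) ++ Bk s ++ Cov rest) by [].
have disj v : v \in Bk s -> v \notin x :: p.
  move=> vB; apply/negP => vp; move: gu'; rewrite catA uniq_catC cat_uniq cat_uniq.
  by case/and3P => _ _ /and3P [_ /hasPn /(_ v vB)]; rewrite [_ \in _]vp.
have hB : Bh s \in Bk s by rewrite mem_head.
have lp : last x p \in x :: p by apply: mem_last.
have par_in y : y \in U -> y \in (x :: p) ++ Bk s ++ Cov rest -> par y by apply: gd.
have NG v w : w \in N (v, None) -> G v w /\ w \in U by rewrite inE => /andP [].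
have dG (v : V) : W (v, None) = r by [].
have LsG v : v \in U -> (v, None) \in Ls by move=> vU; rewrite inE.
have pl : par (last x p) by apply: par_in => //; rewrite mem_cat lp.
have pb : par (Bh s) by apply: par_in => //; rewrite !mem_cat hB orbT.
have lb : last x p != Bh s by apply: contraTneq lp => ->; apply: disj.
have ul : unlab par (last x p) by apply: gun; apply: Or33.
have ub : unlab par (Bh s) by apply: gun; apply: Or31; apply: disj.
have ges : k + size p + g <= Lmax.
  by rewrite eg /bstart; apply: leq_trans (leq_subr _ _) sL.
have bud : #|dom par| + g + m.*2 + b.*2 <= wmax.
  by move: gz ges wm; clear; lia.
have [par' [c [sc pc [uc cU] g' [pe dm unl]]]] :=
  connect ms_gt0 NG dG LsG room symG r4 mt bt J gg gl bh pl pb lb ul ub gt bud.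
have cp v : v \in c -> v \notin x :: p ++ Cov (s :: rest).
  by move=> /cU [vU pv]; apply/negP => /(gd _ vU); rewrite pv.
have szc : k + (size p).+1 + size c = bstart CL s.
  by rewrite sc; move: eg gt; clear; lia.
have szl : size (CL s) <= s.1 by apply: leq_trans lL ts.
exists c, par'; split=> //; last first.
  have -> : size (p ++ c ++ Bk s) = size p + size c + (size (CL s) + (size (CR s)).+1).
    by rewrite !size_cat blkE size_cat size_rev /= addnA.
  by move: szc lR szl; rewrite /bstart; clear; lia.
have lastE : last x (p ++ c ++ Bk s) = last (Bh s) (Bt s) by rewrite catA last_cat.
have lB : last (Bh s) (Bt s) \in Bk s by rewrite /blk mem_last.
split=> //.
- have -> : x :: p ++ c ++ Bk s = belast x p ++ (last x p) :: c ++ Bk s.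
    by rewrite -cat_cons lastI cat_rcons.
  rewrite oseq_cat -lastI gs andTb size_belast -cat_cons oseq_cat.
  apply/andP; split.
    by rewrite rcons_cons; apply: oseq_path pc => j u v h; rewrite /edge_at h orbT.
  have -> : k + size p + size (last x p :: c) = bstart CL s.
    by move: szc => /=; clear; lia.
  apply: oseq_sub (blk_oseq adjC lev_max hC ts) => j u v /=; by rewrite /edge_at => ->.
- have pe1 : perm_eq (x :: (p ++ c ++ Bk s) ++ Cov rest) (c ++ x :: p ++ Cov (s :: rest)).
    apply/permP => h; rewrite cover_cons -cat_cons !count_cat /= !count_cat /=.
    by rewrite !count_cat /=; clear; lia.
  rewrite (perm_uniq pe1) cat_uniq uc gu andbT; apply/hasPn => v vp.
  by apply: contraL vp; apply: cp.
- move=> y yU; rewrite -cat1s !mem_cat -!orbA => h.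
  have : (y \in dom par) || (y \in c).
    move: h; have [yc|yc h] := boolP (y \in c); first by rewrite orbT.
    rewrite orbF inE; apply: gd => //; rewrite cover_cons -cat1s !mem_cat -!orbA.
    exact: h.
  move=> h'; suff : y \in dom par' by rewrite inE.
  by rewrite dm in_setU [X in _ || X]in_set.
- by rewrite lastE.
- by rewrite lastE; apply: contraTneq lB => <-; apply/negP => /disj; rewrite mem_head.
- move=> v; rewrite lastE => hv.
  have xc : x \notin c by apply/negP => /cp; rewrite mem_head.
  suff [h1 h2] : unlab par v /\ v \notin [:: last x p, Bh s & c] by apply: unl.
  case: hv => [|->|->].
  + rewrite -cat_cons => hv.
    have vp : v \notin x :: p by apply: contra hv => h; rewrite mem_cat h.
    have vc : v \notin c by apply: contra hv => h; rewrite !mem_cat h orbT.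
    have vB : v \notin Bk s by apply: contra hv => h; rewrite !mem_cat h !orbT.
    split; first by apply: gun; apply: Or31.
    rewrite !inE !negb_or vc andbT; apply/andP; split.
      by apply: contraNneq vp => ->.
    by apply: contraNneq vB => ->.
  + split; first by apply: gun; apply: Or32.
    rewrite !inE !negb_or gn xc andbT /=.
    by apply: contraTneq hB => <-; apply/negP => /disj; rewrite mem_head.
  + split; first by apply: gun; apply: Or31; apply: disj.
    rewrite !inE !negb_or eq_sym; apply/and3P; split.
    * by apply: contraTneq lp => ->; apply: disj.
    * by rewrite eq_sym.
    * apply/negP => /cp; rewrite cover_cons -cat_cons !mem_cat lB /= orbT.
      by [].
- rewrite dm; apply: leq_trans (leq_card_setU _ _) _.
  have szs : #|[set y in c]| <= size c by rewrite cardsE; apply: card_size.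
  apply: leq_trans (leq_add gz szs) _.
  by rewrite !size_cat -addnA leq_add2l addSn ltnS leq_add2l leq_addr.
Qed.

Lemma glue_all Lmax rest : forall k x p i z par,
  glued k x p rest par -> k + size p <= i + t.+1 -> i <= Lmax ->
  path (gapr (4 * t + 3)) (i, z) rest ->
  (forall s, s \in rest -> s.2 \notin U /\ t < s.1 <= Lmax) ->
  w0 + Lmax.+1 + m.*2 + b.*2 <= wmax ->
  exists p' par', [/\ glued k x (p ++ p') [::] par',
    forall s, s \in rest -> exists q1 q2,
      x :: p ++ p' = q1 ++ s.2 :: q2 /\ k + size q1 = s.1,
    {subset Cov rest <= x :: p ++ p'} &
    k + size (p ++ p') <= Lmax + t.+1].
Proof.
elim: rest => [|s rest IH] k x p i z par gl kp iL /=.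
  move=> _ _ _; exists [::], par; rewrite cats0; split=> //.
  by apply: leq_trans kp _; rewrite leq_add2r.
move=> /andP [gp pa] hr wm; have [sU tL] := hr _ (mem_head s rest).
have hr' s' : s' \in rest -> s'.2 \notin U /\ t < s'.1 <= Lmax.
  by move=> h; apply: hr; rewrite inE h orbT.
have [|c [par1 [gl1 sz1 e1]]] := glue_step gl kp gp tL sU _ wm; first by move=> s' /hr' [].
have sL : s.1 <= Lmax by case/andP: tL.
have [|p' [par' [g' pos' cov' e']]] := IH k x _ s.1 s.2 par1 gl1 e1 sL _ hr' wm.
  by case: (s) pa.
exists ((c ++ Bk s) ++ p'), par'; rewrite !catA in g' pos' cov' e' *; split=> //.
- move=> s'; rewrite inE => /orP [/eqP ->|/pos' //].
  exists (x :: p ++ c ++ rev (CL s)), (CR s ++ p'); split.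
    by rewrite blkE cat_cons -!catA.
  have [[szL _ _ _ _] _] := hC s.
  have szl : size (CL s) <= s.1.
    by apply: leq_trans szL (leq_trans (lev_max _) _); case/andP: tL.
  by rewrite /= !size_cat size_rev -addSn !addnA sz1 /bstart subnK.
- move=> v; rewrite cover_cons mem_cat => /orP [vB|/cov' //].
  by rewrite -!catA -cat_cons !mem_cat vB !orbT.
Qed.

End Glue.

(** * The skeleton path *)

Section Skeleton.
Variables (V : finType) (G : rel V) (adj : bool -> rel V) (X : {set V}).
Variables (m b r q rho mD t wmax p0 : nat) (sg : nat -> bool) (pos : V -> nat).
Let z := #|X| + m.
Let K := (4 * z + m).*2.
(** Bounds the position of the last root: [p0] for the roots in [X], and one gap for each further
    root, of which there are at most [z]. *)
Let Lmax := p0 + (4 * t + 3) * z.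

Definition rest_set (x : V) (p : seq V) : {set V} :=
  [set v | [|| v \notin x :: p, v == x | v == last x p]].

Lemma skeleton : symmetric G ->
  (forall s u v, adj (~~ s) u v = adj s v u) ->
  (forall s v, q.*2 <= #|[set w | adj s v w & w \notin X]|) ->
  (forall (A B : {set V}) s, #|A| <= mD ->
    (forall v, v \in A -> q <= #|[set w in B | adj s v w]|) -> rho * #|A| <= #|B|) ->
  (forall A B : {set V}, [disjoint A & B] -> m <= #|A| -> b <= #|B| ->
    exists x y, [/\ x \in A, y \in B & G x y]) ->
  X != set0 -> (forall x, x \in X -> t < pos x <= p0) ->
  (forall x y, x \in X -> y \in X -> x != y ->
    pos x + (4 * t + 3) <= pos y \/ pos y + (4 * t + 3) <= pos x) ->
  8 <= rho -> r.*2 <= rho -> 7 <= r -> z <= mD ->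
  0 < m <= r ^ t -> 0 < b <= r ^ t ->
  #|X| + b + r.*2.+1 * (K + m) < #|V| ->
  z + K + b + wmax + K * r < #|V| ->
  4 * z + Lmax.+1 + m.*2 + b.*2 <= wmax ->
  exists k x p, [/\ oseq (edge_at G adj sg) k (x :: p), uniq (x :: p),
    x != last x p /\ k + size p <= Lmax + t.+1,
    forall y, y \in X -> exists q1 q2, x :: p = q1 ++ y :: q2 /\ k + size q1 = pos y &
    (forall A : {set V}, A \subset rest_set x p -> 0 < #|A| <= m ->
      #|A|.*2 + 3 < #|extnbr (rest_set x p) G A|)].
Proof.
move=> symG adjC mind exp J X0 tp gap rho8 rrho r7 zD mt bt num1 num2 num3.
have /andP [m0 mrt] := mt; have /andP [b0 brt] := bt.
have spr : spreads G m b.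
  move=> A mA; rewrite ltnNge; apply/negP => bB.
  have [|x [y [xA]]] := J A _ _ mA bB.
    by rewrite -setI_eq0; apply/eqP/setP => w; rewrite !inE andbA andbN.
  rewrite inE => /andP [_ /forall_inP h] Gxy.
  by have := h x xA; rewrite Gxy.
have [Bad [dBX Bm expU0]] := bad_set spr num1.
pose lev := level adj X Bad q t.
have BadD : #|Bad| <= mD by apply: leq_trans (ltnW Bm) (leq_trans (leq_addl _ _) zD).
have Badt : #|Bad| < r ^ t by apply: leq_trans Bm mrt.
have groundE : ground lev = ~: (X :|: Bad).
  by apply/setP => v; rewrite in_setC inE (level0 X exp rrho BadD Badt).
have nZE : #|~: ground lev| <= z.
  rewrite groundE setCK; apply: leq_trans (leq_card_setU _ _) _.
  by rewrite leq_add2l ltnW.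
pose nZ := #|~: ground lev|.
have levd s v : v \notin ground lev ->
    q <= #|[set w | [&& adj s v w, w \notin X & lev w < lev v]]|.
  rewrite groundE in_setC negbK => vZ.
  exact: (level_deg mind exp rrho BadD Badt).
have exp8 (A B : {set V}) s : #|A| <= mD ->
    (forall v, v \in A -> q <= #|[set w in B | adj s v w]|) -> 8 * #|A| <= #|B|.
  by move=> h1 h2; apply: leq_trans (exp A B s h1 h2); rewrite leq_mul2r rho8 orbT.
have expU (A : {set V}) : A \subset ground lev -> 0 < #|A| <= K ->
    r.*2 * #|A| <= #|extnbr (ground lev) G A|.
  by rewrite groundE; apply: expU0.
have r0 : 0 < r by apply: leq_trans r7.
pose ms := 4 * nZ + m.
have msK : ms.*2 <= K by rewrite /K leq_double leq_add2r leq_mul2l nZE orbT.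
have ms0 : 0 < ms by rewrite addn_gt0 m0 orbT.
have num : nZ + ms.*2 + b + wmax + ms.*2 * r < #|V|.
  apply: leq_ltn_trans num2; apply: leq_add; last by rewrite leq_mul2r msK orbT.
  by rewrite !leq_add2r leq_add.
have w4 : 4 * nZ <= wmax.
  apply: leq_trans num3; apply: (@leq_trans (4 * z)); first by rewrite leq_mul2l nZE orbT.
  by move: (4 * z) Lmax => u w; clear; lia.
have ZD : nZ <= mD by apply: leq_trans nZE zD.
have [par0 [good0 dom0 un0 own0]] := reserve levd exp8 expU spr m0 r0 msK ZD num w4.
have room par : #|dom par| <= wmax -> roomy (nbr G adj X lev) (want r) (labels lev) ms par.
  by move=> h; exact: (roomy_dom adj X spr r0 num).
have con0 : consistent (nbr G adj X lev) par0 by case: good0.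
have levm v : lev v <= t.+1 by apply: level_max.
have XU x : x \in X -> x \notin ground lev by rewrite groundE in_setC negbK inE => ->.
have [CL [CR hC]] := chains sg con0 own0.
have l0 : 0 < 4 * t + 3 by rewrite addn_gt0 orbT.
have [r1 [rs [pa un cv inr hr]]] := roots_exist con0 hC l0 X0 XU tp gap.
have [r1U /andP [tr1 r1L]] := hr _ (mem_head r1 rs).
have hrL s : s \in r1 :: rs -> s.2 \notin ground lev /\ t < s.1 <= Lmax.
  move=> /hr [-> /andP [-> h]]; split=> //=; apply: leq_trans h _.
  by rewrite leq_add2l leq_mul2l nZE orbT.
have r4 : 4 <= r by apply: leq_trans r7.
have dom1 : #|dom par0| <= 4 * z.
  by apply: leq_trans dom0 _; rewrite leq_mul2l nZE orbT.
have g1 := @glue_first _ G adj X lev t r ms sg adjC levm par0 (4 * z) CL CR good0 un0 dom1 hC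
  r1 rs r1U tr1 un _.
have {}g1 := g1 (fun s' h => (hr s' (mem_behead (s := r1 :: rs) h)).1).
have [[szL _ _ _ _] [szR _ _ _ _]] := hC r1.
have e1 : bstart CL r1 + size (btail CL CR r1) <= r1.1 + t.+1.
  have szl : size (CL r1) <= r1.1 by apply: leq_trans szL (leq_trans (levm _) tr1).
  have szr : size (CR r1) <= t.+1 by apply: leq_trans szR (levm _).
  by rewrite /btail size_cat size_rev size_belast addnA /bstart subnK // leq_add2l.
have [_ /andP [_ r1Lm]] := hrL _ (mem_head r1 rs).
have [||p' [par [g2 posr cov e2]]] := glue_all symG adjC levm ms0 r4 mt bt J room good0 hC
    (Lmax := Lmax) (z := r1.2) g1 e1 r1Lm _ _ num3.
- by case: (r1) pa.
- by move=> s h; apply: hrL; rewrite inE h orbT.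
set x := bhead CL r1 in g1 g2 posr cov e2 *; set p := btail CL CR r1 ++ p' in g2 posr cov e2 *.
have {}cov y : y \notin ground lev -> y \in x :: p.
  move=> /cv; rewrite cover_cons mem_cat => /orP [h|/cov //].
  by rewrite /p -cat_cons mem_cat h.
exists (bstart CL r1), x, p; split=> //.
- exact: gl_seq g2.
- by have := gl_uniq g2; rewrite cats0.
- by split=> //; exact: gl_neq g2.
- move=> y yX; have := inr y yX; rewrite inE => /orP [/eqP e|/posr //].
  exists (rev (CL r1)), (CR r1 ++ p'); split.
    have -> : y = r1.2 by rewrite -e.
    have -> : x :: p = blk CL CR r1 ++ p' by [].
    by rewrite blkE -catA.
  have szl : size (CL r1) <= r1.1 by apply: leq_trans szL (leq_trans (levm _) tr1).
  by rewrite size_rev /bstart subnK // -e.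
move=> A AS /andP [A0 Am].
have AU : A \subset ground lev.
  apply/subsetP => v /(subsetP AS); rewrite inE => /or3P [vp|/eqP ->|/eqP ->].
  - by apply: contraR vp => /cov.
  - exact: gl_head g2.
  - exact: gl_last g2.
(* The labels of [A] have no children, so their supply in the final reservation is free and hence
   off the path. It has at least [r * #|A|] elements, at most [#|A|] of them in [A]; for a single
   vertex the claim is [2 + 3 < r - 1], which is [7 <= r]. *)
pose A' : {set V * option (bool * bool)} := [set (v, None) | v in A].
have cA' : #|A'| = #|A| by apply: card_imset => u v [].
have A'L : A' \subset labels lev.
  by apply/subsetP => l /imsetP [v vA ->]; rewrite inE (subsetP AU).
have [ext _ _] := gl_good g2.
have dA' : dem (want r) A' = r * #|A|.
  rewrite /dem (eq_bigr (fun=> r)) ?sum_nat_const ?cA' 1?mulnC //.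
  by move=> l /imsetP [v _ ->].
have : r * #|A| <= #|effs (nbr G adj X lev) par A'|.
  rewrite -dA'; apply: ext => //; rewrite cA'.
  by apply: leq_trans Am _; rewrite -addnn /ms -addnA addnCA leq_addr.
have sub : effs (nbr G adj X lev) par A' \subset A :|: extnbr (rest_set x p) G A.
  apply/subsetP => w /bigcupP [l /imsetP [v vA ->]].
  rewrite inE => /andP []; rewrite inE /= => /andP [wU Gvw] pw.
  have {pw} pw : par w = None.
    case/orP: pw => [/eqP //|/eqP pw].
    suff un' : unlab par v by case: (un' w pw).
    apply: (gl_un g2); have := subsetP AS v vA; rewrite in_set.
    move=> /or3P [h|/eqP h|/eqP h].
    - exact: Or31.
    - exact: Or32.
    - exact: Or33.
  have wp : w \notin x :: p.
    by apply/negP => h; have := gl_dom g2 wU; rewrite cats0 pw => /(_ h).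
  rewrite in_setU; have [//|wA] := boolP (w \in A).
  rewrite inE wA [w \in rest_set _ _]inE wp /=.
  by apply/existsP; exists v; rewrite vA.
have := subset_leq_card sub; have := (leq_card_setU A (extnbr (rest_set x p) G A)).1.
move=> h1 h2 h3; have := leq_trans h3 (leq_trans h2 h1); move: A0 r7; clear.
by move: (#|A|) (#|extnbr _ _ _|) => *; nia.
Qed.

Lemma card_rest_set x p : #|V| <= #|rest_set x p| + size p.
Proof.
have sub : ~: rest_set x p \subset [set v in p].
  apply/subsetP => v; rewrite /rest_set in_setC in_set => /norP [vp /norP [vx _]].
  by rewrite negbK in_cons (negbTE vx) in vp; rewrite inE.
have := subset_leq_card sub; have := cardsC (rest_set x p).
have : #|[set v in p]| <= size p by rewrite cardsE; apply: card_size.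
clear; lia.
Qed.

End Skeleton.

(** * Copies of an oriented cycle *)

Section CycleSequences.
Variable W : finType.
Implicit Types (e : rel W) (s : seq W).

Definition cyclic_order e s : Prop :=
  [/\ uniq s, 2 < size s, forall v, v \in s &
      forall u v, e u v = (v == next s u) || (u == next s v)].

Lemma cyclic_order_rot e s i : cyclic_order e s -> cyclic_order e (rot i s).
Proof.
move=> [us ss fs es]; split; rewrite ?rot_uniq ?size_rot //.
  by move=> v; rewrite mem_rot.
by move=> u v; rewrite !next_rot.
Qed.

Lemma cyclic_order_rev e s : cyclic_order e s -> cyclic_order e (rev s).
Proof.
move=> [us ss fs es]; split; rewrite ?rev_uniq ?size_rev //.
  by move=> v; rewrite mem_rev.
move=> u v; rewrite !next_rev // es orbC; congr (_ || _).
  by apply/eqP/eqP => ->; rewrite ?prev_next ?next_prev.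
by apply/eqP/eqP => ->; rewrite ?prev_next ?next_prev.
Qed.

Lemma next_mid (T : eqType) (s1 s2 : seq T) (u v : T) :
  uniq (s1 ++ u :: v :: s2) -> next (s1 ++ u :: v :: s2) u = v.
Proof.
move=> us; rewrite -(next_rot (size s1)) // rot_size_cat /=.
by rewrite eqxx.
Qed.

Lemma next_last (T : eqType) (x : T) (s : seq T) : uniq (x :: s) -> next (x :: s) (last x s) = x.
Proof.
move=> us; case/lastP: s us => [|s y] us; first by rewrite /= eqxx.
have ex : x :: rcons s y = (x :: s) ++ [:: y] by rewrite cats1.
have us' : uniq ((x :: s) ++ [:: y]) by rewrite -ex.
rewrite last_rcons ex.
by rewrite -(next_rot (size (x :: s)) us') rot_size_cat /= eqxx.
Qed.

(** Induction along [P]: the new vertex follows or precedes the last one in the cyclic order. It can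
    precede only if [P] was a single vertex, and then the order is reversed. *)
Lemma path_prefix e s P : cyclic_order e s -> uniq P -> sorted e P ->
  exists s', cyclic_order e s' /\ exists s2, s' = P ++ s2.
Proof.
move=> cs; elim/last_ind: P => [|P b IH]; first by exists s; split=> //; exists s.
rewrite rcons_uniq => /andP [bP uP] so.
case/lastP: P IH bP uP so => [|P a] IH bP uP so.
  have [_ _ fs _] := cs.
  have [i s2 es] := rot_to (fs b).
  exists (rot i s); split; first exact: cyclic_order_rot.
  by exists s2; rewrite es.
have eab : e a b.
  by move: so; rewrite -!cats1 -catA; case: (P) => [|c P'] /=; rewrite ?cat_path /=; case/andP => // _ /and3P [].
have so' : sorted e (rcons P a) by move: so; rewrite -[rcons _ b]cats1 => /cat_sorted2 [].
have [s' [cs' [s2 es']]] := IH uP so'.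
have [us' ss' fs' ees] := cs'.
have := eab; rewrite ees => /orP [/eqP nb|/eqP na].
  case: s2 es' => [|c s2] es'.
    have : b \in s' by apply: fs'.
    by rewrite es' cats0 (negbTE bP).
  exists s'; split=> //; exists s2.
  have : next s' a = c by rewrite es' cat_rcons next_mid // -cat_rcons -es'.
  by rewrite -nb es' => ->; rewrite !cat_rcons.
have bpa : b = prev s' a by rewrite na prev_next.
case/lastP: P IH bP uP so so' es' => [|P c] IH bP uP so so' es'.
  exists (rot (size s2) (rev s')); split.
    by apply: cyclic_order_rot; apply: cyclic_order_rev.
  rewrite es' /= rev_cons -cats1 -(size_rev s2) rot_size_cat /=.
  move: es'; case/lastP: s2 => [|s2 d] es'.
    by move: ss'; rewrite es'.
  have -> : b = d.
    rewrite bpa; apply: (can_inj (prev_next us')); rewrite next_prev // es'.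
    have us2 : uniq (a :: rcons s2 d) by rewrite es' in us'.
    by have := next_last us2; rewrite last_rcons => /esym.
  by exists (rev s2); rewrite rev_rcons.
have : b = c.
  rewrite bpa -[RHS](prev_next us'); congr (prev _ _); rewrite es' !cat_rcons.
  by rewrite next_mid // -!cat_rcons -es'.
by move=> bc; rewrite bc mem_rcons in_cons mem_rcons mem_head orbT in bP.
Qed.

(** The offset [o] leaves room before [P] for the left descent of the first root. *)
Lemma cyclic_order_shift e s P o : cyclic_order e s -> uniq P -> sorted e P ->
  o + size P <= size s ->
  exists2 s', cyclic_order e s' & forall w, w \in P -> index w s' = o + index w P.
Proof.
move=> cs uP so oP; have [s' [cs' [s2 es']]] := path_prefix cs uP so.
have [us _ fs _] := cs; have [us' _ fs' _] := cs'.
have sz : size s' = size s.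
  have /card_uniqP <- := us; have /card_uniqP <- := us'.
  by apply: eq_card => w; rewrite fs fs'.
exists (rotr o s'); first exact: cyclic_order_rot.
move=> w wP; rewrite /rotr /rot index_cat.
have szP : size P <= size s' - o by rewrite sz; move: oP; clear; lia.
have wt : index w (take (size s' - o) s') = index w P.
  by rewrite es' in szP *; rewrite take_cat ltnNge szP /= index_cat wP.
have wtin : w \in take (size s' - o) s'.
  by rewrite es' in szP *; rewrite take_cat ltnNge szP /= mem_cat wP.
have -> : (w \in drop (size s' - o) s') = false.
  apply/negbTE; move: us'; rewrite -{1}(cat_take_drop (size s' - o) s') cat_uniq.
  by move=> /and3P [_ /hasPn h _]; apply/negP => /h /=; rewrite wtin.
by rewrite wt size_drop subKn // sz; apply: leq_trans (leq_addr _ _) oP.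
Qed.

Lemma index_next s u : uniq s -> u \in s ->
  index (next s u) s = (index u s).+1 %% size s.
Proof.
move=> us uin; rewrite next_nth uin.
case: s us uin => // y s us uin; set i := index u (y :: s).
have il : i < (size s).+1 by rewrite -[(size s).+1]/(size (y :: s)) index_mem.
have [lt|ge] := ltnP i (size s).
  rewrite modn_small //= -[nth y s i]/(nth y (y :: s) i.+1).
  by rewrite -[RHS](@index_uniq _ y i.+1 (y :: s)).
have -> : i = size s by apply/eqP; rewrite eqn_leq ge -ltnS il.
by rewrite nth_default // modnn /= eqxx.
Qed.

End CycleSequences.

(** * From a cyclic sequence to a copy *)

Section Copy.
Variables (V W : finType) (D0 : digraph V) (C : digraph W) (X : {set V}) (f : V -> W).

Definition copy_in (B : {set V * V}) : bool :=
  [exists phi : {ffun W -> V},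
    [&& injectiveb phi,
        [forall u, forall v, edge C u v ==> ((phi u, phi v) \in edges D0 :|: B)]
      & [forall x in X, phi (f x) == x]]].

Lemma copy_in_mono (B B' : {set V * V}) : B \subset B' -> copy_in B -> copy_in B'.
Proof.
move=> BB' /existsP [phi /and3P [h1 /forallP h2 h3]]; apply/existsP; exists phi.
rewrite h1 h3 andbT /=; apply/forallP => u; apply/forallP => v; apply/implyP => uv.
have := h2 u => /forallP /(_ v); rewrite uv /=.
by apply/subsetP; apply: setUS.
Qed.

Hypothesis asym : forall u v, ~~ (edge C u v && edge C v u).

(** [C] has no two opposite edges and [phi] is injective, so a copy that uses [e] does not use its
    reverse. *)
Lemma copy_in_pair (B : {set V * V}) (e : V * V) :
  copy_in (e |: ((e.2, e.1) |: B)) -> copy_in (e |: B) || copy_in ((e.2, e.1) |: B).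
Proof.
move=> /existsP [phi /and3P [h1 /forallP h2 h3]].
have inj := injectiveP _ h1.
have h2' u v : edge C u v -> (phi u, phi v) \in edges D0 :|: (e |: ((e.2, e.1) |: B)).
  by move=> uv; have := h2 u => /forallP /(_ v); rewrite uv.
have [u0 /existsP [v0 /andP [uv0 /eqP e0]]|no] :=
    pickP (fun u => [exists v, edge C u v && ((phi u, phi v) == e)]).
- apply/orP; left; apply/existsP; exists phi; rewrite h1 h3 andbT /=.
  apply/forallP => u; apply/forallP => v; apply/implyP => uv.
  move: (h2' _ _ uv); rewrite !in_setU !in_set1.
  case/or4P => [->|->|/eqP e1|->]; rewrite ?orbT //.
  case: e1; rewrite -e0 => /= /inj ? /inj ?; subst u v.
  by have := asym u0 v0; rewrite uv0 uv.
apply/orP; right; apply/existsP; exists phi; rewrite h1 h3 andbT /=.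
apply/forallP => u; apply/forallP => v; apply/implyP => uv.
move: (h2' _ _ uv); rewrite !in_setU !in_set1.
case/or4P => [->|e1|->|->]; rewrite ?orbT //.
have := no u; rewrite /= => /existsP []; exists v; by rewrite uv.
Qed.

Variable sW : seq W.
Hypothesis cW : cyclic_order (uedge C) sW.
Variable w0 : W.
Let n := size sW.

Definition orient (i : nat) : bool :=
  edge C (nth w0 sW (i %% n)) (nth w0 sW (i.+1 %% n)).

Definition sadj (s : bool) : rel V :=
  fun u v => if s then edge D0 u v else edge D0 v u.

Lemma copy_from_cycle (B : {set V * V}) (H : rel V) (c0 : seq V) (x0 : V) k :
  (forall u v, H u v -> (u, v) \in B /\ (v, u) \in B) ->
  uniq c0 -> size c0 = n -> k <= n ->
  oseq (fun j u v => sadj (orient j) u v || H u v) k c0 ->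
  H (last x0 c0) (head x0 c0) ->
  (forall x, x \in X -> exists q1 q2, c0 = q1 ++ x :: q2 /\ k + size q1 = index (f x) sW) ->
  copy_in B.
Proof.
move=> HB uc sc kn sq Hl Xp; have [us ss fs es] := cW.
have n0 : 0 < n by apply: leq_trans ss.
(* Position [i] of the cycle is entry [i - k] modulo [n] of [c0]. *)
pose sh i := (i + (n - k)) %% n.
pose phi := [ffun w => nth x0 c0 (sh (index w sW))].
have shn i : sh i < n by rewrite ltn_mod.
have shS i : sh (i.+1 %% n) = (sh i).+1 %% n.
  by rewrite /sh modnDml -[((i + _) %% n).+1]addn1 modnDml addn1 addSn.
have iw w : index w sW < n by rewrite index_mem.
have shk i : i < n -> (k + sh i) %% n = i.
  move=> ilt; rewrite /sh modnDmr addnCA subnKC //.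
  by rewrite modnDr modn_small.
have key u : let v := next sW u in
    if orient (index u sW) then (phi u, phi v) \in edges D0 :|: B
    else (phi v, phi u) \in edges D0 :|: B.
  move=> v; have iv : index v sW = (index u sW).+1 %% n by apply: index_next.
  rewrite !ffunE iv shS; set a := sh (index u sW).
  have an : a < n by apply: shn.
  have or : orient (k + a) = orient (index u sW).
    rewrite /orient -[(k + a).+1]addn1 -[(index u sW).+1]addn1.
    by rewrite -(modnDml (k + a)) shk // (modn_small (iw u)).
  rewrite -or; have [lt|ge] := ltnP a.+1 n.
    rewrite (modn_small lt); have := oseq_nth x0 sq (j := a); rewrite sc => /(_ lt).
    case: (orient _) => /= /orP [h|/HB [h1 h2]]; rewrite in_setU ?h1 ?h2 ?orbT //.
      by rewrite [_ \in edges D0]h.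
    by rewrite [_ \in edges D0]h.
  (* The closing step belongs to [H] and is thus available in both directions. *)
  have ea : a.+1 = n by apply/eqP; rewrite eqn_leq ge an.
  have ha : nth x0 c0 a = last x0 c0 by rewrite -nth_last sc -ea.
  rewrite ea modnn ha nth0.
  have [h1 h2] := HB _ _ Hl.
  by case: (orient _); rewrite in_setU; apply/orP; right.
apply/existsP; exists phi; apply/and3P; split.
- apply/injectiveP => u v; rewrite !ffunE => /eqP.
  rewrite nth_uniq ?sc ?shn // => /eqP e.
  have := shk _ (iw u); rewrite e shk // => e'.
  by rewrite -(nth_index w0 (fs u)) -e' nth_index.
- apply/forallP => u; apply/forallP => v; apply/implyP => uv.
  have : uedge C u v by rewrite /uedge uv.
  rewrite es => /orP [/eqP ev|/eqP eu].
    have := key u; rewrite -ev /= /orient (modn_small (iw u)).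
    have <- : index v sW = (index u sW).+1 %% n by rewrite ev; apply: index_next.
    by rewrite !nth_index // uv.
  have := key v; rewrite -eu /= /orient (modn_small (iw v)).
  have <- : index u sW = (index v sW).+1 %% n by rewrite eu; apply: index_next.
  rewrite !nth_index //; have := asym u v; rewrite uv /= => /negbTE ->.
  by [].
- apply/forall_inP => x xX; have [q1 [q2 [ec ek]]] := Xp x xX.
  rewrite ffunE -ek /sh addnAC subnKC // modnDl modn_small.
    by rewrite ec nth_cat ltnn subnn.
  by rewrite -sc ec size_cat /= -addSnnS leq_addr.
Qed.

End Copy.

Import Order.TTheory GRing.Theory Num.Theory.

Local Open Scope ring_scope.

(** * Product measures and symmetrization *)

Section ProductMeasure.
Variables (R : realFieldType) (I : finType).
Implicit Types (q : I -> R) (S T K : {set I}).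

Definition wt q S : R := \prod_i (if i \in S then q i else 1 - q i).

Lemma sum_cylinder q T K : [disjoint T & K] ->
  \sum_(S : {set I} | (T \subset S) && [disjoint K & S]) wt q S =
  (\prod_(i in T) q i) * \prod_(i in K) (1 - q i).
Proof.
move=> TK.
(* Setting the forbidden factors to 0 extends the sum to all sets, where it factorizes. *)
pose a i := if i \in K then 0 else q i.
pose b i := if i \in T then 0 else 1 - q i.
have -> : \sum_(S : {set I} | (T \subset S) && [disjoint K & S]) wt q S =
    \sum_(S : {set I}) \prod_i (if i \in S then a i else b i).
  rewrite [RHS](bigID (fun S : {set I} => (T \subset S) && [disjoint K & S])) /=.
  rewrite [X in _ = _ + X]big1 ?addr0.
    apply: eq_bigr => S /andP [TS KS]; apply: eq_bigr => i _; rewrite /a /b.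
    case: ifP => iS; first by rewrite (disjointFl KS iS).
    by case: ifP => // iT; rewrite (subsetP TS i iT) in iS.
  move=> S; rewrite negb_and => /orP [/subsetPn [i iT iS]|].
    by rewrite (bigD1 i) //= (negbTE iS) /b iT mul0r.
  rewrite -setI_eq0 => /set0Pn [i /setIP [iK iS]].
  by rewrite (bigD1 i) //= iS /a iK mul0r.
rewrite -bigA_distr [LHS](bigID (mem T)) /=; congr (_ * _).
  apply: eq_bigr => i iT; rewrite /a /b iT addr0.
  by rewrite (disjointFr TK iT).
rewrite (bigID (mem K)) /= [X in _ * X]big1 ?mulr1.
  apply: eq_big => [i|i /andP [iT iK]]; last by rewrite /a /b iK (negbTE iT) add0r.
  by case iT: (i \in T) => //=; rewrite (disjointFr TK iT).
by move=> i /andP [iT iK]; rewrite /a /b (negbTE iT) (negbTE iK) addrC subrK.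
Qed.

Lemma sum_wt q : \sum_(S : {set I}) wt q S = 1.
Proof.
have := @sum_cylinder q set0 set0; rewrite -setI_eq0 set0I eqxx => /(_ isT).
rewrite !big_set0 mulr1 => <-; apply: eq_bigl => S.
by rewrite sub0set -setI_eq0 set0I eqxx.
Qed.

Lemma sum_split (P : pred {set I}) (g : {set I} -> R) i :
  (forall S, i \notin S -> P (i |: S) = P S) ->
  \sum_(S | P S) g S = \sum_(S | P S && (i \notin S)) (g S + g (i |: S)).
Proof.
move=> Pi; rewrite big_split /= (bigID (fun S => i \notin S)) /=; congr (_ + _).
rewrite (reindex_onto (fun S => i |: S) (fun S => S :\ i)) /=; last first.
  by move=> S /andP [_]; rewrite negbK => /setD1K.
apply: eq_bigl => S; rewrite negbK setU11 andbT.
have [iS|iS] := boolP (i \in S).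
  rewrite andbF; apply/negbTE/negP => /andP [_ /eqP e].
  by move: iS; rewrite -e !inE eqxx.
by rewrite Pi // setU1K // eqxx.
Qed.

(** Rankin's trick: if [#|F| <= k], then [z ^+ #|F| / z ^+ k] is at least 1; without the restriction
    on [#|F|] the weighted sum is a product over [I]. *)
Lemma sum_few_subsets (w z : R) k : 0 <= w -> 0 < z <= 1 ->
  \sum_(F : {set I} | (#|F| <= k)%N) w ^+ #|F| <= z ^- k * (1 + w * z) ^+ #|I|.
Proof.
move=> w0 /andP [z0 z1].
have -> : (1 + w * z) ^+ #|I| = \sum_(F : {set I}) (w * z) ^+ #|F|.
  rewrite -prodr_const addrC bigA_distr; apply: eq_bigr => F _.
  by rewrite -big_mkcond /= prodr_const.
rewrite mulr_sumr [leRHS](bigID (fun F : {set I} => (#|F| <= k)%N)) /=.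
rewrite -[leLHS]addr0; apply: lerD; last first.
  apply: sumr_ge0 => F _; apply: mulr_ge0; first by rewrite invr_ge0 exprn_ge0 // ltW.
  by rewrite exprn_ge0 // mulr_ge0 // ltW.
apply: ler_sum => F Fk; rewrite exprMn mulrCA -[leLHS]mulr1.
apply: ler_wpM2l; first exact: exprn_ge0.
rewrite ler_pdivlMl ?exprn_gt0 // mulr1.
by apply: ler_wiXn2l => //; apply: ltW.
Qed.

End ProductMeasure.

(** * Symmetrization pair by pair *)

Section Coupling.
Variables (R : realFieldType) (n : nat).
Local Notation V := 'I_n.
Local Notation I := (V * V)%type.
Implicit Types (S A B : {set I}) (e : I).

Definition rev_pair e : I := (e.2, e.1).
Definition key e : I := if (e.1 < e.2)%N then e else rev_pair e.

Lemma rev_pairK : involutive rev_pair.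
Proof. by case. Qed.

Lemma key_rev e : key (rev_pair e) = key e.
Proof.
rewrite /key /rev_pair /=; case: e => u v /=.
by have [//|//|/val_inj ->] := ltngtP u v.
Qed.

Lemma key_eq e i : (key i == key e) = (i == e) || (i == rev_pair e).
Proof.
apply/eqP/orP => [|[/eqP ->|/eqP ->]] //; last by rewrite key_rev.
rewrite /key; case: ifP => _; case: ifP => _ h.
- by left; rewrite h.
- by right; rewrite h.
- by right; rewrite -h rev_pairK.
- by left; rewrite (inv_inj rev_pairK h).
Qed.

Definition symm S : {set I} := [set e | (e \in S) || (rev_pair e \in S)].

Definition symm_on A S : {set I} :=
  [set e | if key e \in A then (e \in S) || (rev_pair e \in S) else e \in S].

Section Exchange.
Variables (p p' : R) (phi : pred {set I}).
Hypothesis phi_mono : forall B B', B \subset B' -> phi B -> phi B'.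
Hypothesis phi_pair : forall B e, phi (e |: (rev_pair e |: B)) ->
  phi (e |: B) || phi (rev_pair e |: B).
Hypotheses (p01 : 0 <= p <= 1) (p'01 : 0 <= p' <= 1) (pp' : 1 - (1 - p') ^+ 2 <= p).

Definition hyb_wt A e : R := if e.1 == e.2 then 0 else if key e \in A then p' else p.

Definition hyb A : R := \sum_S wt (hyb_wt A) S * (phi (symm_on A S))%:R.

Lemma wt_pair (q : I -> R) S e e' : e != e' ->
  wt q S = (if e \in S then q e else 1 - q e) *
    ((if e' \in S then q e' else 1 - q e') *
     \prod_(i | (i != e) && (i != e')) (if i \in S then q i else 1 - q i)).
Proof. by move=> ee'; rewrite /wt (bigD1 e) // (bigD1 e') //= eq_sym. Qed.

(* McDiarmid's exchange: symmetrizing one pair of opposite edges cannot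
   increase the probability, as a copy uses at most one of the two. *)
Lemma hyb_step A e : (e.1 < e.2)%N -> e \notin A -> hyb (e |: A) <= hyb A.
Proof.
move=> e12 eA; pose e' := rev_pair e.
have ne12 : e.1 != e.2 by apply: contraTneq e12 => ->; rewrite ltnn.
have ee' : e != e'.
  by apply: contraNneq ne12 => /(congr1 fst) /= ->.
have ke : key e = e by rewrite /key e12.
have ke' : key e' = e by rewrite key_rev.
have kn i : i != e -> i != e' -> (key i == e) = false.
  by move=> h1 h2; rewrite -{1}ke key_eq (negbTE h1) (negbTE h2).
have split4 (g : {set I} -> R) : \sum_S g S =
    \sum_(S : {set I} | (e \notin S) && (e' \notin S))
      (g S + g (e |: S) + (g (e' |: S) + g (e |: (e' |: S)))).
  rewrite (sum_split (P := predT) _ (i := e)) // (sum_split _ (i := e')) //.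
  by move=> S _; rewrite !inE (negbTE ee').
rewrite /hyb !split4; apply: ler_sum => S /andP [eS e'S].
pose W := \prod_(i | (i != e) && (i != e')) (if i \in S then hyb_wt A i else 1 - hyb_wt A i).
have W0 : 0 <= W.
  have [a0 a1] := andP p01; have [b0 b1] := andP p'01.
  apply: prodr_ge0 => i _; rewrite /hyb_wt.
  by do !case: ifP => _; rewrite ?subr_ge0 // ?subr0 ?ler01.
have qe B : hyb_wt (e |: B) e = p' by rewrite /hyb_wt (negbTE ne12) ke setU11.
have qe' B : hyb_wt (e |: B) e' = p'.
  by rewrite /hyb_wt /= eq_sym (negbTE ne12) ke' setU11.
have re : hyb_wt A e = p by rewrite /hyb_wt (negbTE ne12) ke (negbTE eA).
have re' : hyb_wt A e' = p.
  by rewrite /hyb_wt /= eq_sym (negbTE ne12) ke' (negbTE eA).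
have WE (A' T : {set I}) : (forall i, i != e -> i != e' -> (i \in T) = (i \in S)) ->
    (A' = A \/ A' = e |: A) ->
    \prod_(i | (i != e) && (i != e')) (if i \in T then hyb_wt A' i else 1 - hyb_wt A' i) = W.
  move=> hT hA; apply: eq_bigr => i /andP [h1 h2]; rewrite hT //.
  suff -> : hyb_wt A' i = hyb_wt A i by [].
  by case: hA => -> //; rewrite /hyb_wt !inE kn.
have m1 i : i != e -> i != e' -> (i \in e |: S) = (i \in S).
  by move=> h1 h2; rewrite !inE (negbTE h1).
have m2 i : i != e -> i != e' -> (i \in e' |: S) = (i \in S).
  by move=> h1 h2; rewrite !inE (negbTE h2).
have m3 i : i != e -> i != e' -> (i \in e |: (e' |: S)) = (i \in S).
  by move=> h1 h2; rewrite !inE (negbTE h1) (negbTE h2).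
pose B := symm_on A S.
have rev_ne i : i != e -> i != e' -> rev_pair i != e /\ rev_pair i != e'.
  move=> h1 h2; split.
    by apply: contraNneq h2 => h; rewrite /e' -h rev_pairK.
  by rewrite (inj_eq (inv_inj rev_pairK)).
have vA (T : {set I}) : (forall i, i != e -> i != e' -> (i \in T) = (i \in S)) ->
    forall i, i != e -> i != e' -> (i \in symm_on A T) = (i \in B) /\
      (i \in symm_on (e |: A) T) = (i \in B).
  move=> hT i h1 h2; have [h3 h4] := rev_ne i h1 h2.
  by rewrite !inE kn // !hT.
have vAe (T : {set I}) : (e \in symm_on A T) = (e \in T) by rewrite inE ke (negbTE eA).
have vAe' (T : {set I}) : (e' \in symm_on A T) = (e' \in T) by rewrite inE ke' (negbTE eA).
have veAe (T : {set I}) : (e \in symm_on (e |: A) T) = (e \in T) || (e' \in T).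
  by rewrite inE ke setU11.
have veAe' (T : {set I}) : (e' \in symm_on (e |: A) T) = (e \in T) || (e' \in T).
  by rewrite inE ke' setU11 /e' rev_pairK orbC.
have eB : e \notin B by rewrite vAe.
have e'B : e' \notin B by rewrite vAe'.
have s1 : symm_on A (e |: S) = e |: B.
  apply/setP => i; rewrite in_setU1; have [->|h1] := eqVneq i e; first by rewrite vAe setU11.
  have [->|h2] := eqVneq i e'; last by rewrite (vA _ m1 i h1 h2).1.
  by rewrite vAe' in_setU1 eq_sym (negbTE ee') (negbTE e'S) (negbTE e'B).
have s2 : symm_on A (e' |: S) = e' |: B.
  apply/setP => i; rewrite in_setU1; have [->|h2] := eqVneq i e'; first by rewrite vAe' setU11.
  have [->|h1] := eqVneq i e; last by rewrite (vA _ m2 i h1 h2).1.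
  by rewrite vAe in_setU1 (negbTE ee') (negbTE eS) (negbTE eB).
have s3 : symm_on A (e |: (e' |: S)) = e |: (e' |: B).
  apply/setP => i; rewrite !in_setU1; have [->|h1] := eqVneq i e; first by rewrite vAe setU11.
  have [->|h2] := eqVneq i e'; first by rewrite vAe' in_setU1 setU11 orbT.
  by rewrite (vA _ m3 i h1 h2).1.
have t0 : symm_on (e |: A) S = B.
  apply/setP => i; have [->|h1] := eqVneq i e.
    by rewrite veAe (negbTE eS) (negbTE e'S) (negbTE eB).
  have [->|h2] := eqVneq i e'; last by rewrite (vA S _ i h1 h2).2.
  by rewrite veAe' (negbTE eS) (negbTE e'S) (negbTE e'B).
have t1 (T : {set I}) : (forall i, i != e -> i != e' -> (i \in T) = (i \in S)) ->
    (e \in T) || (e' \in T) -> symm_on (e |: A) T = e |: (e' |: B).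
  move=> hT h; apply/setP => i; rewrite !in_setU1.
  have [->|h1] := eqVneq i e; first by rewrite veAe.
  have [->|h2] := eqVneq i e'; first by rewrite veAe'.
  by rewrite (vA T hT i h1 h2).2.
rewrite t0 !t1 ?s1 ?s2 ?s3 ?setU11 ?in_setU1 ?eqxx ?orbT //.
rewrite !(wt_pair _ _ ee') !qe !qe' !re !re'.
rewrite !(WE _ _ _ (or_introl erefl)) // !(WE _ _ _ (or_intror erefl)) //.
rewrite !in_setU1 !eqxx (eq_sym e' e) (negbTE ee') (negbTE eS) (negbTE e'S) /= -/B.
have h1 : phi B -> phi (e |: B) by apply: phi_mono; apply: subsetUr.
have h2 : phi B -> phi (e' |: B) by apply: phi_mono; apply: subsetUr.
have h3 : phi (e' |: B) -> phi (e |: (e' |: B)) by apply: phi_mono; apply: subsetUr.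
have h4 := @phi_pair B e; rewrite -/e' in h4.
have h5 : phi (e |: B) -> phi (e |: (e' |: B)).
  by apply: phi_mono; apply: setUS; apply: subsetUr.
have pp : 0 <= p by case/andP: p01.
have pp1 : p <= 1 by case/andP: p01.
(* The critical case is that [phi] fails for [B] but holds with both edges added. By [phi_pair] one
   of them suffices, so the old probability is at least [p (1 - p) + p^2 = p], and the new one is
   [1 - (1 - p')^2]. *)
have key1 : W * (1 - (1 - p') ^+ 2) <= W * p by apply: ler_wpM2l.
have key2 : 0 <= W * (p * (1 - p)) by rewrite !mulr_ge0 // subr_ge0.
move: h1 h2 h3 h4 h5.
case: (phi B); case: (phi (e |: B)); case: (phi (e' |: B));
  case: (phi (e |: (e' |: B))) => h1 h2 h3 h4 h5;
  try (by have := h1 isT); try (by have := h2 isT); try (by have := h3 isT);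
  try (by have := h4 isT); try (by have := h5 isT); rewrite ?mulr1 ?mulr0; lra.
Qed.

Lemma hyb_le A : (forall e, e \in A -> (e.1 < e.2)%N) -> hyb A <= hyb set0.
Proof.
have [k] := ubnP #|A|; elim: k A => // k IH A kA up.
have [->|[e eA]] := set_0Vmem A; first by [].
rewrite -(setD1K eA); apply: le_trans (hyb_step _ _) _.
- exact: up.
- by rewrite !inE eqxx.
apply: IH; first by rewrite (cardsD1 e) eA in kA.
by move=> i; rewrite inE => /andP [_ /up].
Qed.

Definition pair_wt (p0 : R) e : R := if e.1 == e.2 then 0 else p0.

Lemma symmetrize :
  \sum_S wt (pair_wt p') S * (phi (symm S))%:R <=
  \sum_S wt (pair_wt p) S * (phi S)%:R.
Proof.
pose U : {set I} := [set e : I | (e.1 < e.2)%N].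
have -> : \sum_S wt (pair_wt p) S * (phi S)%:R = hyb set0.
  apply: eq_bigr => S _; congr (_ * (nat_of_bool (phi _))%:R).
    by apply: eq_bigr => e _; rewrite /hyb_wt inE.
  by apply/setP => e; rewrite !inE.
apply: le_trans (@hyb_le U _); last by move=> e; rewrite inE.
rewrite le_eqVlt; apply/orP; left; apply/eqP; apply: eq_bigr => S _.
have keyU e : e.1 != e.2 -> key e \in U.
  case: e => u v /= uv; rewrite inE /key /=.
  by have [//|//|/val_inj e] := ltngtP u v; rewrite e eqxx in uv.
congr (_ * (nat_of_bool (phi _))%:R).
  apply: eq_bigr => e _; rewrite /hyb_wt /pair_wt.
  by case: eqP => [//|/eqP /keyU ->].
apply/setP => e; rewrite !inE.
have [e12|/keyU ] := eqVneq e.1 e.2; last by rewrite inE => ->.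
have -> : rev_pair e = e by case: e e12 => u v /= ->.
by rewrite orbb; case: ifP.
Qed.

End Exchange.

End Coupling.

(** * Two rounds *)

Lemma disjoint_setU (T : finType) (A B C : {set T}) :
  [disjoint A :|: B & C] = [disjoint A & C] && [disjoint B & C].
Proof. by rewrite -!setI_eq0 setIUl setU_eq0. Qed.

Lemma prod_setU (R : realFieldType) (T : finType) (A B : {set T}) (g : T -> R) :
  [disjoint A & B] ->
  \prod_(i in A :|: B) g i = \prod_(i in A) g i * \prod_(i in B) g i.
Proof.
move=> dAB; rewrite -bigU //; apply: eq_bigl => i; by rewrite !inE.
Qed.

Section TwoRounds.
Variables (R : realFieldType) (n : nat).
Local Notation V := 'I_n.
Local Notation I := (V * V)%type.
Implicit Types (S F H : {set I}).

(* The pairs above the diagonal carry the first round, those below it the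
   second one. *)
Definition upper : {set I} := [set e : I | (e.1 < e.2)%N].
Definition lower : {set I} := [set e : I | (e.2 < e.1)%N].

Definition joined (m b : nat) S : Prop := forall A B : {set V},
  [disjoint A & B] -> (m <= #|A|)%N -> (b <= #|B|)%N ->
  exists x y, [/\ x \in A, y \in B & (x, y) \in symm S].

Variables (p z : R) (phi : pred {set I}) (m b k h : nat).
Hypothesis phi_mono : forall B B' : {set I}, B \subset B' -> phi B -> phi B'.
Hypotheses (p01 : 0 <= p <= 1) (z01 : 0 < z <= 1).
Hypothesis progress : forall S1, S1 \subset upper -> joined m b S1 ->
  exists2 lam : {set I} -> nat, (forall F, lam F <= k)%N &
    forall F, F \subset lower -> phi (symm (S1 :|: F)) \/
      exists H, [/\ H \subset lower, (h <= #|H|)%N &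
        forall e, e \in H -> (lam F < lam (e |: F))%N].

Let q : I -> R := pair_wt p.

Let q01 e : 0 <= q e <= 1.
Proof. by rewrite /q /pair_wt; case: ifP => // _; rewrite lexx ler01. Qed.

Let wt_ge0 S : 0 <= wt q S.
Proof.
apply: prodr_ge0 => e _; have /andP [h0 h1] := q01 e.
by case: ifP => _ //; rewrite subr_ge0.
Qed.

Let q_neq (e : I) : e.1 != e.2 -> q e = p.
Proof. by rewrite /q /pair_wt => /negbTE ->. Qed.

Lemma upper_neq (e : I) : e \in upper -> e.1 != e.2.
Proof. by rewrite inE => h'; apply: contraTneq h' => ->; rewrite ltnn. Qed.

Lemma lower_neq (e : I) : e \in lower -> e.1 != e.2.
Proof. by rewrite inE => h'; apply: contraTneq h' => ->; rewrite ltnn. Qed.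

Definition crossing (A B : {set V}) : {set I} :=
  [set key e | e in setX A B].

Lemma key_upper (e : I) : e.1 != e.2 -> key e \in upper.
Proof.
case: e => u v /= uv; rewrite inE /key /=.
by have [//|//|/val_inj e] := ltngtP u v; rewrite e eqxx in uv.
Qed.

Lemma card_crossing (A B : {set V}) : [disjoint A & B] ->
  #|crossing A B| = (#|A| * #|B|)%N.
Proof.
move=> AB; rewrite card_in_imset ?cardsX // => -[u v] [u' v'].
move=> /setXP [/= uA vB] /setXP [/= u'A v'B] /eqP.
rewrite key_eq => /orP [/eqP //|/eqP [uv' _]].
by rewrite uv' (disjointFl AB v'B) in uA.
Qed.

Lemma crossing_upper (A B : {set V}) : [disjoint A & B] -> crossing A B \subset upper.
Proof.
move=> AB; apply/subsetP => e /imsetP [[u v] /setXP [uA vB] ->].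
apply: key_upper; apply/eqP => /= uv; move: vB; rewrite -uv.
by rewrite (disjointFr AB uA).
Qed.

Let prod_lower F : F \subset lower -> \prod_(e in F) q e = p ^+ #|F|.
Proof.
move=> sF; rewrite -prodr_const; apply: eq_bigr => e eF.
by apply: q_neq; apply: lower_neq; apply: (subsetP sF).
Qed.

Let prod_compl (K : {set I}) : (forall e, e \in K -> e.1 != e.2) ->
  \prod_(e in K) (1 - q e) = (1 - p) ^+ #|K|.
Proof.
move=> sK; rewrite -prodr_const; apply: eq_bigr => e eK.
by rewrite q_neq // sK.
Qed.

Let ip0 : 0 <= 1 - p.  Proof. by case/andP: p01 => _; rewrite subr_ge0. Qed.
Let ip1 : 1 - p <= 1.  Proof. by case/andP: p01 => h0 _; rewrite lerBlDr lerDl. Qed.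

(** A union bound over at most [4 ^ n] pairs of sets; disjoint sets are crossed by at least [m * b]
    distinct unordered pairs. *)
Lemma joined_fail :
  \sum_(S | `[< ~ joined m b (S :&: upper) >]) wt q S <=
  4 ^+ n * (1 - p) ^+ (m * b).
Proof.
pose ok (AB : {set V} * {set V}) :=
  [&& [disjoint AB.1 & AB.2], (m <= #|AB.1|)%N & (b <= #|AB.2|)%N].
apply: (@le_trans _ _ (\sum_(AB | ok AB)
    \sum_(S : {set I} | (set0 \subset S) && [disjoint crossing AB.1 AB.2 & S]) wt q S)).
  rewrite (exchange_big_dep predT) //= [leLHS]big_mkcond /=; apply: ler_sum => S _.
  case: asboolP => [nj|_]; last by apply: sumr_ge0.
  suff [AB okAB] : exists AB, ok AB && ((set0 \subset S) && [disjoint crossing AB.1 AB.2 & S]).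
    rewrite (bigD1 AB) //= ?andTb // lerDl; exact: sumr_ge0.
  apply: contrapT => no; apply: nj => A B dAB mA bB.
  apply: contrapT => nxy; apply: no; exists (A, B).
  rewrite /ok /= dAB mA bB sub0set /= -setI_eq0; apply/eqP/setP => e.
  rewrite in_setI in_set0; apply/negP => /andP [eC eS].
  have eU := subsetP (crossing_upper dAB) _ eC.
  case/imsetP: eC => -[u v] /setXP [/= uA vB] ek; apply: nxy; exists u, v.
  split=> //; rewrite inE; move: eS eU; rewrite ek /key /=; case: ifP => _ eS eU.
    by rewrite in_setI eS eU.
  by rewrite orbC in_setI eS eU.
apply: (@le_trans _ _ (\sum_(AB | ok AB) (1 - p) ^+ (m * b))).
  apply: ler_sum => -[A B] /and3P [/= dAB mA bB].
  rewrite sum_cylinder; last by rewrite -setI_eq0 set0I.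
  rewrite big_set0 mul1r prod_compl; last first.
    by move=> e /(subsetP (crossing_upper dAB)) /upper_neq.
  by rewrite card_crossing //; apply: ler_wiXn2l => //; apply: leq_mul.
rewrite sumr_const -[leLHS]mulr_natl ler_wpM2r ?exprn_ge0 //.
rewrite -natrX ler_nat; apply: leq_trans (max_card _) _.
by rewrite card_prod -cardsT -powersetT card_powerset cardsT card_ord -expnMn.
Qed.

(** Once [S1] and [F] are fixed, so is [Hs S1 F], disjoint from [F]; the event is then a cylinder of
    weight at most [c S1 * (p ^+ #|F| * (1 - p) ^+ h)]. The [c S1] sum to 1, and [sum_few_subsets]
    bounds the sum over [F]. *)
Lemma few_progress (Hs : {set I} -> {set I} -> option {set I}) :
  (forall S1 F H, Hs S1 F = Some H ->
     [/\ H \subset lower, [disjoint F & H] & (h <= #|H|)%N]) ->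
  \sum_(S | [exists F : {set I}, [&& F \subset S :&: lower, (#|F| <= k)%N &
      if Hs (S :&: upper) F is Some H then [disjoint H & S] else false]]) wt q S <=
  z ^- k * (1 + p * z) ^+ (n * n) * (1 - p) ^+ h.
Proof.
move=> HsP.
pose bad (F S1 S : {set I}) := [&& F \subset S, S :&: upper == S1 &
  if Hs S1 F is Some H then [disjoint H & S] else false].
pose okF (F : {set I}) := (F \subset lower) && (#|F| <= k)%N.
have dUL : [disjoint upper & lower].
  rewrite -setI_eq0; apply/eqP/setP => e; rewrite !inE.
  by apply/negP => /andP [h1 h2]; have := ltn_trans h1 h2; rewrite ltnn.
pose c (S1 : {set I}) := \sum_(S : {set I} | S :&: upper == S1) wt q S.
have cylU (S1 S : {set I}) : S1 \subset upper ->
    (S :&: upper == S1) = (S1 \subset S) && [disjoint upper :\: S1 & S].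
  move=> s1; apply/eqP/andP => [<-|[s2 d2]].
    split; first exact: subsetIl.
    rewrite -setI_eq0; apply/eqP/setP => e; rewrite !inE.
    by case: (e \in S); rewrite ?andbF //= andNb.
  apply/setP => e; rewrite in_setI.
  have [e1|e1] := boolP (e \in S1); first by rewrite (subsetP s2) // (subsetP s1).
  apply/negP => /andP [eS eU].
  have : e \in upper :\: S1 by rewrite in_setD e1 eU.
  by move/(disjointFr d2); rewrite eS.
apply: (@le_trans _ _ (\sum_(F | okF F) \sum_(S1 : {set I} | S1 \subset upper)
    \sum_(S | bad F S1 S) wt q S)).
  pose g F S := \sum_(S1 : {set I} | S1 \subset upper) (if bad F S1 S then wt q S else 0).
  apply: (@le_trans _ _ (\sum_S \sum_(F | okF F) g F S)); last first.
    rewrite exchange_big /=; apply: ler_sum => F _; rewrite exchange_big /=.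
    by apply: ler_sum => S1 _; rewrite -big_mkcond.
  have g0 F S : 0 <= g F S by apply: sumr_ge0 => S1 _; case: ifP.
  rewrite [leLHS]big_mkcond; apply: ler_sum => S _.
  case: ifP => [/existsP [F /and3P [FS Fk HF]]|_]; last exact: sumr_ge0.
  have /andP [FS1 FS2] : (F \subset S) && (F \subset lower) by rewrite -subsetI.
  rewrite (bigD1 F) /=; last by rewrite /okF FS2.
  apply: (@le_trans _ _ (g F S)); last by rewrite lerDl; apply: sumr_ge0.
  rewrite /g (bigD1 (S :&: upper)) /=; last exact: subsetIr.
  rewrite {1}/bad FS1 eqxx HF /= lerDl; apply: sumr_ge0 => S1 _; by case: ifP.
apply: (@le_trans _ _ (\sum_(F | okF F) \sum_(S1 : {set I} | S1 \subset upper)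
    c S1 * (p ^+ #|F| * (1 - p) ^+ h))).
  apply: ler_sum => F /andP [FL Fk]; apply: ler_sum => S1 S1U.
  have c0 : 0 <= c S1 by apply: sumr_ge0.
  case E: (Hs S1 F) => [H|]; last first.
    rewrite big_pred0; first by rewrite !mulr_ge0 ?exprn_ge0 //; case/andP: p01.
    by move=> S; rewrite /bad E !andbF.
  have [HL FH hH] := HsP _ _ _ E.
  have dS1H : [disjoint S1 & H] by apply: disjointWl S1U _; apply: disjointWr HL _.
  have dFU : [disjoint F & upper :\: S1].
    rewrite disjoint_sym; apply: disjointWl (subsetDl _ _) _.
    exact: disjointWr FL dUL.
  have dTK : [disjoint S1 :|: F & (upper :\: S1) :|: H].
    rewrite disjoint_setU ![[disjoint _ & (upper :\: S1) :|: H]]disjoint_sym.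
    rewrite !disjoint_setU ![[disjoint H & _]]disjoint_sym dS1H FH !andbT.
    rewrite [[disjoint _ & F]]disjoint_sym dFU andbT.
    by rewrite -setI_eq0; apply/eqP/setP => e; rewrite !inE; case: (e \in S1); rewrite ?andbF.
  have -> : \sum_(S | bad F S1 S) wt q S = \sum_(S : {set I} |
      ((S1 :|: F) \subset S) && [disjoint (upper :\: S1) :|: H & S]) wt q S.
    apply: eq_bigl => S; rewrite /bad E cylU // subUset disjoint_setU.
    by case: (S1 \subset S); case: (F \subset S); rewrite ?andbF.
  rewrite sum_cylinder // !prod_setU //; last 2 first.
  - apply: disjointWl (subsetDl _ _) _; exact: disjointWr HL dUL.
  - by apply: disjointWl S1U _; apply: disjointWr FL _.
  have -> : c S1 = \prod_(e in S1) q e * \prod_(e in upper :\: S1) (1 - q e).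
    rewrite -sum_cylinder; first by apply: eq_bigl => S; apply: cylU.
    by rewrite -setI_eq0; apply/eqP/setP => e; rewrite !inE; case: (e \in S1); rewrite ?andbF.
  rewrite mulrACA; apply: ler_wpM2l.
    by apply: mulr_ge0; apply: prodr_ge0 => e _; have /andP [h1 h2] := q01 e; rewrite ?subr_ge0.
  rewrite prod_lower // prod_compl; last by move=> e /(subsetP HL) /lower_neq.
  apply: ler_wpM2l; first by rewrite exprn_ge0 //; case/andP: p01.
  exact: ler_wiXn2l.
have c1 : \sum_(S1 : {set I} | S1 \subset upper) c S1 = 1.
  rewrite -(sum_wt q) /c [RHS](partition_big (fun S => S :&: upper)
    (fun S1 : {set I} => S1 \subset upper)) //= => S _.
  exact: subsetIr.
rewrite (eq_bigr (fun F : {set I} => p ^+ #|F| * (1 - p) ^+ h)); last first.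
  by move=> F _; rewrite -mulr_suml c1 mul1r.
rewrite -mulr_suml; apply: ler_wpM2r; first exact: exprn_ge0.
have p0 : 0 <= p by case/andP: p01.
have cI : #|{: I}| = (n * n)%N by rewrite card_prod card_ord.
rewrite -cI; apply: le_trans (sum_few_subsets _ k p0 z01).
rewrite [leRHS](bigID (fun F : {set I} => F \subset lower)) /= -[leLHS]addr0; apply: lerD.
  by rewrite le_eqVlt; apply/orP; left; apply/eqP/eq_bigl => F; rewrite /okF andbC.
by apply: sumr_ge0 => F _; apply: exprn_ge0.
Qed.

Lemma two_rounds :
  1 - (4 ^+ n * (1 - p) ^+ (m * b) + z ^- k * (1 + p * z) ^+ (n * n) * (1 - p) ^+ h) <=
  \sum_S wt q S * (phi (symm S))%:R.
Proof.
have [Hs [HsP HsQ]] : exists Hs : {set I} -> {set I} -> option {set I},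
    (forall S1 F H, Hs S1 F = Some H ->
     [/\ H \subset lower, [disjoint F & H] & (h <= #|H|)%N]) /\
    (forall S1, S1 \subset upper -> joined m b S1 ->
      exists2 lam : {set I} -> nat, (forall F, lam F <= k)%N &
      forall F, F \subset lower -> phi (symm (S1 :|: F)) \/
      exists2 H, Hs S1 F = Some H & 
        forall e, e \in H -> (lam F < lam (e |: F))%N).
  have /boolp.choice [lam lamP] : forall S1, exists l : {set I} -> nat,
      S1 \subset upper -> joined m b S1 -> (forall F, l F <= k)%N /\
      forall F, F \subset lower -> phi (symm (S1 :|: F)) \/
      exists H, [/\ H \subset lower, (h <= #|H|)%N &
        forall e, e \in H -> (l F < l (e |: F))%N].
    move=> S1; have [[sU jS]|no] := pselect (S1 \subset upper /\ joined m b S1).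
      by have [l l1 l2] := progress sU jS; exists l.
    by exists (fun _ => 0%N) => sU jS; case: no.
  exists (fun S1 F => [pick H : {set I} | [&& H \subset lower, (h <= #|H|)%N &
     [forall e in H, (lam S1 F < lam S1 (e |: F))%N]]]); split.
    move=> S1 F H; case: pickP => // H' /and3P [HL hH /forall_inP lH] [<-]; split=> //.
    rewrite -setI_eq0; apply/eqP/setP => e; rewrite !inE; apply/negP => /andP [eF eH].
    by have := lH _ eH; rewrite (setUidPr _) ?ltnn // sub1set.
  move=> S1 sU jS; have [l1 l2] := lamP _ sU jS; exists (lam S1) => // F FL.
  have [|[H [HL hH lH]]] := l2 _ FL; first by left.
  right; case: pickP => [H' /and3P [_ _ /forall_inP h3]|/(_ H)]; first by exists H'.
  by move=> /negP []; rewrite HL hH; apply/forall_inP.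
pose f1 S := `[< ~ joined m b (S :&: upper) >].
pose f2 S := [exists F : {set I}, [&& F \subset S :&: lower, (#|F| <= k)%N &
      if Hs (S :&: upper) F is Some H then [disjoint H & S] else false]].
have fail S : ~~ phi (symm S) -> f1 S || f2 S.
  move=> nphi; rewrite /f1; case: asboolP => //= /contrapT jS.
  have [lam lamk lamP] := HsQ _ (subsetIr _ _) jS.
  (* Take [F] among the present second-round edges with [#|F| <= lam F] and [lam F] maximal. A
     present edge of [H] would raise [lam] by at least one and [#|F|] by at most one, so all of [H]
     is absent; and [lam F <= k] keeps [F] small. *)
  pose P (F : {set I}) := (F \subset S :&: lower) && (#|F| <= lam F)%N.
  have P0 : P set0 by rewrite /P sub0set cards0.
  pose F := [arg max_(F > set0 | P F) lam F].
  have [/andP [FS Fl] maxF] : P F /\ (forall F', P F' -> (lam F' <= lam F)%N).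
    by rewrite /F; case: arg_maxnP.
  apply/existsP; exists F; rewrite FS (leq_trans Fl (lamk _)) /=.
  have [FS1 FL] : F \subset S /\ F \subset lower.
    by apply/andP; rewrite -subsetI.
  have [ph|[H HsE lH]] := lamP _ FL.
    case/negP: nphi; apply: phi_mono ph; apply/subsetP => e.
    have sub : (S :&: upper) :|: F \subset S by rewrite subUset subsetIl.
    by rewrite !inE => /orP [|] he; apply/orP; [left|right];
      apply: (subsetP sub); rewrite !inE.
  rewrite HsE -setI_eq0; apply/eqP/setP => e; rewrite in_setI in_set0.
  apply/negP => /andP [eH eS]; have lt := lH _ eH.
  have [HL _ _] := HsP _ _ _ HsE.
  have := maxF (e |: F); rewrite leqNgt lt /P subUset FS sub1set in_setI eS.
  rewrite (subsetP HL) //= (leq_trans _ lt) ?ltnS.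
    by move/(_ isT).
  apply: leq_trans (_ : _ <= #|F|.+1)%N _ => //.
  by rewrite cardsU1; case: (_ \notin _).
rewrite lerBlDr -[leLHS](sum_wt q).
apply: (@le_trans _ _ (\sum_S (wt q S * (phi (symm S))%:R +
   ((if f1 S then wt q S else 0) + (if f2 S then wt q S else 0))))).
  apply: ler_sum => S _; have := fail S; case: (phi _) => [_|/(_ isT)].
    by rewrite mulr1 lerDl addr_ge0 //; case: ifP.
  by rewrite mulr0 add0r; case: (f1 S); case: (f2 S) => //= _;
    rewrite ?addr0 ?add0r // lerDl.
rewrite !big_split /=. rewrite lerD2l; apply: lerD; rewrite -big_mkcond.
  exact: joined_fail.
exact: few_progress.
Qed.

End TwoRounds.

Local Open Scope nat_scope.

(** * Boosters for the skeleton *)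

Lemma longest_mono (V : finType) (S0 : {set V}) s t (H H' : rel V) :
  subrel H H' -> longest S0 s t H <= longest S0 s t H'.
Proof.
move=> HH'; apply/bigmax_leqP => k /existsP [p vp].
rewrite -(size_tuple p); apply: longest_ge.
have /and4P [h1 h2 h3 h4] := vp; apply/and4P; split=> //.
apply: sub_sorted h3 => u v /orP [/HH' h|h]; by rewrite /forced h ?orbT.
Qed.

Section Progress.
Variables (n : nat) (W : finType).
Local Notation V := 'I_n.
Local Notation I := (V * V)%type.
Variables (D0 : digraph V) (C : digraph W) (X : {set V}) (f : V -> W) (sW : seq W) (w0 : W).
Variables (m b r q rho mD t wmax p0 c h : nat).
Let z := #|X| + m.
Let K := (4 * z + m).*2.
Let Lmax := p0 + (4 * t + 3) * z.
Let pos x := index (f x) sW.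

Hypothesis asym : forall u v, ~~ (edge C u v && edge C v u).
Hypothesis cW : cyclic_order (uedge C) sW.
Hypothesis szW : size sW = n.
Hypothesis min_deg : forall s v, q.*2 <= #|[set w | sadj D0 s v w & w \notin X]|.
Hypothesis expand : forall (A B : {set V}) s, #|A| <= mD ->
    (forall v, v \in A -> q <= #|[set w in B | sadj D0 s v w]|) -> rho * #|A| <= #|B|.
Hypotheses (X0 : X != set0) (tp : forall x, x \in X -> t < pos x <= p0).
Hypothesis gap : forall x y, x \in X -> y \in X -> x != y ->
    pos x + (4 * t + 3) <= pos y \/ pos y + (4 * t + 3) <= pos x.
Hypotheses (rho8 : 8 <= rho) (rrho : r.*2 <= rho) (r7 : 7 <= r) (zD : z <= mD).
Hypotheses (mt : 0 < m <= r ^ t) (bt : 0 < b <= r ^ t).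
Hypotheses (num1 : #|X| + b + r.*2.+1 * (K + m) < n)
  (num2 : z + K + b + wmax + K * r < n)
  (num3 : 4 * z + Lmax.+1 + m.*2 + b.*2 <= wmax)
  (num4 : c * 3 + 3 + b.*2 + (Lmax + t.+1) <= n) (hc : h.*2 <= c ^ 2).

Lemma symmC (S : {set I}) u v : ((u, v) \in symm S) = ((v, u) \in symm S).
Proof. by rewrite !inE orbC. Qed.

Lemma progress_cycle (S1 : {set I}) : joined m b S1 ->
  exists2 lam : {set I} -> nat, (forall F, lam F <= n.+1) &
    forall F : {set I}, F \subset lower n -> copy_in D0 C X f (symm (S1 :|: F)) \/
      exists H : {set I}, [/\ H \subset lower n, h <= #|H| &
        forall e, e \in H -> lam F < lam (e |: F)].
Proof.
move=> jS; pose G : rel V := fun u v => (u, v) \in symm S1.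
have symG : symmetric G by move=> u v; apply: symmC.
have adjC s u v : sadj D0 (~~ s) u v = sadj D0 s v u by case: s.
have cV : #|V| = n by rewrite card_ord.
have JG (A B : {set V}) : [disjoint A & B] -> m <= #|A| -> b <= #|B| ->
    exists x y, [/\ x \in A, y \in B & G x y] by exact: jS.
have n1 : #|X| + b + r.*2.+1 * ((4 * (#|X| + m) + m).*2 + m) < #|V| by rewrite cV.
have n2 : (#|X| + m) + (4 * (#|X| + m) + m).*2 + b + wmax + (4 * (#|X| + m) + m).*2 * r < #|V|.
  by rewrite cV.
have [k [x [p [sq up [xt kp] pX expS]]]] := skeleton (orient C sW w0) symG adjC min_deg expand JG X0 tp gap
  rho8 rrho r7 zD mt bt n1 n2 num3.
have {}kp : k + size p <= Lmax + t.+1 := kp.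
set S0 := rest_set x p in expS; pose t0 := last x p.
have cS0 := card_rest_set x p; rewrite -/S0 cV in cS0.
have xS : x \in S0 by rewrite /S0 /rest_set in_set eqxx orbT.
have tS : t0 \in S0 by rewrite /S0 /rest_set in_set eqxx !orbT.
have spr : spreads G m b.
  move=> A mA; rewrite ltnNge; apply/negP => bB.
  have [|y [w [yA]]] := JG A _ _ mA bB.
    by rewrite -setI_eq0; apply/eqP/setP => w; rewrite !inE andbA andbN.
  rewrite inE => /andP [_ /forall_inP h'] Gyw.
  by have := h' y yA; rewrite Gyw.
pose HF (F : {set I}) : rel V := fun u v => (u, v) \in symm (S1 :|: F).
have symHF F : symmetric (HF F) by move=> u v; apply: symmC.
have HFm (F F' : {set I}) : F \subset F' -> subrel (HF F) (HF F').
  move=> FF' u v; rewrite /HF !in_set /= => /orP [] /orP [h'|/(subsetP FF') h'];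
    by rewrite h' ?orbT.
have GHF F : subrel G (HF F).
  by move=> u v; rewrite /G /HF !in_set /= => /orP [] ->; rewrite ?orbT.
have ext_sub (A : {set V}) F : extnbr S0 G A \subset extnbr S0 (HF F) A.
  apply/subsetP => w; rewrite !in_set => /and3P [-> -> /existsP [a /andP [aA Gaw]]] /=.
  by apply/existsP; exists a; rewrite aA (GHF F).
have expF F (A : {set V}) : A \subset S0 -> 0 < #|A| <= m ->
    #|A|.*2 + 3 < #|extnbr S0 (HF F) A|.
  by move=> AS Am; apply: leq_trans (expS A AS Am) (subset_leq_card (ext_sub A F)).
have bigF F (A : {set V}) : A \subset S0 -> m <= #|A| ->
    #|S0| <= #|A| + #|extnbr S0 (HF F) A| + b.
  move=> AS mA; apply: leq_trans (card_extnbr_spread S0 spr mA) _.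
  by rewrite leq_add2r leq_add2l subset_leq_card.
have bS : b.*2 < #|S0|.
  by move: cS0 num4 kp; move: Lmax (#|S0|) (size p) => u v1 v2; clear; lia.
have cS : c * 3 + 3 + b <= #|S0|.
  by move: cS0 num4 kp; move: Lmax (#|S0|) (size p) => u v1 v2; clear; lia.
pose ham F := `[< hamilton S0 x t0 (HF F) >].
(* One extra unit rewards the Hamilton cycle, after which the longest path need not grow; hence the
   bound [n.+1]. *)
exists (fun F => longest S0 x t0 (HF F) + ham F).
  move=> F; have := longest_le S0 x t0 (HF F); rewrite cV => le.
  by rewrite -addn1 leq_add // leq_b1.
move=> F FL; have [hF|nhF] := pselect (hamilton S0 x t0 (HF F)).
  left; have [P [uP mP pP lP]] := hF.
  case/lastP: P lP uP mP pP => [/= e|Q y]; first by move: xt; rewrite -/t0 e eqxx.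
  rewrite last_rcons => -> uP mP pP {y}.
  have dQ w : w \in Q -> w \notin x :: p.
    move=> wQ; have : w \in S0 by rewrite -mP in_cons mem_rcons in_cons wQ !orbT.
    rewrite /S0 /rest_set in_set => /or3P [//|/eqP e|/eqP e].
      by move: uP; rewrite /= rcons_uniq -e wQ !andbF.
    by move: uP; rewrite /= mem_rcons in_cons (_ : t0 = w) ?wQ ?orbT // /t0 e.
  (* The skeleton followed by the interior of the Hamilton path is a cyclic sequence of all
     vertices. *)
  have uc : uniq ((x :: p) ++ Q).
    rewrite cat_uniq up andTb; apply/andP; split; last first.
      by move: uP; rewrite /= rcons_uniq => /and3P [].
    by apply/hasPn => w /dQ.
  have sc : size ((x :: p) ++ Q) = n.
    rewrite -[RHS]cV; have /card_uniqP <- := uc; apply: eq_card => w; rewrite [RHS]inE.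
    rewrite mem_cat; have [//|wp /=] := boolP (w \in x :: p).
    have : w \in S0 by rewrite /S0 /rest_set in_set wp.
    rewrite -mP in_cons mem_rcons in_cons => /or3P [/eqP e|/eqP e|//].
      by rewrite e mem_last in wp.
    by rewrite e mem_head in wp.
  have lc : last x ((x :: p) ++ Q) = last t0 Q by rewrite last_cat.
  have lHF : HF F (last x ((x :: p) ++ Q)) (head x ((x :: p) ++ Q)).
    by rewrite lc; move: pP; rewrite rcons_path => /andP [].
  have pQ : path (HF F) t0 Q by move: pP; rewrite rcons_path => /andP [].
  apply: (copy_from_cycle (w0 := w0) (k := k) (c0 := (x :: p) ++ Q) (H := HF F) asym cW _ uc _ _ _ lHF).
  - by move=> u v h'; split=> //; rewrite symmC.
  - by rewrite sc szW.
  - by rewrite szW; move: num4 kp; move: Lmax (size p) => u v1; clear; lia.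
  - have -> : (x :: p) ++ Q = belast x p ++ t0 :: Q by rewrite lastI cat_rcons.
    rewrite oseq_cat -lastI; apply/andP; split.
      apply: oseq_sub sq => j u v /= /orP [->//|/GHF h']; by rewrite h' orbT.
    by apply: oseq_path pQ => j u v h'; rewrite h' orbT.
  - move=> y yX; have [q1 [q2 [e1 e2]]] := pX y yX.
    by exists q1, (q2 ++ Q); rewrite e1 -catA.
right; pose LP := longest_pairs S0 x t0 (HF F).
have cLP : c ^ 2 <= #|LP| := card_longest_pairs xS tS xt (symHF F) (expF F) (bigF F) cS.
exists (LP :&: lower n); split; first exact: subsetIr.
  (* The pairs occur in both orders, so half of them lie below the diagonal. *)
  rewrite -leq_double; apply: leq_trans hc (leq_trans cLP _).
  have sub : LP \subset (LP :&: lower n) :|: ((@rev_pair n) @: (LP :&: lower n)).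
    apply/subsetP => -[u v] uvL; rewrite in_setU; have uv := longest_pairs_neq uvL.
    have [lt|gt|/val_inj e] := ltngtP u v; last by rewrite e eqxx in uv.
      apply/orP; right; apply/imsetP; exists (v, u) => //.
      by rewrite in_setI (longest_pairs_sym (symHF F) uvL) inE.
    by rewrite in_setI uvL inE gt.
  apply: leq_trans (subset_leq_card sub) _; apply: leq_trans (leq_card_setU _ _) _.
  by rewrite -addnn leq_add2l leq_imset_card.
move=> [u v] /setIP [uvL _]; rewrite {1}/ham.
have -> : `[< hamilton S0 x t0 (HF F) >] = false by apply/asboolPn.
rewrite addn0; have sF : F \subset (u, v) |: F by apply: subsetUr.
have Huv : HF ((u, v) |: F) u v by rewrite /HF in_set; apply/orP; left; rewrite !inE eqxx orbT.
have [hm|lt] := booster xt (symHF F) (expF F) (bigF F) bS (symHF _) (HFm _ _ sF) uvL Huv.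
  have -> : ham ((u, v) |: F) by apply/asboolP.
  by rewrite addn1 ltnS; apply: longest_mono; apply: HFm.
by apply: leq_trans lt (leq_addr _ _).
Qed.

End Progress.

Local Open Scope ring_scope.

Lemma random_digraph_prob_wt (R : realType) (n : nat) (p : R) (phi : pred {set 'I_n * 'I_n}) :
  random_digraph_prob (V := 'I_n) p (fun D => phi (edges D)) =
  \sum_S wt (pair_wt p) S * (phi S)%:R.
Proof.
pose loopless := [pred E : {set 'I_n * 'I_n} | [forall v, (v, v) \notin E]].
rewrite [RHS](bigID loopless) /= [X in _ = _ + X]big1 ?addr0; last first.
  move=> E; rewrite negb_forall => /existsP [v]; rewrite negbK => vE.
  by rewrite /wt (bigD1 (v, v)) //= vE /pair_wt /= eqxx !mul0r.
rewrite [RHS](reindex_omap (@edges 'I_n) insub) /=; last first.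
  by move=> E hE; rewrite insubT.
rewrite /random_digraph_prob big_mkcond /=; apply: eq_big => [D|D _].
  by rewrite valK eqxx andbT; case: D.
suff -> : wt (pair_wt p) (edges D) = random_digraph_pmf p D.
  by case: (phi _); rewrite ?mulr1 ?mulr0.
rewrite /wt (bigID (fun e : 'I_n * 'I_n => e.1 != e.2)) /=.
rewrite [X in _ * X]big1 ?mulr1.
  by apply: eq_bigr => e /negbTE ne; rewrite /pair_wt ne.
case: D => E /= /forallP hE [u v] /=; rewrite negbK => /eqP ->.
by rewrite (negbTE (hE v)) /pair_wt /= eqxx subr0.
Qed.

Section CopyProbability.
Variables (R : realType) (n : nat) (W : finType).
Local Notation V := 'I_n.
Variables (D0 : digraph V) (C : digraph W) (X : {set V}) (f : V -> W) (sW : seq W) (w0 : W).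
Variables (m b r q rho mD t wmax p0 c h : nat) (p z : R).
Let zX := (#|X| + m)%N.
Let K := ((4 * zX + m).*2)%N.
Let Lmax := (p0 + (4 * t + 3) * zX)%N.

Lemma copy_probability :
  (forall u v, ~~ (edge C u v && edge C v u)) ->
  cyclic_order (uedge C) sW -> size sW = n ->
  (forall s v, (q.*2 <= #|[set w | sadj D0 s v w & w \notin X]|)%N) ->
  (forall (A B : {set V}) s, (#|A| <= mD)%N ->
    (forall v, v \in A -> (q <= #|[set w in B | sadj D0 s v w]|)%N) ->
    (rho * #|A| <= #|B|)%N) ->
  X != set0 ->
  (forall x, x \in X -> (t < index (f x) sW <= p0)%N) ->
  (forall x y, x \in X -> y \in X -> x != y ->
    (index (f x) sW + (4 * t + 3) <= index (f y) sW)%N \/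
    (index (f y) sW + (4 * t + 3) <= index (f x) sW)%N) ->
  (8 <= rho)%N -> (r.*2 <= rho)%N -> (7 <= r)%N -> (zX <= mD)%N ->
  (0 < m <= r ^ t)%N -> (0 < b <= r ^ t)%N ->
  (#|X| + b + r.*2.+1 * (K + m) < n)%N ->
  (zX + K + b + wmax + K * r < n)%N ->
  (4 * zX + Lmax.+1 + m.*2 + b.*2 <= wmax)%N ->
  (c * 3 + 3 + b.*2 + (Lmax + t.+1) <= n)%N -> (h.*2 <= c ^ 2)%N ->
  0 <= p <= 1 -> 0 < z <= 1 ->
  1 - (4 ^+ n * (1 - p / 2) ^+ (m * b) +
    z ^- n.+1 * (1 + p / 2 * z) ^+ (n * n) * (1 - p / 2) ^+ h) <=
  random_digraph_prob p (fun D1 : digraph V => has_copy (dunion D0 D1) C X f).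
Proof.
move=> asym cW szW mind exp X0 tp gap rho8 rrho r7 zD mt bt n1 n2 n3 n4 hc p01 z01.
have [pp0 pp1] := andP p01.
have p'01 : 0 <= p / 2 <= 1 by apply/andP; split; lra.
have mono := @copy_in_mono V W D0 C X f.
apply: (le_trans (two_rounds (phi := copy_in D0 C X f) mono p'01 z01 _)).
  move=> S1 _ jS; apply: (progress_cycle w0 asym cW szW mind exp X0 tp gap
    rho8 rrho r7 zD mt bt n1 n2 n3 n4 hc jS).
rewrite (_ : random_digraph_prob _ _ = \sum_S wt (pair_wt p) S * (copy_in D0 C X f S)%:R).
  (* Halving suffices, as [1 - (1 - p / 2) ^+ 2 = p - p ^+ 2 / 4]. *)
  apply: symmetrize => //.
    by move=> B e; apply: copy_in_pair asym B e.
  nra.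
rewrite -random_digraph_prob_wt; apply: eq_bigl => D; exact: erefl.
Qed.

End CopyProbability.

(** * Numerical estimates *)

Section Scales.
Variable R : realType.

Lemma loglog_large (Y : R) : exists n0 : nat, forall n : nat, (n0 <= n)%N ->
  Y <= ln (ln (n%:R : R)).
Proof.
exists (Num.truncn (expR (expR Y))).+1 => n hn.
have h : expR (expR Y) <= n%:R.
  apply: (@le_trans _ _ (Num.truncn (expR (expR Y))).+1%:R).
    by apply/ltW/truncnS_gt.
  by rewrite ler_nat.
have n0 : 0 < (n%:R : R) by apply: lt_le_trans h; apply: expR_gt0.
have l1 : expR Y <= ln (n%:R : R) by rewrite -[leLHS]expRK ler_ln ?posrE ?expR_gt0.
have l0 : 0 < ln (n%:R : R) by apply: lt_le_trans l1; apply: expR_gt0.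
by rewrite -[leLHS]expRK ler_ln ?posrE ?expR_gt0.
Qed.

(* With [s = exp (y / 12)] the powers of [ln n] in the definition of
   pseudorandomness become integral powers of [s]. *)
Lemma scales (n : nat) (y := ln (ln (n%:R : R))) : 10 ^+ 9 <= y ->
  exists s : R, [/\ 10 ^+ 7 <= s, ln n%:R = s ^+ 12, y <= 12 * s,
    [/\ ln n%:R `^ (2 / 3) = s ^+ 8, ln n%:R `^ (1 / 3) = s ^+ 4,
        (s ^+ 12) ^+ 2 <= n%:R & s ^+ 3 = expR (y / 4)] &
    [/\ (n%:R : R) `^ (3 / 4) * s ^+ 12 <= n%:R, expR (s ^+ 12) = n%:R &
        expR y = s ^+ 12]].
Proof.
move=> hy; pose L := ln (n%:R : R).
have y0 : 0 < y by apply: lt_le_trans hy; rewrite exprn_gt0.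
have L1 : 1 < L.
  rewrite ltNge; apply/negP => L1; have := ln_le0 L1; rewrite -/y.
  by move=> y1; have := lt_le_trans y0 y1; rewrite ltxx.
have L0 : 0 < L by apply: lt_trans L1.
have n1 : 0 < (n%:R : R).
  rewrite ltr0n lt0n; apply/negP => /eqP n0; move: L0.
  by rewrite /L n0 ln0 // ltxx.
have eL : expR L = n%:R by rewrite /L lnK.
have ey : expR y = L by rewrite /y lnK.
pose s := expR (y / 12).
have sX k : s ^+ k = expR (k%:R * (y / 12)) by rewrite expRM_natl.
have sL : L = s ^+ 12 by rewrite sX mulrC divfK ?ey // pnatr_eq0.
have hs : 1 + y / 12 <= s by apply: expR_ge1Dx.
have s7 : 10 ^+ 7 <= s by apply: le_trans hs; lra.
have pw x : L `^ x = expR (x * y) by rewrite /powR gt_eqF.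
have L8 : 1 + L / 8 <= expR (L / 8) by apply: expR_ge1Dx.
have LL : L <= expR (L / 4).
  have -> : L / 4 = L / 8 + L / 8 by lra.
  have L48 : 48 <= L by rewrite -ey; apply: le_trans (expR_ge1Dx _); lra.
  rewrite expRD; apply: (@le_trans _ _ ((1 + L / 8) * (1 + L / 8))).
    nra.
  by apply: ler_pM => //; lra.
exists s; split=> //; first by apply: le_trans (_ : 12 * (1 + y / 12) <= _); lra.
  split.
  - by rewrite pw sX; congr expR; lra.
  - by rewrite pw sX; congr expR; lra.
  - have L2 : L <= expR (L / 2) by apply: le_trans LL _; rewrite ler_expR; lra.
    have -> : n%:R = expR (L / 2) * expR (L / 2) by rewrite -expRD -eL; congr expR; lra.
    by rewrite -sL expr2; apply: ler_pM => //; apply: ltW.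
  - by rewrite sX; congr expR; lra.
split; rewrite -?sL //.
rewrite /powR gt_eqF // -/L -[leRHS]eL.
have -> : expR L = expR (3 / 4 * L) * expR (L / 4) by rewrite -expRD; congr expR; lra.
by apply: ler_wpM2l => //; apply: expR_ge0.
Qed.

Lemma pow_le_expR (x : R) k : 0 <= x <= 1 -> (1 - x) ^+ k <= expR (- (k%:R * x)).
Proof.
move=> /andP [x0 x1]; rewrite -mulrN expRM_natl.
by apply: lerXn2r; rewrite ?nnegrE ?subr_ge0 ?expR_ge0 //; apply: expR_ge1Dx.
Qed.

Lemma pow1_le_expR (x : R) k : 0 <= x -> (1 + x) ^+ k <= expR (k%:R * x).
Proof.
move=> x0; rewrite expRM_natl.
by apply: lerXn2r; rewrite ?nnegrE ?addr_ge0 ?expR_ge0 //; apply: expR_ge1Dx.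
Qed.

(** Put [x = L / (2000 N)]. In the first term [m b x] is at least [10^5 N / 22000 > 4 N], against
    [4 ^ n <= exp (2 N)]. In the second, [z = 1 / L] contributes [exp ((n + 1) y)] and
    [exp (N / 2000)], while [h x >= L N / (5 * 10^5) >= (2 y + 3) N]. *)
Lemma failure_bound (n m b h : nat) (L y : R) (N := (n%:R : R)) :
  0 < N -> 1 < L -> L <= N -> expR y = L -> 0 <= y -> 5 * 10 ^+ 5 * (2 * y + 3) <= L ->
  10 ^+ 5 * N <= m%:R * L -> N / 11 <= b%:R -> N ^+ 2 / 250 <= h%:R -> 1 <= N ->
  4 ^+ n * (1 - L / (10 ^+ 3 * N) / 2) ^+ (m * b) +
  L^-1 ^- n.+1 * (1 + L / (10 ^+ 3 * N) / 2 * L^-1) ^+ (n * n) *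
    (1 - L / (10 ^+ 3 * N) / 2) ^+ h <= 2 * expR (- (2 * N)).
Proof.
move=> N0 L1 LN ey y0 yL mL bN hN N1.
pose x := L / (10 ^+ 3 * N) / 2; rewrite -/x.
have L0 : 0 < L by apply: lt_trans L1.
have xN : x * N = L / (2 * 10 ^+ 3).
  by rewrite /x; field; rewrite gt_eqF.
have x0 : 0 <= x by rewrite /x !divr_ge0 ?mulr_ge0 ?exprn_ge0 // ltW.
have x1 : x <= 1.
  rewrite -(ler_pM2r N0) xN mul1r; lra.
have xx : 0 <= x <= 1 by rewrite x0 x1.
rewrite mulr_natl mulr2n; apply: lerD.
  have e4 : 4 ^+ n <= expR (2 * N).
    rewrite mulrC /N expRM_natl; apply: lerXn2r; rewrite ?nnegrE ?expR_ge0 //.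
    have -> : (2 : R) = 1 + 1 by lra.
    rewrite expRD; have : 1 + 1 <= expR 1 :> R by apply: expR_ge1Dx.
    move: (expR 1) => e; nra.
  apply: (@le_trans _ _ (expR (2 * N) * expR (- ((m * b)%:R * x)))).
    apply: ler_pM; [exact: exprn_ge0| |exact: e4|exact: pow_le_expR].
    by rewrite exprn_ge0 // subr_ge0.
  rewrite -expRD ler_expR natrM.
  have : 4 * N <= m%:R * b%:R * x; last by lra.
  have h1 : 10 ^+ 5 * N * (N / 11) <= m%:R * L * b%:R.
    by apply: ler_pM => //; lra.
  rewrite -(ler_pM2r N0) -[leRHS]mulrA xN.
  have -> : m%:R * b%:R * (L / (2 * 10 ^+ 3)) = m%:R * L * b%:R / (2 * 10 ^+ 3) by lra.
  move: (m%:R * L * b%:R) h1 => v; nra.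
rewrite exprVn invrK -ey -expRM_natl.
have b2 : (1 + x * (expR y)^-1) ^+ (n * n) <= expR (N / (2 * 10 ^+ 3)).
  apply: le_trans (pow1_le_expR _ _) _; first by rewrite mulr_ge0 // invr_ge0 expR_ge0.
  rewrite ler_expR natrM -/N mulrA -[X in X / _]mulrA [N * x]mulrC xN ey.
  by rewrite [N * (L / (2 * 10 ^+ 3))]mulrA mulrAC mulfK ?gt_eqF.
have b3 : (1 - x) ^+ h <= expR (- (L * N / (5 * 10 ^+ 5))).
  apply: le_trans (pow_le_expR _ xx) _; rewrite ler_expR lerN2.
  rewrite -(ler_pM2r N0) -[leRHS]mulrA xN.
  have : L / (2 * 10 ^+ 3) * (N ^+ 2 / 250) <= L / (2 * 10 ^+ 3) * h%:R by apply: ler_wpM2l => //; lra.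
  lra.
apply: (@le_trans _ _ (expR (n.+1%:R * y) * expR (N / (2 * 10 ^+ 3)) * expR (- (L * N / (5 * 10 ^+ 5))))).
  apply: ler_pM => //; rewrite ?exprn_ge0 ?subr_ge0 //.
    by rewrite mulr_ge0 ?expR_ge0 ?exprn_ge0 // addr_ge0 // mulr_ge0 // invr_ge0 expR_ge0.
  by apply: ler_wpM2l => //; apply: expR_ge0.
rewrite -!expRD ler_expR -natr1 -/N.
nra.
Qed.

End Scales.

(** * Choice of the constants *)

Section ChoiceOfConstants.
Variable R : realType.

(** Here [u = N / L] and [a] is the cube root of [L]. Terms of order [u], [u a] or [u L / y] are
    negligible against [N = u a^3]. What counts is [sp] and [b], about [n / 10] each, and [w], about
    [n / 2]: in tenths of [n] the first four inequalities read [1 < 10], [6 < 10], [3 <= 5] and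
    [6 <= 10]. *)
Lemma nat_bounds (n x sp rho r t m b w : nat) (N L y a u : R) :
  N = n%:R -> L = a ^+ 3 -> N = u * L -> L <= u -> 10 ^+ 9 <= y -> y <= a -> 10 ^+ 20 <= a ->
  x%:R <= u -> sp%:R <= N / 10 + 1 ->
  rho%:R <= a < rho.+1%:R -> r = rho./2 ->
  4 * (L / y) < t%:R <= 4 * (L / y) + 1 ->
  10 ^+ 5 * u < m%:R <= 10 ^+ 5 * u + 1 ->
  b = (n %/ 10)%N -> w = (n %/ 2)%N ->
  let z := (x + m)%N in let K := ((4 * z + m).*2)%N in
  let Lmax := (t.+1 + sp + (4 * t + 3) * z)%N in
  [/\ (x + b + r.*2.+1 * (K + m) < n)%N, (z + K + b + w + K * r < n)%N,
      (4 * z + Lmax.+1 + m.*2 + b.*2 <= w)%N,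
      (b * 3 + 3 + b.*2 + (Lmax + t.+1) <= n)%N &
      [/\ (t.+1 + sp <= n)%N, z%:R <= N * y / L, (4 * t + 3)%:R <= 20 * L / y,
          (8 <= rho)%N & (7 <= r)%N /\ a / 4 <= r%:R]].
Proof.
move=> eN eL eu Lu y9 ya a20 xu spN /andP [rho1 rho2] er /andP [t1 t2] /andP [m1 m2] eb ew z K Lmax.
have y0 : 0 < y by lra.
have a0 : 0 < a by lra.
have L0 : 0 < L by rewrite eL exprn_gt0.
pose v := L / y.
have vy : v * y = L by rewrite /v divfK // gt_eqF.
have aa : 10 ^+ 20 * a <= a * a by apply: ler_wpM2r => //; lra.
have La : a * a * a = L by rewrite eL; ring.
have Laa : 10 ^+ 20 * (a * a) <= L.
  by rewrite -La -[leRHS]mulrA; apply: ler_wpM2r => //; apply: mulr_ge0; lra.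
have v0 : a * a <= v by rewrite /v ler_pdivlMr // -La; apply: ler_wpM2l => //; lra.
have vL : 10 ^+ 9 * v <= L by rewrite -vy mulrC; apply: ler_wpM2l => //; lra.
have u0 : 0 < u by lra.
have ua : 10 ^+ 20 * u <= u * a by rewrite mulrC; apply: ler_wpM2l => //; lra.
have Nua : 10 ^+ 20 * (u * a) <= N.
  rewrite eu mulrCA; apply: ler_wpM2l; first lra.
  by apply: le_trans _ Laa; apply: ler_wpM2l; lra.
have uv : 10 ^+ 9 * (v * u) <= N.
  by rewrite eu mulrA mulrC; apply: ler_wpM2l => //; lra.
have rho_r : (rho = r.*2 \/ rho = r.*2.+1)%N.
  by rewrite er; move: (odd_double_half rho); case: (odd rho); clear; lia.
have r1 : 2 * (r%:R : R) <= a /\ a <= 2 * r%:R + 2.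
  case: rho_r => e; move: rho1 rho2; rewrite e -!natr1 -muln2 !natrM; lra.
have b1 : 10 * (b%:R : R) <= N <= 10 * b%:R + 9.
  have h1 : (10 * b <= n)%N by rewrite eb mulnC leq_trunc_div.
  have h2 : (n <= 10 * b + 9)%N.
    by rewrite eb; move: (divn_eq n 10) (ltn_pmod n (isT : 0 < 10)%N); clear; lia.
  rewrite eN; move: h1 h2; rewrite -!(ler_nat R) natrD !natrM => -> -> //.
have w1 : 2 * (w%:R : R) <= N <= 2 * w%:R + 1.
  have h1 : (2 * w <= n)%N by rewrite ew mulnC leq_trunc_div.
  have h2 : (n <= 2 * w + 1)%N.
    by rewrite ew; move: (divn_eq n 2) (ltn_pmod n (isT : 0 < 2)%N); clear; lia.
  rewrite eN; move: h1 h2; rewrite -!(ler_nat R) natrD !natrM => -> -> //.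
have zR : (z%:R : R) = x%:R + m%:R by rewrite /z natrD.
have KR : (K%:R : R) = 2 * (4 * z%:R + m%:R) by rewrite /K -muln2 natrM natrD natrM mulrC.
have u1 : 1 <= u by move: Lu Laa aa a20; clear; lra.
have z1 : (z%:R : R) <= 2 * 10 ^+ 5 * u by rewrite zR; move: xu m2 u1; clear; lra.
have K1 : (K%:R : R) <= 10 ^+ 7 * u by rewrite KR; move: z1 m2 u1; clear; lra.
have t3 : (4 * t + 3)%:R <= 20 * v by rewrite natrD natrM; move: t2 v0 aa a20; rewrite -/v; clear; lra.
have tz : ((4 * t + 3) * z)%:R <= 4 * 10 ^+ 6 * (v * u) :> R.
  rewrite natrM; apply: (@le_trans _ _ ((20 * v) * (2 * 10 ^+ 5 * u))).
    by apply: ler_pM.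
  by lra.
have LmR : (Lmax%:R : R) = t%:R + 1 + sp%:R + ((4 * t + 3) * z)%:R.
  by rewrite /Lmax 2!natrD -natr1.
have tu : (t%:R : R) <= u by move: t2 v0 aa a20 vL Lu; rewrite -/v; clear; lra.
have Kr : (K * r)%:R <= 10 ^+ 7 * (u * a) :> R.
  rewrite natrM; apply: (@le_trans _ _ (10 ^+ 7 * u * a)); last by rewrite mulrA.
  by apply: ler_pM => //; move: r1 a0; clear; lra.
have rK : (r.*2.+1 * (K + m))%:R <= 10 ^+ 8 * (u * a) :> R.
  rewrite natrM; apply: (@le_trans _ _ ((a + 1) * (2 * 10 ^+ 7 * u))).
    apply: ler_pM => //; first by rewrite -natr1 -muln2 natrM; move: r1; clear; lra.
    by rewrite natrD; move: K1 m2 u1; clear; lra.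
  by move: ua u1; clear; lra.
have [b2 b3] := andP b1; have [w2 w3] := andP w1.
split.
- by rewrite -(ltr_nat R) 2!natrD -eN; move: xu b2 rK ua Nua u1; clear; lra.
- by rewrite -(ltr_nat R) 4!natrD -eN; move: z1 K1 b2 w2 Kr ua Nua u1; clear; lra.
- rewrite -(ler_nat R) 3!natrD natrM -[Lmax.+1%:R]natr1 LmR -!muln2 !natrM.
  by move: z1 tu spN tz uv m2 b2 w3 ua Nua u1; clear; lra.
- rewrite -(ler_nat R) 4!natrD natrM LmR -muln2 natrM -natr1 -eN.
  by move: tu spN tz uv b2 ua Nua u1; clear; lra.
split.
- by rewrite -(ler_nat R) natrD -natr1 -eN; move: tu spN ua Nua u1; clear; lra.
- have -> : N * y / L = u * y by rewrite eu mulrAC mulfK // gt_eqF.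
  have : 10 ^+ 9 * u <= u * y by rewrite mulrC; apply: ler_wpM2l => //; apply: ltW.
  by move: z1 u0; clear; lra.
- by rewrite -mulrA.
- by rewrite -(ler_nat R); move: rho2 a20; rewrite -natr1; clear; lra.
- by split; [rewrite -(ler_nat R)|]; move: r1 a20; clear; lra.
Qed.

End ChoiceOfConstants.

Lemma truncn_next (R : realType) (x : R) : 0 <= x ->
  x < (Num.truncn x).+1%:R <= x + 1.
Proof.
move=> x0; have /andP [h1 h2] := truncn_itv x0; rewrite h2 /= -natr1.
by rewrite lerD2r.
Qed.

Lemma random_digraph_prob_le (R : realType) (V : finType) (p : R) (E E' : pred (digraph V)) :
  0 <= p <= 1 -> (forall D, E D -> E' D) ->
  random_digraph_prob p E <= random_digraph_prob p E'.
Proof.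
move=> /andP [p0 p1] EE'; rewrite /random_digraph_prob big_mkcond [leRHS]big_mkcond.
apply: ler_sum => D _; have pm : 0 <= random_digraph_pmf p D.
  by apply: prodr_ge0 => e _; case: ifP; rewrite ?subr_ge0.
by case: ifP => [/EE' ->//|_]; case: ifP.
Qed.

(** The degree condition is weakened by 1 so that a vertex may be pinned when the given exceptional
    set is empty. *)
Lemma nonempty_case (R : realType) (n : nat) (N := n%:R : R) (D0 : digraph 'I_n)
    (X : {set 'I_n}) (W : finType) (C : digraph W) (P : seq W) (f : 'I_n -> W) :
  10 ^+ 9 <= ln (ln N) -> X != set0 -> #|X|%:R * ln N <= N ->
  (forall s v, ln N / 500 - 1 <= (deg_in D0 s v (~: X))%:R) ->
  (forall (A B : {set 'I_n}) (s : sign),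
    #|A|%:R <= N * ln (ln N) / ln N ->
    (forall v, v \in A -> ln N `^ (2 / 3) <= (deg_in D0 s v B)%:R) ->
    #|A|%:R * ln N `^ (1 / 3) <= #|B|%:R) ->
  #|W| = n -> oriented_cycle C -> path_in C P -> (path_length P)%:R <= N / 10 ->
  (forall x, x \in X -> f x \in P) ->
  (forall x y, x \in X -> y \in X -> x != y ->
     20 * ln N / ln (ln N) <= (path_dist P (f x) (f y))%:R) ->
  1 - 2 * expR (- (2 * N)) <=
  random_digraph_prob (ln N / (10 ^+ 3 * N)) (fun D1 => has_copy (dunion D0 D1) C X f).
Proof.
move=> y9 X0 Xs hmin hexp cW [[s0 cs0] asym] /and3P [P0 uP soP] lenP fP gapP.
have [s [s7 Ls ys [L23 L13 L2N s3] [_ eL ey]]] := scales y9.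
rewrite -/N in Ls L2N eL ys ey s3.
set L := ln N in Xs hmin hexp gapP Ls ys ey s3 L23 L13 *.
set y := ln L in y9 ys ey s3 hexp gapP *.
pose a := s ^+ 4; pose u := N / L.
have a20 : 10 ^+ 20 <= a.
  have h : (10 ^+ 7) ^+ 4 <= a by apply: lerXn2r; rewrite ?nnegrE; lra.
  lra.
have y0 : 0 < y by move: y9; clear; lra.
have ey' : L = expR y by rewrite ey.
have La : L = a ^+ 3 by rewrite Ls /a -exprM.
have s0' : 0 <= s by lra.
have sa : 10 ^+ 21 * s <= a.
  have : (10 ^+ 7) ^+ 3 <= s ^+ 3 by apply: lerXn2r; rewrite ?nnegrE; lra.
  have -> : a = s ^+ 3 * s by rewrite /a -exprSr.
  by move=> h; apply: ler_wpM2r => //; lra.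
have ya : y <= a by lra.
have L0 : 0 < L by rewrite La exprn_gt0 //; lra.
have N0 : 0 < N by apply: lt_le_trans L2N; rewrite -Ls exprn_gt0.
have eu : N = u * L by rewrite /u divfK // gt_eqF.
have Lu : L <= u by rewrite /u ler_pdivlMr // -expr2 Ls.
have xu : #|X|%:R <= u by rewrite /u ler_pdivlMr.
have sp : (size P)%:R <= N / 10 + 1.
  have szP : (0 < size P)%N by case: (P) P0.
  by move: lenP; rewrite /path_length => h; rewrite -(prednK szP) -natr1; lra.
have Laa : 10 ^+ 20 * (a ^+ 2) <= L by rewrite La exprS; apply: ler_wpM2r => //; apply: exprn_ge0; lra.
have aa : 10 ^+ 20 * a <= a ^+ 2 by rewrite expr2; apply: ler_wpM2r => //; lra.
have L1 : 1 < L by lra.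
have LN : L <= N by apply: le_trans L2N; rewrite -Ls expr2 ler_peMr // ltW.
pose rho := Num.truncn a; pose r := rho./2.
have rhoP : rho%:R <= a < rho.+1%:R by apply: truncn_itv; lra.
(* Since [r >= exp (y / 4)], this gives [n <= r ^ t]; and [4 * t + 3 <= 20 * L / y] turns the
   distances on [P] into the required gaps. *)
pose t := (Num.truncn (4 * (L / y))).+1.
have tP : 4 * (L / y) < t%:R <= 4 * (L / y) + 1.
  by apply: truncn_next; rewrite mulr_ge0 // divr_ge0 // ltW.
pose m := (Num.truncn (10 ^+ 5 * u)).+1.
have u0 : 0 < u := lt_le_trans L0 Lu.
have mP : 10 ^+ 5 * u < m%:R <= 10 ^+ 5 * u + 1.
  by apply: truncn_next; rewrite mulr_ge0 ?exprn_ge0 // ltW.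
(* Just above the power 2/3 of [L], so that [q] neighbours trigger the expansion of [D0]; [q.*2] is
   still below [L / 500 - 1]. *)
pose q := (Num.truncn (s ^+ 8)).+1.
have /andP [q1 q2] : s ^+ 8 < q%:R <= s ^+ 8 + 1 by apply: truncn_next; apply: exprn_ge0.
pose b := (n %/ 10)%N.
have [n1 n2 n3 n4 [n5 zN t3 rho8 [r7 ar]]] := nat_bounds (erefl N) La eu Lu y9 ya a20 xu sp rhoP
  (erefl r) tP mP (erefl b) (erefl (n %/ 2)%N).
have [ss0 sz0 fs0 _] := cs0.
have szn : size s0 = n by have /card_uniqP <- := ss0; rewrite -cW; apply: eq_card => w; rewrite fs0.
have [sW csW iW] : exists2 sW, cyclic_order (uedge C) sW &
    forall w, w \in P -> index w sW = (t.+1 + index w P)%N.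
  by apply: cyclic_order_shift cs0 uP soP _; rewrite szn.
have szW : size sW = n.
  by have [uW _ fW _] := csW; have /card_uniqP <- := uW; rewrite -cW; apply: eq_card => w; rewrite fW.
have /andP [t1 t2] := tP; have /andP [m1 m2] := mP.
have rt : (n <= r ^ t)%N.
  rewrite -(ler_nat R) -/N -eL natrX.
  have a3 : expR (y / 4) <= r%:R.
    rewrite -s3; apply: le_trans ar.
    have -> : a / 4 = s ^+ 3 * (s / 4) by rewrite mulrA -exprSr.
    by rewrite ler_peMr ?exprn_ge0 //; move: s7; clear; lra.
  apply: (@le_trans _ _ (expR (y / 4) ^+ t)); last by apply: lerXn2r; rewrite ?nnegrE ?expR_ge0.
  rewrite -expRM_natl ler_expR -Ls.
  have : 4 * (L / y) * (y / 4) <= t%:R * (y / 4).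
    by apply: ler_wpM2r; [rewrite divr_ge0 // ltW|exact: ltW].
  have -> : 4 * (L / y) * (y / 4) = L by field; rewrite gt_eqF.
  by [].
have mt : (0 < m <= r ^ t)%N.
  apply/andP; split=> //; apply: leq_trans rt.
  apply: leq_trans (ltnW n1); rewrite mulSn; clear; lia.
have b1 : N <= 10 * b%:R + 9.
  have : (n <= 10 * b + 9)%N.
    by rewrite /b; move: (divn_eq n 10) (ltn_pmod n (isT : 0 < 10)%N); clear; lia.
  by rewrite -(ler_nat R) natrD natrM.
have N20 : 10 ^+ 20 <= N by apply: le_trans LN; move: Laa aa a20; clear; lra.
have bt : (0 < b <= r ^ t)%N.
  rewrite -(ltr0n R); apply/andP; split; first by move: b1 N20; clear; lra.
  by apply: leq_trans rt; apply: leq_div.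
(* [b] also serves as [c], so half of [b ^ 2] pairs are boosters below the diagonal: about
   [N^2 / 200]. *)
pose h := ((b ^ 2)./2)%N.
have hc : (h.*2 <= b ^ 2)%N by rewrite /h -[leqRHS]odd_double_half leq_addl.
have hN : N ^+ 2 / 250 <= h%:R.
  have : (b ^ 2 <= h * 2 + 1)%N.
    by rewrite /h muln2 -{1}[(b ^ 2)%N]odd_double_half addnC leq_add2l leq_b1.
  rewrite -(ler_nat R) natrD natrM natrX => hb.
  have bb : N / 11 <= b%:R by move: b1 N20; clear; lra.
  have bsq : (N * 2 / 21) ^+ 2 <= b%:R ^+ 2.
    by apply: lerXn2r; rewrite ?nnegrE //; move: b1 N20 N0; clear; lra.
  have NN : 1 * N <= N * N by apply: ler_wpM2r; move: N20 N0; clear; lra.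
  by move: bsq hb NN N20; rewrite !expr2; clear; lra.
have sadjE sg v (B : {set 'I_n}) :
    [set w in B | sadj D0 sg v w] = nbhd D0 (if sg then Plus else Minus) v :&: B.
  by apply/setP => w; case: sg; rewrite !inE andbC.
have mind sg v : (q.*2 <= #|[set w | sadj D0 sg v w & w \notin X]|)%N.
  have -> : [set w | sadj D0 sg v w & w \notin X] = [set w in ~: X | sadj D0 sg v w].
    by apply/setP => w; rewrite !inE andbC.
  rewrite sadjE -(ler_nat R); apply: le_trans (hmin _ v).
  have -> : L = a * s ^+ 8 by rewrite Ls /a -exprD.
  have s8 : 1 <= s ^+ 8 by apply: exprn_ege1; move: s7; clear; lra.
  have : 10 ^+ 20 * s ^+ 8 <= a * s ^+ 8 by apply: ler_wpM2r => //; apply: exprn_ge0.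
  by rewrite -muln2 natrM; move: q2 s8; clear; lra.
have exp (A B : {set 'I_n}) sg : (#|A| <= #|X| + m)%N ->
    (forall v, v \in A -> (q <= #|[set w in B | sadj D0 sg v w]|)%N) ->
    (rho * #|A| <= #|B|)%N.
  move=> Az hA; rewrite -(ler_nat R) natrM mulrC.
  apply: le_trans (hexp A B (if sg then Plus else Minus) _ _).
  - by rewrite L13; apply: ler_wpM2l => //; case/andP: rhoP.
  - by apply: le_trans zN; rewrite ler_nat.
  - move=> v /hA; rewrite sadjE L23 -(ler_nat R) => hq; apply: le_trans hq; exact: ltW.
have tp x : x \in X -> (t < index (f x) sW <= t.+1 + size P)%N.
  move=> xX; rewrite iW ?fP // leq_addr leq_add2l ltnW // index_mem; exact: fP.
have gap x x' : x \in X -> x' \in X -> x != x' ->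
    (index (f x) sW + (4 * t + 3) <= index (f x') sW)%N \/
    (index (f x') sW + (4 * t + 3) <= index (f x) sW)%N.
  move=> xX x'X xx'; rewrite !iW ?fP //.
  have : (4 * t + 3 <= path_dist P (f x) (f x'))%N.
    by rewrite -(ler_nat R); apply: le_trans (gapP _ _ xX x'X xx').
  rewrite /path_dist; clear; lia.
have rrho : (r.*2 <= rho)%N by rewrite /r -[leqRHS]odd_double_half leq_addl.
have p01 : 0 <= L / (10 ^+ 3 * N) <= 1.
  apply/andP; split; first by rewrite divr_ge0 ?mulr_ge0 ?exprn_ge0 // ltW.
  by rewrite ler_pdivrMr ?mulr_gt0 ?exprn_gt0 //; move: LN N0; clear; lra.
have z01 : 0 < L^-1 <= 1 by rewrite invr_gt0 L0 invf_le1 // ltW.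
case: (P) P0 => [//|w0 _] _.
apply: le_trans (copy_probability w0 asym csW szW mind exp X0 tp gap rho8 rrho r7 (leqnn _)
  mt bt n1 n2 n3 n4 hc p01 z01).
rewrite lerD2l lerN2; apply: (failure_bound N0 L1 LN (esym ey') (ltW y0)) => //.
- by move: ys sa Laa aa s7; clear; lra.
- by have -> : 10 ^+ 5 * N = 10 ^+ 5 * u * L; [rewrite -mulrA -eu|apply: ler_wpM2r; apply: ltW].
- by move: b1 N20; clear; lra.
- by move: N20; clear; lra.
Qed.

Theorem theorem2p3 (R : realType) :
  exists n0 : nat, forall n : nat, (n0 <= n)%N ->
  forall (D0 : digraph 'I_n) (X : {set 'I_n}),
    (#|X|%:R : R) <= n%:R `^ (3 / 4) ->
    pseudorandom R D0 X ->
  forall (W : finType) (C : digraph W),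
    #|W| = n ->
    oriented_cycle C ->
  forall P : seq W,
    path_in C P ->
    ((path_length P)%:R : R) <= n%:R / 10 ->
  forall f : 'I_n -> W,
    (forall x, x \in X -> f x \in P) ->
    {in X &, injective f} ->
    (forall x y, x \in X -> y \in X -> x != y ->
       20 * ln (n%:R : R) / ln (ln n%:R) <= (path_dist P (f x) (f y))%:R) ->
  1 - 2 * expR (- (2 * n%:R) : R) <=
    random_digraph_prob (ln (n%:R : R) / (10 ^+ 3 * n%:R))
      (fun D1 : digraph 'I_n => has_copy (dunion D0 D1) C X f).
Proof.
have [n0 hn0] := loglog_large (10 ^+ 9 : R).
exists n0 => n /hn0 y9 D0 X Xs [_ hmin hexp] W C cW oC P PC lenP f fP _ gapP.
rewrite card_ord in hmin hexp.
have [s [s7 Ls _ [_ _ L2N _] [XN eL _]]] := scales y9.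
have L0 : 0 < ln (n%:R : R) by rewrite Ls exprn_gt0 //; lra.
have [X0|X0] := eqVneq X set0; last first.
  apply: (@nonempty_case R n D0 X W C P f) => //.
    by apply: le_trans XN; rewrite -Ls; apply: ler_wpM2r => //; apply: ltW.
  by move=> sg v; apply: le_trans (hmin sg v); lra.
have ngt0 : (0 < n)%N.
  by rewrite lt0n; apply/negP => /eqP n00; move: L0; rewrite n00 ln0 // ltxx.
have L12 : 1 <= s ^+ 12 by apply: exprn_ege1; lra.
have LN : ln (n%:R : R) <= n%:R by rewrite Ls; apply: le_trans L2N; rewrite expr2; nra.
(* The skeleton path starts from a root, so pin an arbitrary vertex. *)
pose u0 : 'I_n := Ordinal ngt0.
case: P PC lenP fP gapP => [//|w0 P] PC lenP _ _.
apply: (@le_trans _ _ (random_digraph_prob (ln (n%:R : R) / (10 ^+ 3 * n%:R))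
  (fun D1 : digraph 'I_n => has_copy (dunion D0 D1) C [set u0] (fun _ => w0)))).
  apply: (@nonempty_case R n D0 [set u0] W C (w0 :: P) (fun _ => w0)) => //.
  - by apply/set0Pn; exists u0; rewrite inE.
  - by rewrite cards1 mul1r.
  - move=> sg v; rewrite lerBlDr; apply: le_trans (hmin sg v) _.
    rewrite natr1 ler_nat /deg_in X0 setC0 setIT.
    rewrite (cardsD1 u0 (nbhd D0 sg v)) -setDE addnC -addn1.
    by rewrite leq_add2l leq_b1.
  - by move=> x _; apply: mem_head.
  - by move=> x x' /set1P -> /set1P ->; rewrite eqxx.
have nR : 0 < (n%:R : R) by rewrite ltr0n.
apply: random_digraph_prob_le.
  apply/andP; split; first by rewrite divr_ge0 ?mulr_ge0 ?exprn_ge0 // ltW.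
  by rewrite ler_pdivrMr ?mulr_gt0 ?exprn_gt0 //; lra.
move=> D /existsP [phi /and3P [h1 h2 _]]; apply/existsP; exists phi.
by rewrite h1 h2 X0 /=; apply/forall_inP => x; rewrite inE.
Qed.
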